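(* Let $I\mapsto X_I$ be the free Poisson process and $X=X_A$. Let $\pi\in NC(k)$ be a partition with the following property: if $U,V$ are inner classes of $\pi$ covered by a class $W$ and such that $u<v$ for all $u\in U$, $v\in V$, then there exists $w\in W$ such that $u<w<v$ for all $u\in U$, $v\in V$. Then $$\mathrm{Pr}_\pi(A)=X^{o(\pi)}\,(1+|A|)^{i(\pi)} .$$
   Context: $\mathcal A$ is a finite von Neumann algebra with faithful normal tracial state $\varphi$. The free Poisson process is a map $I\mapsto X_I$ from finite half-open intervals $I=[a,b)\subset\mathbb R$ to self-adjoint elements of $\mathcal A$ (extended additively to finite disjoint unions) such that the $X_I$ for disjoint $I$ are freely independent, $X_{I_1}+X_{I_2}=X_J$ when $J=I_1\sqcup I_2$, and all free cumulants of $X_I$ are equal to $|I|$. $A$ is a finite union of half-open intervals with total length $|A|$. For each $N$, $X_1^{(N)},\dots,X_N^{(N)}\in\mathcal A$ are self-adjoint, freely independent, identically distributed, with $\sum_i X_i^{(N)}=X_A$. $NC(k)$ is the lattice of noncrossing partitions of $\{1,\dots,k\}$. The product measure is the operator-norm limit $$\mathrm{Pr}_\pi(A)=\lim_{N\to\infty}\sum X^{(N)}_{i_1}\cdots X^{(N)}_{i_k},$$ the sum being over all $(i_1,\dots,i_k)\in\{1,\dots,N\}^k$ such that $i_a=i_b$ whenever $a,b$ lie in the same class of $\pi$. For distinct classes $B,C$ of a noncrossing $\pi$ write $B>C$ if there are $i,j\in B$, $l\in C$ with $i<l<j$; this is a partial order, and ''$U$ is covered by $W$'' means that $W>U$ with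 no class strictly between them. A class is inner if some other class is greater than it, and outer otherwise. $i(\pi)$ and $o(\pi)$ are the numbers of inner and outer classes of $\pi$. *)

(* Defs.v *)
From HB Require Import structures.
From mathcomp Require Import all_boot all_order all_algebra.
From mathcomp Require Import all_classical all_reals all_analysis.
From mathcomp.real_closed Require Export complex.

Set Implicit Arguments.
Unset Strict Implicit.
Unset Printing Implicit Defensive.

Import Order.TTheory GRing.Theory Num.Theory.
Import numFieldNormedType.Exports.

Local Open Scope classical_set_scope.
Local Open Scope ring_scope.

Section NoncrossingPartitions.
Local Open Scope nat_scope.
Variable k : nat.
Implicit Types (P : {set {set 'I_k}}) (B C U V W : {set 'I_k}).

Definition noncrossing P : bool :=
  finset.partition P [set: 'I_k]%SET &&
  [forall B in P, forall C in P, (B != C) ==>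
     ~~ [exists i in B, exists j in C, exists l in B, exists m in C,
          (i < j) && (j < l) && (l < m)]].

Definition class_gt B C : bool :=
  (B != C) &&
  [exists i in B, exists j in B, exists l in C, (i < l) && (l < j)].

Definition covered_class P U W : bool :=
  class_gt W U && ~~ [exists V in P, class_gt W V && class_gt V U].

Definition inner P U : bool := [exists W in P, class_gt W U].

Definition num_inner P : nat := #|[set U in P | inner P U]%SET|.
Definition num_outer P : nat := #|[set U in P | ~~ inner P U]%SET|.

Definition separated_inner_classes P : Prop :=
  forall U V W, U \in P -> V \in P -> W \in P ->
    inner P U -> inner P V -> covered_class P U W -> covered_class P V W ->
    (forall u v, u \in U -> v \in V -> u < v) ->
    exists2 w, w \in W &
      forall u v, u \in U -> v \in V -> (u < w) && (w < v).

End NoncrossingPartitions.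

Section Commutant.
Variables (R : realType) (H : normedModType R[i]).

Definition bounded_operator (T : H -> H) : Prop := linear T /\ continuous T.

Definition commutant (E : set (H -> H)) : set (H -> H) :=
  [set T | bounded_operator T /\ forall S, E S -> T \o S = S \o T].

End Commutant.

(* A von Neumann algebra is presented as an abstract algebra together with a
   faithful action on a complex Hilbert space, whose image is required to be a
   self-adjoint unital algebra of operators equal to its bicommutant (so that
   every element acts by a bounded linear operator).  The inner product is
   linear in its first argument. *)
Record von_neumann_algebra (R : realType) := VonNeumannAlgebra {
  vn_space : completeNormedModType R[i];
  vn_dot : {dot vn_space for (@Num.conj R[i])};
  vn_dotE : forall x : vn_space, vn_dot x x = `|x| ^+ 2;
  vn_carrier :> algType R[i];
  vn_act : vn_carrier -> vn_space -> vn_space;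
  vn_star : vn_carrier -> vn_carrier;
  vn_act_linear : forall (c : R[i]) (a b : vn_carrier) (x : vn_space),
    vn_act (c *: a + b) x = c *: vn_act a x + vn_act b x;
  vn_act1 : forall x : vn_space, vn_act 1 x = x;
  vn_actM : forall (a b : vn_carrier) (x : vn_space),
    vn_act (a * b) x = vn_act a (vn_act b x);
  vn_act_inj : injective vn_act;
  vn_starE : forall (a : vn_carrier) (x y : vn_space),
    vn_dot (vn_act a x) y = vn_dot x (vn_act (vn_star a) y);
  vn_bicommutant : range vn_act = commutant (commutant (range vn_act))
}.

Section VonNeumann.
Variables (R : realType) (M : von_neumann_algebra R).
Implicit Types (phi : M -> R[i]) (a b s : M) (D : set M).

Definition self_adjoint a : Prop := vn_star a = a.

Definition op_norm a : R :=
  sup [set complex.Re `|vn_act a x| | x in [set x : vn_space M | `|x| <= 1]].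

Definition op_le a b : Prop :=
  forall x : vn_space M, 0 <= vn_dot M (vn_act (b - a) x) x.

Definition op_supremum D s : Prop :=
  (forall a, D a -> op_le a s) /\
  (forall b, (forall a, D a -> op_le a b) -> op_le s b).

(* Normality is preservation of suprema of bounded increasing nets. *)
Definition normal_functional phi : Prop :=
  forall D s, D !=set0 ->
    (forall a, D a -> self_adjoint a) ->
    (forall a b, D a -> D b -> exists c, [/\ D c, op_le a c & op_le b c]) ->
    op_supremum D s -> supremums [set phi a | a in D] (phi s).

(* A von Neumann algebra carrying such a state is automatically finite. *)
Record faithful_normal_tracial_state phi : Prop := {
  state_linear : forall (c : R[i]) a b, phi (c *: a + b) = c * phi a + phi b;
  state_unital : phi 1 = 1;
  state_positive : forall a, 0 <= phi (vn_star a * a);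
  state_tracial : forall a b, phi (a * b) = phi (b * a);
  state_faithful : forall a, phi (vn_star a * a) = 0 -> a = 0;
  state_normal : normal_functional phi
}.

Definition free_subalgebras phi (T : eqType) (B : T -> set M) : Prop :=
  forall s : seq (T * M), s != [::] ->
    sorted (fun u v => u.1 != v.1) s ->
    (forall u, u \in s -> B u.1 u.2 /\ phi u.2 = 0) ->
    phi (\prod_(u <- s) u.2) = 0.

Definition generated_subalgebra a : set M :=
  range (fun p : {poly R[i]} => horner_alg a p).

Definition freely_independent phi (T : eqType) (x : T -> M) : Prop :=
  free_subalgebras phi (fun t => generated_subalgebra (x t)).

Definition same_distribution phi a b : Prop :=
  forall p : {poly R[i]}, phi (horner_alg a p) = phi (horner_alg b p).

(* The moment-cumulant relations determine c 1, c 2, ... (c 0 is irrelevant). *)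
Definition free_cumulants phi a (c : nat -> R[i]) : Prop :=
  forall n : nat, phi (a ^+ n) =
    \sum_(P : {set {set 'I_n}} | noncrossing P) \prod_(B in P) c #|B|.

End VonNeumann.

Section Process.
Variables (R : realType) (M : von_neumann_algebra R).
Implicit Types (phi : M -> R[i]) (X : set R -> M) (I A : set R).

Definition half_open I : Prop := exists a b : R, a < b /\ I = `[a, b[%classic.

Definition finite_union_half_open A : Prop :=
  exists (n : nat) (I : 'I_n -> set R),
    (forall j, half_open (I j)) /\ A = \bigcup_j I j.

Definition total_length A : R := fine (lebesgue_measure A).

(* X is defined on all sets, but only its values on finite unions of half-open
   intervals are constrained.  Additivity includes both the case where the
   union is an interval and the extension of X to finite disjoint unions. *)
Record free_poisson_process phi X : Prop := {
  poisson_self_adjoint : forall I, half_open I -> self_adjoint (X I);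
  poisson_free : forall (n : nat) (I : 'I_n -> set R),
    (forall j, half_open (I j)) -> trivIset setT I ->
    freely_independent phi (fun j => X (I j));
  poisson_additive : forall (n : nat) (I : 'I_n -> set R),
    (forall j, half_open (I j)) -> trivIset setT I ->
    X (\bigcup_j I j) = \sum_(j < n) X (I j);
  poisson_cumulants : forall I, half_open I ->
    free_cumulants phi (X I) (fun=> (total_length I)%:C%C)
}.

Record free_iid_decomposition phi (a : M) (N : nat) (x : 'I_N -> M) : Prop := {
  decomposition_self_adjoint : forall i, self_adjoint (x i);
  decomposition_free : freely_independent phi x;
  decomposition_same_distribution : forall i j,
    same_distribution phi (x i) (x j);
  decomposition_sum : \sum_(i < N) x i = a
}.

Definition product_sum (k : nat) (P : {set {set 'I_k}}) (N : nat)
    (x : 'I_N -> M) : M :=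
  \sum_(i : {ffun 'I_k -> 'I_N} |
      [forall B in P, forall a in B, forall b in B, i a == i b])
    \prod_(j < k) x (i j).

Definition op_norm_cvg (u : nat -> M) (l : M) : Prop :=
  (fun N => op_norm (u N - l)) @ \oo --> (0 : R).

(* p is the product measure Pr_P, the limit along the family x. *)
Definition is_product_measure (k : nat) (P : {set {set 'I_k}})
    (x : forall N, 'I_N -> M) (p : M) : Prop :=
  op_norm_cvg (fun N => product_sum P (x N)) p.

End Process.

(* Main.v *)
Require Import Defs.
From HB Require Import structures.
From mathcomp Require Import all_boot all_order all_algebra.
From mathcomp Require Import all_classical all_reals all_analysis.
From mathcomp Require Import zify ring lra.
Set Implicit Arguments.
Unset Strict Implicit.
Unset Printing Implicit Defensive.
Import Order.TTheory GRing.Theory Num.Theory.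
Import numFieldNormedType.Exports.
Local Open Scope ring_scope.

(* Let l_1, ..., l_N be the creation operators of the full Fock space over C^N
   and c_i = l_i + sqrt (|A| / N).  The operators c_i c_i^* have, in the vacuum
   state, the joint moments of the x_i, and since the norm of an element of M is
   governed by its moments under the faithful trace, it suffices to bound
   operators of the model.  There Y = \sum_i c_i c_i^* is bounded,
   c_i^* c_i = 1 + O(N^(-1/2)) and c_i^* Y c_i = 1 + |A| + O(N^(-1/2)), while
   \sum_i c_i E_i c_i^* is at most a constant times the supremum of the E_i.
   The hypothesis on the partition says that each gap of a class W contains at
   most one class covered by W; hence, by induction from the inside out, a class
   with j classes below it contributes
   \sum_i c_i (c_i^* G_1 c_i) (c_i^* G_2 c_i) ... c_i^*, where each G is either 1
   or close to a multiple of Y, and this is close to (1 + |A|)^j Y. *)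

(** * Elements of M as operators *)

Section RealForm.
Local Open Scope classical_set_scope.
Local Open Scope ring_scope.
Variables (R : realType) (M : von_neumann_algebra R).
Local Notation H := (vn_space M).
Local Notation Re := (@complex.Re R).
Implicit Types (a b c : M) (x y z : H) (r t : R).

(** The law of the x_i is not given, only that of their sum. It is recovered degree by degree: among
    the words occurring in the (n + 1)-st moment of the sum, only the constant ones involve a moment
    not yet known, and all of these have the same one. The cumulants of the process are turned into
    moments of a Jacobi matrix by inserting the points of a noncrossing partition one at a time.
    Passing from moments under the trace to norms requires a positive part inside M; it is built
    from square roots, which are limits of iterations and belong to M by the bicommutant condition.
    Vectors of the model are arbitrary functions on words, so operators there have no adjoints.
    Hence the difference u between a product sum and its claimed limit is estimated together with
    its adjoint, which is of the same kind for the reversed word. All estimates concern squared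
    norms, so errors of order 1/N there mean convergence at rate N^(-1/2). Outer classes stand side
    by side and contribute one factor Y each; this is where the power of X comes from. *)

Lemma Re_mulr_real (r : R) (w : R[i]) : Re (r%:C%C * w) = r * Re w.
Proof. by case: w => p q /=; rewrite mul0r subr0. Qed.

Lemma Re_conj (w : R[i]) : Re (Num.conj w) = Re w.
Proof. by case: w. Qed.

Lemma norm_ReE (w : R[i]) : 0 <= w -> (Re w)%:C%C = w.
Proof. by case: w => p q; rewrite lecE /= => /andP[/eqP -> _]. Qed.

(** Norms and inner products take values in [R[i]]; their real parts lie in an ordered field, where
    [lra] and [nra] apply. The real part of the inner product still separates vectors and determines
    adjoints. *)
Definition rnorm x : R := Re `|x|.
Definition rdot x y : R := Re (vn_dot M x y).

Lemma rnormE x : (rnorm x)%:C%C = `|x|.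
Proof. exact/norm_ReE. Qed.

Lemma rnorm_ge0 x : 0 <= rnorm x.
Proof. by have := normr_ge0 x; rewrite -rnormE lecR. Qed.

Lemma rnorm0_eq0 x : rnorm x = 0 -> x = 0.
Proof. by move=> x0; apply/normr0_eq0; rewrite -rnormE x0. Qed.

Lemma rnormD x y : rnorm (x + y) <= rnorm x + rnorm y.
Proof. by rewrite -lecR rmorphD /= !rnormE ler_normD. Qed.

Lemma rnormZ r x : rnorm (r%:C%C *: x) = `|r| * rnorm x.
Proof. by rewrite /rnorm normrZ normc_def /= expr0n addr0 sqrtr_sqr Re_mulr_real. Qed.

Lemma rnormN x : rnorm (- x) = rnorm x.
Proof. by rewrite /rnorm normrN. Qed.

Lemma rdotC x y : rdot x y = rdot y x.
Proof. by rewrite /rdot hermC /= expr0 mul1r Re_conj. Qed.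

Lemma rdotDl x y z : rdot (x + y) z = rdot x z + rdot y z.
Proof. by rewrite /rdot linearDl raddfD. Qed.

Lemma rdotZl r x z : rdot (r%:C%C *: x) z = r * rdot x z.
Proof. by rewrite /rdot linearZl_LR /= Re_mulr_real. Qed.

Lemma rdotDr x y z : rdot z (x + y) = rdot z x + rdot z y.
Proof. by rewrite rdotC rdotDl !(rdotC z). Qed.

Lemma rdotZr r x z : rdot z (r%:C%C *: x) = r * rdot z x.
Proof. by rewrite rdotC rdotZl (rdotC z). Qed.

Lemma rdotxx x : rdot x x = rnorm x ^+ 2.
Proof.
by rewrite /rdot vn_dotE -rnormE expr2 Re_mulr_real expr2.
Qed.

Lemma rdotNl x z : rdot (- x) z = - rdot x z.
Proof. by rewrite /rdot linearNl raddfN. Qed.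

Lemma rdotNr x z : rdot z (- x) = - rdot z x.
Proof. by rewrite rdotC rdotNl (rdotC z). Qed.

(** The common source of the Cauchy-Schwarz inequalities for the inner product and for the trace. *)
Lemma quadratic_ge0_discr (A B C : R) :
  (forall t, 0 <= A + 2 * t * B + t ^+ 2 * C) -> B ^+ 2 <= A * C.
Proof.
move=> q; have A0 : 0 <= A by have := q 0; lra.
have [C0|C0] := ltP 0 C.
  have := q (- B / C); have -> : A + 2 * (- B / C) * B + (- B / C) ^+ 2 * C
      = (A * C - B ^+ 2) / C by field; exact: lt0r_neq0.
  by rewrite pmulr_lge0 ?invr_gt0 // subr_ge0.
have [B0|B0] := eqVneq B 0; last first.
  (* This t makes the affine part equal to -1, and C <= 0 keeps the total negative. *)
  have := q (- (A + 1) / (2 * B)).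
  have -> : A + 2 * (- (A + 1) / (2 * B)) * B = -1 by field.
  by have := sqr_ge0 (- (A + 1) / (2 * B)); nra.
rewrite B0 expr0n /=; have [->|C1] := eqVneq C 0; first by rewrite mulr0.
have {C1}C0 : C < 0 by rewrite lt_neqAle C1.
(* Now B = 0 and C < 0; since t >= 1, t^2 >= t > - A / C, so the form is negative at t. *)
have := q (1 - A / C); rewrite B0.
have -> : A + 2 * (1 - A / C) * 0 + (1 - A / C) ^+ 2 * C = C - A + A * (A / C).
  by field; exact: ltr0_neq0.
have h1 : A / C <= 0 by rewrite mulr_ge0_le0 // invr_le0 ltW.
by move=> h2; nra.
Qed.

Lemma rdot_CS x y : rdot x y ^+ 2 <= rnorm x ^+ 2 * rnorm y ^+ 2.
Proof.
rewrite -!rdotxx; apply: quadratic_ge0_discr => t.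
have := sqr_ge0 (rnorm (x + t%:C%C *: y)); rewrite -rdotxx.
by rewrite !(rdotDl, rdotDr, rdotZl, rdotZr) (rdotC y x); lra.
Qed.

Lemma rdot_le x y : `|rdot x y| <= rnorm x * rnorm y.
Proof.
rewrite -(@ler_pXn2r _ 2) ?nnegrE ?mulr_ge0 ?rnorm_ge0 //.
by rewrite real_normK ?num_real // exprMn rdot_CS.
Qed.

Lemma rdot_eq0 x : (forall y, rdot x y = 0) -> x = 0.
Proof.
by move=> /(_ x); rewrite rdotxx => /eqP; rewrite expf_eq0 /= => /eqP /rnorm0_eq0.
Qed.

Lemma rdot_inj x z : (forall y, rdot y x = rdot y z) -> x = z.
Proof.
move=> e; apply/eqP; rewrite -subr_eq0; apply/eqP/rdot_eq0 => y.
by rewrite rdotC rdotDr rdotNr e subrr.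
Qed.

Local Notation act := (@vn_act R M).
Local Notation star := (@vn_star R M).

(** Boundedness is read off the bicommutant equation, members of a commutant being bounded by
    definition. *)
Lemma act_bounded_op a : bounded_operator (act a).
Proof.
have : range (@vn_act R M) (act a) by exists a.
by rewrite vn_bicommutant => -[].
Qed.

HB.instance Definition _ a :=
  GRing.isLinear.Build R[i] H H *:%R (act a) (act_bounded_op a).1.

Lemma actD a b x : act (a + b) x = act a x + act b x.
Proof. by have := vn_act_linear 1 a b x; rewrite !scale1r. Qed.

Lemma act0 x : act 0 x = 0.
Proof. by have := vn_act_linear (-1) 0 0 x; rewrite scaler0 addr0 scaleN1r addNr. Qed.

Lemma actZ (c : R[i]) a x : act (c *: a) x = c *: act a x.
Proof. by have := vn_act_linear c a 0 x; rewrite !addr0 act0 addr0. Qed.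

Lemma actN a x : act (- a) x = - act a x.
Proof. by rewrite -scaleN1r actZ scaleN1r. Qed.

Lemma act_ext a b : (forall x, act a x = act b x) -> a = b.
Proof. by move=> e; apply: vn_act_inj; apply/funext. Qed.

Lemma star_rdot a x y : rdot (act a x) y = rdot x (act (star a) y).
Proof. by rewrite /rdot vn_starE. Qed.

(** The algebraic rules for [vn_star] are derived from this uniqueness, since the record ties
    [vn_star] to the inner product only. *)
Lemma star_uniq a b : (forall x y, rdot (act a x) y = rdot x (act b y)) ->
  star a = b.
Proof.
by move=> e; apply: act_ext => y; apply: rdot_inj => x; rewrite -star_rdot e.
Qed.

Lemma starM a b : star (a * b) = star b * star a.
Proof. by apply: star_uniq => x y; rewrite !vn_actM !star_rdot. Qed.

Lemma starD a b : star (a + b) = star a + star b.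
Proof. by apply: star_uniq => x y; rewrite !actD rdotDl rdotDr !star_rdot. Qed.

Lemma star1 : star 1 = 1.
Proof. by apply: star_uniq => x y; rewrite !vn_act1. Qed.

Lemma starZ r a : star (r%:C%C *: a) = r%:C%C *: star a.
Proof. by apply: star_uniq => x y; rewrite !actZ rdotZl rdotZr star_rdot. Qed.

Lemma star0 : star 0 = 0.
Proof. by have := starZ 0 0; rewrite !scale0r. Qed.

Lemma starN a : star (- a) = - star a.
Proof. by have := starZ (-1) a; rewrite rmorphN /= !scaleN1r. Qed.

Lemma starK a : star (star a) = a.
Proof. by apply: star_uniq => x y; rewrite rdotC -star_rdot rdotC. Qed.

Lemma star_sum (I : Type) (s : seq I) (P : pred I) (f : I -> M) :
  star (\sum_(i <- s | P i) f i) = \sum_(i <- s | P i) star (f i).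
Proof. by elim/big_rec2: _ => [|i y1 y2 _ <-]; rewrite ?star0 ?starD. Qed.

Lemma starX a n : star (a ^+ n) = star a ^+ n.
Proof. by elim: n => [|n IH]; rewrite ?star1 // exprS starM IH -exprSr. Qed.

Lemma complexP_real (e : R[i]) : 0 < e -> exists2 r : R, 0 < r & e = r%:C%C.
Proof.
move=> e0; exists (Re e); last by rewrite norm_ReE // ltW.
by move: (e0); rewrite -{1}(norm_ReE (ltW e0)) ltcR.
Qed.

Lemma act_rnorm a : exists2 K : R, 0 < K & forall x, rnorm (act a x) <= K * rnorm x.
Proof.
have /(_ 0) /continuous_linear_bounded := (act_bounded_op a).2.
move/(_ 0)/linear_boundedP => /pinfty_ex_gt0[r r0 hr].
have [K K0 eK] := complexP_real r0; exists K => // x.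
by rewrite -lecR rmorphM /= !rnormE -eK; exact: hr.
Qed.

Lemma rnorm_complete (u : nat -> H) :
  (forall e : R, 0 < e -> exists n0, forall n m, (n0 <= n <= m)%N ->
     rnorm (u m - u n) < e) ->
  exists l, forall e : R, 0 < e -> exists n0, forall n, (n0 <= n)%N ->
     rnorm (l - u n) < e.
Proof.
move=> cu; have /cauchy_cvg cv : cauchy (u @ \oo).
  apply: cauchy_exP => e /complexP_real [r r0 ->].
  have [n0 hn] := cu _ r0; exists (u n0), n0 => // m /= nm.
  rewrite -ball_normE /ball_ /= -rnormE ltcR -rnormN opprB.
  by apply: hn; rewrite leqnn.
exists (lim (u @ \oo)) => e e0.
have /cvgrPdist_lt/(_ e%:C%C) : u @ \oo --> lim (u @ \oo) by [].
rewrite ltcR => /(_ e0)[n0 _ hn]; exists n0 => n n0n.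
by have := hn n n0n; rewrite -rnormE ltcR.
Qed.

End RealForm.

(** * Square roots in M *)

Section SquareRoot.
Local Open Scope classical_set_scope.
Local Open Scope ring_scope.
Variables (R : realType) (M : von_neumann_algebra R).
Local Notation H := (vn_space M).
Local Notation act := (@vn_act R M).
Local Notation star := (@vn_star R M).
Local Notation Re := (@complex.Re R).
Implicit Types (a b c : M) (x y z : H) (r t : R).

(* The iteration y <- (b + y^2) / 2 converges to a y with (1 - y)^2 = 1 - b;
   its scalar version at b = 1 majorizes the increments. *)
Fixpoint sqrt_iter b n : M :=
  if n is n'.+1 then (2^-1)%:C%C *: (b + sqrt_iter b n' ^+ 2) else 0.

Fixpoint sqrt_major n : R :=
  if n is n'.+1 then (1 + sqrt_major n' ^+ 2) / 2 else 0.

Lemma sqrt_iter_comm b c n : c * b = b * c ->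
  c * sqrt_iter b n = sqrt_iter b n * c.
Proof.
move=> cb; elim: n => [|n IH] /=; first by rewrite mulr0 mul0r.
rewrite -scalerAr -scalerAl mulrDr mulrDl cb; congr (_ *: (_ + _)).
exact: commrX.
Qed.

Lemma sqrt_iter_star b n : star b = b -> star (sqrt_iter b n) = sqrt_iter b n.
Proof.
move=> sb; elim: n => [|n IH] /=; first by rewrite star0.
by rewrite starZ starD sb starX IH.
Qed.

Lemma sqrt_major_bound n : 0 <= sqrt_major n <= sqrt_major n.+1 /\ sqrt_major n <= 1.
Proof.
elim: n => [|n [/andP[h0 h1] h2]]; first by rewrite /= expr0n /=; lra.
have u1 : sqrt_major n.+1 <= 1 by rewrite /=; nra.
split=> //; apply/andP; split; first exact: le_trans h1.
by rewrite [leRHS]/= -/(sqrt_major n.+1); have := sqr_ge0 (sqrt_major n.+1 - 1); lra.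
Qed.

Lemma sqrt_major_homo : {homo sqrt_major : n m / (n <= m)%N >-> n <= m}.
Proof.
by apply: homo_leq => // [? ? ?|n]; [exact: le_trans|case: (sqrt_major_bound n) => /andP[]].
Qed.

Section Contraction.
Variable b : M.
Hypothesis b1 : forall x, rnorm (act b x) <= rnorm x.

Lemma sqrt_iter_rnorm n x : rnorm (act (sqrt_iter b n) x) <= sqrt_major n * rnorm x.
Proof.
elim: n x => [|n IH] x /=; first by rewrite act0 -(scale0r (0 : H)) -[0]/(0%:C%C)
  rnormZ normr0 !mul0r.
rewrite actZ actD expr2 vn_actM rnormZ ger0_norm ?invr_ge0 // mulrC mulrAC.
rewrite ler_pM2r ?invr_gt0 // (le_trans (rnormD _ _)) // mulrDl mul1r lerD //.
rewrite (le_trans (IH _)) // expr2 -mulrA ler_wpM2l //.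
by case: (sqrt_major_bound n) => /andP[].
Qed.

(** The iterates commute, so a difference of squares factors as (u - v)(u + v). The scalar sequence
    obeys the same recursion, with equality where the operators only satisfy bounds. *)
Lemma sqrt_iter_diff n m x : (n <= m)%N ->
  rnorm (act (sqrt_iter b m) x - act (sqrt_iter b n) x)
    <= (sqrt_major m - sqrt_major n) * rnorm x.
Proof.
elim: n m x => [|n IH] m x; first by rewrite act0 !subr0 => _; exact: sqrt_iter_rnorm.
case: m => // m; rewrite ltnS => nm; rewrite -actN -actD /=.
set u := sqrt_iter b m; set v := sqrt_iter b n.
have uv : v * u = u * v.
  by apply: sqrt_iter_comm; apply/esym; apply: sqrt_iter_comm.
have -> : (2^-1)%:C%C *: (b + u ^+ 2) - (2^-1)%:C%C *: (b + v ^+ 2) =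
    (2^-1)%:C%C *: ((u - v) * (u + v)).
  rewrite -scalerBr mulrDr !mulrBl uv -!expr2 opprD addrACA subrr add0r.
  by congr (_ *: _); rewrite addrA subrK.
rewrite actZ vn_actM actD actN rnormZ ger0_norm ?invr_ge0 //.
have h1 := IH m (act (u + v) x) nm.
have h2 : rnorm (act (u + v) x) <= (sqrt_major m + sqrt_major n) * rnorm x.
  by rewrite actD (le_trans (rnormD _ _)) // mulrDl lerD // sqrt_iter_rnorm.
have h3 := sqrt_major_homo nm.
have -> : ((1 + sqrt_major m ^+ 2) / 2 - (1 + sqrt_major n ^+ 2) / 2) * rnorm x
  = 2^-1 * ((sqrt_major m - sqrt_major n) * ((sqrt_major m + sqrt_major n) * rnorm x)).
  by field.
rewrite ler_pM2l ?invr_gt0 // (le_trans h1) // ler_wpM2l // subr_ge0 //.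
Qed.

Lemma sqrt_major_cauchy (e : R) : 0 < e ->
  exists n0, forall n m, (n0 <= n <= m)%N -> sqrt_major m - sqrt_major n < e.
Proof.
move=> e0; have cv : cvgn sqrt_major.
  apply: nondecreasing_is_cvgn; first exact: sqrt_major_homo.
  by exists 1 => _ [n _ <-]; case: (sqrt_major_bound n).
have /cvgrPdist_lt/(_ _ e0)[n0 _ hn] : sqrt_major @ \oo --> limn sqrt_major by [].
exists n0 => n m /andP[n0n nm].
have h1 := nondecreasing_cvgn_le sqrt_major_homo cv m.
have := hn n n0n => /=; rewrite ltr_norml => /andP[_]; lra.
Qed.

(** Pointwise limits exist by completeness; letting m tend to infinity in [sqrt_iter_diff] makes the
    convergence uniform on the unit ball. *)
Lemma sqrt_iter_lim : exists T : H -> H, forall e : R, 0 < e ->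
  exists n0, forall n, (n0 <= n)%N -> forall x,
    rnorm (T x - act (sqrt_iter b n) x) <= e * rnorm x.
Proof.
have /choice[T hT] : forall x, exists l, forall e : R, 0 < e -> exists n0,
    forall n, (n0 <= n)%N -> rnorm (l - act (sqrt_iter b n) x) < e.
  move=> x; apply: rnorm_complete => e e0.
  have x1 : 0 < rnorm x + 1 by have := rnorm_ge0 x; lra.
  have [n0 hn] := sqrt_major_cauchy (divr_gt0 e0 x1).
  exists n0 => n m nm; have := sqrt_iter_diff x (proj2 (andP nm)).
  move/le_lt_trans; apply; have := hn n m nm.
  rewrite ltr_pdivlMr // => /(le_lt_trans _); apply.
  rewrite ler_wpM2l ?lerDl // subr_ge0; apply: sqrt_major_homo.
  by case/andP: nm.
exists T => e e0; have [n0 hn] := sqrt_major_cauchy e0; exists n0 => n n0n x.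
apply/ler_addgt0Pr => d d0; have [n1 hn1] := hT x _ d0.
set m := maxn n n1; have := hn1 m (leq_maxr _ _).
have nm : (n <= m)%N by exact: leq_maxl.
have := sqrt_iter_diff x nm; have := hn n m; rewrite n0n nm => /(_ isT).
set u := act _ x; set v := act _ x => h1 h2 h3.
have -> : T x - v = (T x - u) + (u - v) by rewrite addrA subrK.
have := rnormD (T x - u) (u - v); have := rnorm_ge0 x; nra.
Qed.

End Contraction.

Lemma rnorm_small_eq x y : (forall e : R, 0 < e -> rnorm (x - y) <= e) -> x = y.
Proof.
move=> h; apply/eqP; rewrite -subr_eq0; apply/eqP/rnorm0_eq0/eqP.
by rewrite eq_le rnorm_ge0 andbT; apply/ler_addgt0Pr => e /h; rewrite add0r.
Qed.

Lemma rnorm_dist x y z : rnorm (x - z) <= rnorm (x - y) + rnorm (y - z).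
Proof. by rewrite (le_trans _ (rnormD _ _)) // addrA subrK. Qed.

Lemma commutant_rnorm (E : set (H -> H)) (S : H -> H) : commutant E S ->
  exists2 K : R, 0 < K & forall x, rnorm (S x) <= K * rnorm x.
Proof.
move=> [[lS cS] _]; pose f : {linear H -> H} := HB.pack S (GRing.isLinear.Build _ _ _ _
  S lS).
have /(_ 0)/(@continuous_linear_bounded _ _ _ 0 f) := cS.
move=> /linear_boundedP /pinfty_ex_gt0[r r0 hr].
have [K K0 eK] := complexP_real r0; exists K => // x.
by rewrite -lecR rmorphM /= !rnormE -eK; exact: hr.
Qed.

(** Brings the limit of the iteration, so far a mere operator, back into M. *)
Lemma in_bicommutant (T : H -> H) (K : R) : linear T ->
  (forall x, rnorm (T x) <= K * rnorm x) ->
  (forall S, commutant (range act) S -> forall x, T (S x) = S (T x)) ->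
  exists y : M, forall x, act y x = T x.
Proof.
move=> lT bT cT; suff : range act T by case=> y _ <-; exists y.
rewrite vn_bicommutant; split; last by move=> S hS; apply/funext => x /=; exact: cT.
split=> //; pose f : {linear H -> H} := HB.pack T (GRing.isLinear.Build _ _ _ _ T lT).
suff : continuous f by [].
apply/linear_bounded_continuous/linear_boundedP; near=> r => x.
have r_real : (0 : R[i]) <= r by near: r; exact: nbhs_pinfty_ge.
have := bT x; rewrite -lecR rmorphM /= !rnormE => /le_trans; apply.
apply: ler_wpM2r => //; near: r; apply: nbhs_pinfty_ge; by rewrite complex_real.
Unshelve. all: by end_near. Qed.

(** [1 - y] is a square root of [1 - b]. The element [y] inherits the hypotheses made on [b], so the
    lemma applies again to [y] and shows that the root [1 - y] is itself a square, hence
    positive. *)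
Lemma sqrt_exists b : star b = b -> (forall x, rnorm (act b x) <= rnorm x) ->
  exists y : M, [/\ star y = y, forall c, c * b = b * c -> c * y = y * c,
    forall x, rnorm (act y x) <= rnorm x & (1 - y) ^+ 2 = 1 - b].
Proof.
move=> sb b1; have [T hT] := sqrt_iter_lim b1.
have hT2 (e : R) : 0 < e -> exists n, forall x,
    rnorm (T x - act (sqrt_iter b n) x) <= e * rnorm x.
  by move=> /hT[n hn]; exists n => x; exact: hn.
have close x z (K : R) : (forall e : R, 0 < e -> rnorm (x - z) <= e * K) -> x = z.
  move=> h; apply: rnorm_small_eq => e e0.
  have K1 : 0 < `|K| + 1 by rewrite ltr_wpDl.
  rewrite (le_trans (h _ (divr_gt0 e0 K1))) // -mulrA ger_pMr // mulrC.
  by rewrite ler_pdivrMr // mul1r; have := ler_norm K; lra.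
have T1 x : rnorm (T x) <= rnorm x.
  apply/ler_addgt0Pr => e e0; have x1 : 0 < rnorm x + 1 by have := rnorm_ge0 x; lra.
  have [n /(_ x) hn] := hT2 _ (divr_gt0 e0 x1).
  have := rnormD (T x - act (sqrt_iter b n) x) (act (sqrt_iter b n) x).
  rewrite subrK => /le_trans; apply; rewrite addrC lerD //.
    rewrite (le_trans (sqrt_iter_rnorm b1 _ _)) // ler_piMl ?rnorm_ge0 //.
    by case: (sqrt_major_bound n).
  rewrite (le_trans hn) // mulrAC ler_pdivrMr // ler_pM2l //; lra.
have lT : linear T.
  move=> c x z; apply: (close _ _ (rnorm (c *: x + z) + Re `|c| * rnorm x + rnorm z)).
  move=> e /hT2[n hn]; set u := act (sqrt_iter b n).
  have -> : T (c *: x + z) - (c *: T x + T z) =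
     (T (c *: x + z) - u (c *: x + z)) + (- (c *: (T x - u x)) - (T z - u z)).
    have -> : u (c *: x + z) = c *: u x + u z by exact: (linearP (act (sqrt_iter b n))).
    by rewrite scalerBr !opprB [X in _ = _ + X]addrACA -opprD addrA subrK.
  rewrite (le_trans (rnormD _ _)) // -addrA mulrDr lerD //.
  rewrite (le_trans (rnormD _ _)) // mulrDr !rnormN lerD //.
  have -> : rnorm (c *: (T x - u x)) = Re `|c| * rnorm (T x - u x).
    by rewrite /rnorm normrZ -{1}(norm_ReE (normr_ge0 c)) Re_mulr_real.
  by rewrite mulrCA ler_wpM2l // -lecR norm_ReE normr_ge0.
have [y hy] : exists y : M, forall x, act y x = T x.
  apply: (@in_bicommutant _ 1) => // [x|S hS x]; first by rewrite mul1r.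
  have [K K0 bS] := commutant_rnorm hS.
  apply: (close _ _ (rnorm (S x) + K * rnorm x)) => e /hT2[n hn].
  set u := act (sqrt_iter b n).
  have Su : S (u x) = u (S x).
    by case: hS => _ /(_ u); move=> /(_ (ex_intro2 _ _ _ I erefl))/(congr1 (@^~ x)).
  have lS : S (T x) - S (u x) = S (T x - u x).
    case: hS => -[lS _] _; have := lS (-1) (u x) (T x); rewrite !scaleN1r.
    by rewrite addrC => <-; rewrite addrC.
  have := rnorm_dist (T (S x)) (u (S x)) (S (T x)).
  move/le_trans; apply; rewrite mulrDr lerD // -Su -rnormN opprB lS.
  by rewrite (le_trans (bS _)) // mulrCA ler_pM2l.
have yn (e : R) : 0 < e -> exists n, forall x,
    rnorm (act y x - act (sqrt_iter b n) x) <= e * rnorm x.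
  by move=> /hT2[n hn]; exists n => x; rewrite hy.
exists y; split.
- apply: star_uniq => x z; apply/eqP; rewrite -subr_eq0 -normr_le0.
  apply/ler_addgt0Pr => e e0; rewrite add0r.
  have x1 : 0 < 2 * (rnorm x * rnorm z) + 1.
    by have := mulr_ge0 (rnorm_ge0 x) (rnorm_ge0 z); lra.
  have [n hn] := yn _ (divr_gt0 e0 x1); set u := act (sqrt_iter b n).
  have su : rdot (u x) z = rdot x (u z) by rewrite star_rdot sqrt_iter_star.
  have -> : rdot (act y x) z - rdot x (act y z) =
      rdot (act y x - u x) z - rdot x (act y z - u z).
    by rewrite rdotDl rdotDr rdotNl rdotNr su; ring.
  rewrite (le_trans (ler_normB _ _)) //.
  have := le_trans (rdot_le _ _) (ler_wpM2r (rnorm_ge0 z) (hn x)).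
  have := le_trans (rdot_le _ _) (ler_wpM2l (rnorm_ge0 x) (hn z)).
  rewrite -/(u x) -/(u z) => h1 h2; apply: le_trans (lerD h2 h1) _.
  have k0 := divr_gt0 e0 x1; have := divfK (lt0r_neq0 x1) e.
  by move: (e / _) k0 => k k0 kE; lra.
- move=> c cb; apply: act_ext => x; rewrite !vn_actM.
  have [K K0 bc] := act_rnorm c.
  apply: (close _ _ (K * rnorm x + rnorm (act c x))) => e /yn[n hn].
  have := rnorm_dist (act c (act y x)) (act c (act (sqrt_iter b n) x)) (act y (act c x)).
  move/le_trans; apply; rewrite mulrDr lerD //.
    by rewrite -linearB (le_trans (bc _)) // mulrCA ler_pM2l.
  by rewrite -vn_actM (sqrt_iter_comm _ cb) vn_actM -rnormN opprB.
- by move=> x; rewrite hy.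
(* The claim rearranged as a fixed-point equation, which is checked against two consecutive
   iterates. *)
suff yE : y = (2^-1)%:C%C *: (b + y ^+ 2).
  have h : y + y = b + y ^+ 2.
    rewrite [X in X + _]yE [X in _ + X]yE -scalerDl -rmorphD /=.
    by rewrite (_ : 2^-1 + 2^-1 = 1 :> R) ?scale1r //; field.
  have -> : b = y + y - y ^+ 2 by rewrite h addrK.
  by rewrite expr2 mulrBr mulr1 mulrBl mul1r -expr2 !opprB opprD -addrA (addrCA (- y)).
apply: act_ext => x; apply: (close _ _ (2 * rnorm x)) => e e0.
have [n0 hn0] := hT _ e0; set u := act (sqrt_iter b n0).
have h1 := hn0 _ (leqnn _) ; have := hn0 _ (leqnSn n0); rewrite /= => /(_ x).
rewrite -/u -hy => h2.
apply: le_trans (rnorm_dist _ (act ((2^-1)%:C%C *: (b + sqrt_iter b n0 ^+ 2)) x) _) _.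
rewrite mulrCA mulr_natl mulr2n; apply: lerD; first exact: h2.
rewrite !actZ -scalerBr rnormZ ger0_norm ?invr_ge0 // !actD opprD addrACA subrr add0r.
rewrite !expr2 !vn_actM -/u.
have h3 := rnorm_dist (u (u x)) (u (act y x)) (act y (act y x)).
have h4 := h1 x; have h5 := h1 (act y x); rewrite -!hy -/u in h4 h5.
have h6 : rnorm (u (u x) - u (act y x)) <= e * rnorm x.
  rewrite /u -linearB (le_trans (sqrt_iter_rnorm b1 _ _)) //.
  rewrite -rnormN opprB (le_trans _ h4) // ler_piMl ?rnorm_ge0 //.
  by case: (sqrt_major_bound n0).
have h7 : rnorm (u (act y x) - act y (act y x)) <= e * rnorm x.
  by rewrite -rnormN opprB (le_trans h5) // ler_pM2l // hy.
have h8 := rnorm_ge0 (u (u x) - act y (act y x)).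
have {h3 h6 h7}h := le_trans h3 (lerD h6 h7).
rewrite -[1 + 1]/(2%:R) mulrC ler_pdivrMr //; apply: le_trans h _; lra.
Qed.

End SquareRoot.

(** * Norms from moments of the trace *)

Section TraceNorm.
Local Open Scope classical_set_scope.
Local Open Scope ring_scope.
Variables (R : realType) (M : von_neumann_algebra R) (phi : M -> R[i]).
Hypothesis tr : faithful_normal_tracial_state phi.
Local Notation H := (vn_space M).
Local Notation act := (@vn_act R M).
Local Notation star := (@vn_star R M).
Local Notation Re := (@complex.Re R).
Local Notation rphi a := (Re (phi a)).
Implicit Types (a b c u v : M) (x y z : H) (r t : R).

Lemma phiD u v : phi (u + v) = phi u + phi v.
Proof. by have := state_linear tr 1 u v; rewrite scale1r mul1r. Qed.

Lemma phi0 : phi 0 = 0.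
Proof. by apply: (addIr (phi 0)); rewrite -phiD !add0r. Qed.

Lemma phiZ (c : R[i]) u : phi (c *: u) = c * phi u.
Proof. by have := state_linear tr c u 0; rewrite !addr0 phi0 addr0. Qed.

Lemma phi_sum (I : Type) (s : seq I) (P : pred I) (f : I -> M) :
  phi (\sum_(i <- s | P i) f i) = \sum_(i <- s | P i) phi (f i).
Proof. by elim/big_rec2: _ => [|i y1 y2 _ <-]; rewrite ?phi0 ?phiD. Qed.

Lemma rphiD u v : rphi (u + v) = rphi u + rphi v.
Proof. by rewrite phiD raddfD. Qed.

Lemma rphiZ r u : rphi (r%:C%C *: u) = r * rphi u.
Proof. by rewrite phiZ Re_mulr_real. Qed.

Lemma rphi_sqr_ge0 u : star u = u -> 0 <= rphi (u ^+ 2).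
Proof.
move=> su; have := state_positive tr u; rewrite su -expr2.
by rewrite lecE => /andP[_].
Qed.

Lemma rphi_sqr_eq0 u : star u = u -> rphi (u ^+ 2) = 0 -> u = 0.
Proof.
move=> su u0; apply: (state_faithful tr); have := state_positive tr u.
by rewrite su -expr2 => /norm_ReE <-; rewrite u0.
Qed.

Lemma rphi_CS u v : star u = u -> star v = v -> u * v = v * u ->
  rphi (u * v) ^+ 2 <= rphi (u ^+ 2) * rphi (v ^+ 2).
Proof.
move=> su sv uv; apply: quadratic_ge0_discr => t.
have := @rphi_sqr_ge0 (u + t%:C%C *: v); rewrite starD starZ su sv => /(_ erefl).
have -> : (u + t%:C%C *: v) ^+ 2 =
    u ^+ 2 + t%:C%C *: (u * v) + (t%:C%C *: (u * v) + (t ^+ 2)%:C%C *: v ^+ 2).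
  rewrite expr2 mulrDl !mulrDr -!scalerAl -!scalerAr scalerA -rmorphM /= -uv.
  by rewrite -!expr2.
by rewrite !rphiD !rphiZ; lra.
Qed.

Lemma bernoulli_unbounded (t B : R) : 1 < t -> (forall j, t ^+ (2 ^ j) <= B) -> False.
Proof.
move=> t1 hB; have bern n : 1 + n%:R * (t - 1) <= t ^+ n.
  elim: n => [|n IH]; first by rewrite mul0r addr0.
  rewrite exprS -natr1; have n0 : 0 <= n%:R :> R by [].
  apply: (@le_trans _ _ (t * (1 + n%:R * (t - 1)))).
    by have := mulr_ge0 n0 (sqr_ge0 (t - 1)); lra.
  by rewrite ler_pM2l //; lra.
have t10 : 0 < t - 1 by lra.
have [n hn] : exists n : nat, B / (t - 1) < n%:R.
  by exists (Num.truncn (B / (t - 1))).+1; rewrite truncnS_gt ?num_real.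
have h1 := bern (2 ^ n)%N; have h2 := hB n.
have h3 : n%:R <= (2 ^ n)%:R :> R by rewrite ler_nat ltnW // ltn_expl.
move: hn; rewrite ltr_pdivrMr // => hn; nra.
Qed.

(* With b = a^* a, the element p = |g| + g is twice the positive part of
   g = (b - r) / C.  By Cauchy-Schwarz the moments phi (b^m p^2) grow at least
   like r^m, whereas they are O(K^m) by hypothesis; so p = 0 by faithfulness. *)
Lemma trace_norm_lt (a : M) (K r : R) : 0 < K -> K < r ->
  (forall m, rphi ((star a * a) ^+ m) <= K ^+ m) ->
  forall x, rnorm (act a x) ^+ 2 <= r * rnorm x ^+ 2.
Proof.
move=> K0 Kr hK x; set b := star a * a.
have sb : star b = b by rewrite /b starM starK.
have r0 : 0 < r by exact: lt_trans Kr.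
have [B B0 bB] := act_rnorm b.
pose C := B + r; have C0 : 0 < C by rewrite addr_gt0.
pose g : M := (C^-1)%:C%C *: (b - (r%:C%C *: 1)).
have bE : b = r%:C%C *: 1 + C%:C%C *: g.
  by rewrite scalerA -rmorphM /= mulfV ?lt0r_neq0 // scale1r addrC subrK.
have sg : star g = g by rewrite starZ starD starN starZ star1 sb.
have g1 z : rnorm (act g z) <= rnorm z.
  rewrite actZ rnormZ ger0_norm ?invr_ge0 ?(ltW C0) // ler_pdivrMl //.
  rewrite actD actN actZ vn_act1 (le_trans (rnormD _ _)) // rnormN rnormZ gtr0_norm //.
  by rewrite [leRHS]mulrDl lerD // bB.
pose b' := 1 - g ^+ 2.
have sb' : star b' = b' by rewrite starD starN star1 starX sg.
have b'1 z : rnorm (act b' z) <= rnorm z.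
  suff h : rnorm (act b' z) ^+ 2 <= rnorm z ^+ 2.
    by rewrite -(@ler_pXn2r _ 2) ?nnegrE ?rnorm_ge0.
  have h : rnorm (act g (act g z)) ^+ 2 <= rnorm (act g z) ^+ 2.
    by rewrite ler_pXn2r ?nnegrE ?rnorm_ge0.
  rewrite -!rdotxx actD actN vn_act1 expr2 vn_actM !(rdotDl, rdotDr, rdotNl, rdotNr).
  rewrite [rdot (act g _) z]star_rdot (rdotC z) star_rdot sg !rdotxx.
  by have := sqr_ge0 (rnorm (act g z)); lra.
(* As [1 - b'] is g^2, the first root s = 1 - y is |g|. The second one, d, is a root of s and
   witnesses its positivity. *)
have [y [sy cy y1 ysq]] := sqrt_exists sb' b'1.
have [y' [sy' cy' _ ysq']] := sqrt_exists sy y1.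
pose s := 1 - y; pose d := 1 - y'; have sE : y = 1 - s by rewrite /s opprB addrC subrK.
have ss : s ^+ 2 = g ^+ 2 by rewrite /s ysq /b' opprB addrC subrK.
have dd : d ^+ 2 = s by [].
have sd : star d = d by rewrite starD starN star1 sy'.
have gs : g * s = s * g.
  rewrite mulrBr mulrBl mulr1 mul1r; congr (_ - _); apply: cy.
  by rewrite mulrBr mulrBl mulr1 mul1r -exprS -exprSr.
have cd c : c * s = s * c -> c * d = d * c.
  move=> cs; rewrite mulrBr mulrBl mulr1 mul1r; congr (_ - _); apply: cy'.
  by rewrite sE mulrBr mulrBl mulr1 mul1r cs.
have sS : star s = s by rewrite -dd starX sd.
clearbody s d; pose p := s + g; have pE : p = s + g by []; clearbody p g.
have sp : star p = p by rewrite pE starD sS sg.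
(* Since s^2 = g^2, multiplying p by g or by the positive s is the same; this is what makes [mu 1]
   at least [r * mu 0]. *)
have gp : g * p = s * p by rewrite pE !mulrDr gs -[g * g]expr2 -ss expr2 addrC.
have sp_comm : s * p = p * s by rewrite pE mulrDr mulrDl gs.
have gp_comm : g * p = p * g by rewrite pE mulrDr mulrDl gs.
have dp_comm : d * p = p * d by rewrite cd // sp_comm.
have bp_comm : b * p = p * b.
  by rewrite bE mulrDr mulrDl -!scalerAr -!scalerAl mulr1 mul1r gp_comm.
have bnp n : b ^+ n * p = p * b ^+ n by apply/esym/commrX.
pose mu n := rphi (b ^+ n * p ^+ 2).
have mu0 : 0 <= mu 0%N by rewrite /mu mul1r rphi_sqr_ge0.
have mu1 : r * mu 0%N <= mu 1%N.
  rewrite /mu mul1r expr1 expr2 mulrA bE mulrDl -!scalerAl mul1r gp mulrDl -!scalerAl.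
  rewrite rphiD !rphiZ lerDl mulr_ge0 ?(ltW C0) //.
  have -> : s * p * p = (d * p) ^+ 2.
    by rewrite -dd !expr2 -(mulrA d) [in LHS]dp_comm !mulrA.
  by apply: rphi_sqr_ge0; rewrite starM sd sp.
have mu_conv n : mu n ^+ 2 <= mu 0%N * mu (n + n)%N.
  have := @rphi_CS p (b ^+ n * p); rewrite starM starX sb sp -bnp => /(_ erefl erefl).
  rewrite mulrA -bnp => /(_ erefl).
  have -> : b ^+ n * p * p = b ^+ n * p ^+ 2 by rewrite -mulrA.
  have -> : (b ^+ n * p) ^+ 2 = b ^+ (n + n) * p ^+ 2.
    by rewrite exprD !expr2 -!mulrA; congr (_ * _); rewrite !mulrA bnp.
  by rewrite /mu mul1r.
have mu_up n : mu n ^+ 2 <= K ^+ (n + n) * rphi ((p ^+ 2) ^+ 2).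
  have := @rphi_CS (b ^+ n) (p ^+ 2); rewrite !starX sb sp => /(_ erefl erefl).
  have -> : b ^+ n * p ^+ 2 = p ^+ 2 * b ^+ n by exact: (commrX 2 (bnp n)).
  move=> /(_ erefl) h; rewrite /mu (_ : b ^+ n * p ^+ 2 = p ^+ 2 * b ^+ n); last exact:
    (commrX 2 (bnp n)).
  apply: le_trans h _; apply: ler_wpM2r; first by rewrite rphi_sqr_ge0 // starX sp.
  by rewrite -exprM muln2 -addnn hK.
have p0 : p = 0.
  apply: rphi_sqr_eq0 => //; have -> : rphi (p ^+ 2) = mu 0%N by rewrite /mu mul1r.
  apply/eqP; rewrite eq_le mu0 andbT leNgt; apply/negP => mupos.
  (* [mu_conv] doubles the exponent, so starting from [mu1] it reaches the powers of two, which
     suffice. *)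
  have mu_low j : mu 0%N * r ^+ (2 ^ j) <= mu (2 ^ j)%N.
    elim: j => [|j IH]; first by rewrite mulrC.
    rewrite -(ler_pM2l mupos) expnS mul2n -addnn (le_trans _ (mu_conv _)) //.
    rewrite mulrA exprD mulrACA -expr2 ler_pXn2r // nnegrE ?mulr_ge0 ?exprn_ge0 // ?ltW //.
    by rewrite (lt_le_trans _ IH) // mulr_gt0 // exprn_gt0.
  (* What can be bounded is w^2 for w = (r / K)^n; the added [mu 0 ^+ 2] comes from w <= w^2 + 1. *)
  apply: (@bernoulli_unbounded (r / K) ((rphi ((p ^+ 2) ^+ 2) + mu 0%N ^+ 2) / mu 0%N
    ^+ 2)).
    by rewrite ltr_pdivlMr // mul1r.
  move=> j; set n := (2 ^ j)%N.
  have rKn0 : 0 <= (r / K) ^+ n by rewrite exprn_ge0 // divr_ge0 // ltW.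
  have h : mu 0%N ^+ 2 * ((r / K) ^+ n) ^+ 2 <= rphi ((p ^+ 2) ^+ 2).
    have := mu_up n; rewrite mulrC -ler_pdivrMr ?exprn_gt0 //; apply: le_trans.
    rewrite expr_div_n expr_div_n mulrA exprD -[K ^+ n * K ^+ n]expr2.
    rewrite ler_pM2r ?invr_gt0 ?exprn_gt0 // -exprMn ler_pXn2r ?mu_low // nnegrE.
      by rewrite mulr_ge0 // exprn_ge0 // ltW.
    by apply: le_trans (mu_low j); rewrite mulr_ge0 // exprn_ge0 // ltW.
  rewrite ler_pdivlMr ?exprn_gt0 //; move: h rKn0; move: (_ ^+ n) => w.
  have : 0 <= mu 0%N ^+ 2 by rewrite sqr_ge0.
  by move: (mu 0%N ^+ 2) (rphi _) => m q; have := sqr_ge0 (w - 1); nra.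
(* With p = 0 one has g = - d^2, so b is at most r as a quadratic form, which is the claim. *)
have gE : g = - s by apply/eqP; rewrite -addr_eq0 addrC -pE p0.
rewrite -rdotxx star_rdot -vn_actM -/b rdotC bE actD !actZ vn_act1 rdotDl !rdotZl.
rewrite rdotxx gerDl gE actN rdotNl mulrN oppr_le0 mulr_ge0 ?(ltW C0) //.
by rewrite -dd expr2 vn_actM star_rdot sd rdotxx sqr_ge0.
Qed.

Lemma trace_norm_bound (a : M) (K : R) : 0 < K ->
  (forall m, rphi ((star a * a) ^+ m) <= K ^+ m) ->
  forall x, rnorm (act a x) ^+ 2 <= K * rnorm x ^+ 2.
Proof.
move=> K0 hK x; apply/ler_addgt0Pr => e e0.
have x1 : 0 < rnorm x ^+ 2 + 1 by have := sqr_ge0 (rnorm x); lra.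
have d0 := divr_gt0 e0 x1.
have Kd : K < K + e / (rnorm x ^+ 2 + 1) by rewrite ltrDl.
apply: le_trans (trace_norm_lt K0 Kd hK x) _; rewrite mulrDl lerD2l mulrAC.
by rewrite ler_pdivrMr // ler_pM2l //; lra.
Qed.

Lemma op_norm_bound (a : M) (K : R) : 0 < K ->
  (forall m, rphi ((star a * a) ^+ m) <= K ^+ m) ->
  0 <= op_norm a <= Num.sqrt K.
Proof.
move=> K0 hK; have hub z : `|z| <= 1 -> rnorm (act a z) <= Num.sqrt K.
  move=> z1; rewrite -(@ler_pXn2r _ 2) ?nnegrE ?rnorm_ge0 ?sqrtr_ge0 //.
  rewrite sqr_sqrtr ?(ltW K0) // (le_trans (trace_norm_bound K0 hK z)) //.
  rewrite -[leRHS]mulr1 ler_pM2l // exprn_ile1 ?rnorm_ge0 //.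
  by rewrite -lecR rnormE.
have ub : ubound [set rnorm (act a z) | z in [set z : H | `|z| <= 1]] (Num.sqrt K).
  by move=> _ [z z1 <-]; exact: hub.
have mem0 : [set rnorm (act a z) | z in [set z : H | `|z| <= 1]] 0.
  exists 0; first by rewrite /= normr0.
  by rewrite linear0 /rnorm normr0.
apply/andP; split; first by apply: ub_le_sup => //; exists (Num.sqrt K).
by apply: ge_sup => //; exists 0.
Qed.

End TraceNorm.

(** * The free Poisson model on words *)

Section FockModel.
Variables (R : realFieldType) (I : finType) (s : I -> R).
Local Notation F := (seq I -> R^o).
Implicit Types (f g : F) (i j : I) (w : seq I) (L d : nat) (K : R) (T : F -> F).

(** A word indexes a basis tensor of the full Fock space; a vector is any function on words,
    summable or not. *)
Definition creation i f : F := fun w => if w is j :: w' then (j == i)%:R * f w' else 0.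
Definition annihilation i f : F := fun w => f (i :: w).
(* With c_i = column_op i and c_i^* = column_adj i, the operator c_i c_i^* is free Poisson of
   rate s_i^2 in the vacuum state. *)
Definition column_op i f : F := creation i f + s i *: f.
Definition column_adj i f : F := annihilation i f + s i *: f.
Definition letter_poisson i f : F := column_op i (column_adj i f).
Definition total_poisson f : F := \sum_i letter_poisson i f.
Definition vacuum : F := fun w => (w == [::])%:R.

Lemma fctDE f g w : (f + g) w = f w + g w. Proof. by []. Qed.
Lemma fctZE (k : R) f w : (k *: f) w = k * f w. Proof. by []. Qed.
Lemma fct_sum_apply (J : Type) (r : seq J) (P : pred J) (h : J -> F) w :
  (\sum_(i <- r | P i) h i) w = \sum_(i <- r | P i) h i w.
Proof. by elim/big_rec2: _ => // i y1 y2 _ <-. Qed.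

Lemma creation_linear i : linear (creation i).
Proof.
move=> k f g; apply/funext => -[|j w]; rewrite fctDE fctZE /= ?mulr0 ?addr0 //.
by rewrite fctDE fctZE mulrDr mulrCA.
Qed.
HB.instance Definition _ i := GRing.isLinear.Build R F F *:%R (creation i)
  (creation_linear i).

Lemma annihilation_linear i : linear (annihilation i).
Proof. by move=> k f g; apply/funext => w. Qed.
HB.instance Definition _ i := GRing.isLinear.Build R F F *:%R (annihilation i)
  (annihilation_linear i).

Lemma column_op_linear i : linear (column_op i).
Proof.
by move=> k f g; rewrite /column_op linearP scalerDr !scalerDr addrACA !scalerA mulrC.
Qed.
HB.instance Definition _ i := GRing.isLinear.Build R F F *:%R (column_op i)
  (column_op_linear i).

Lemma column_adj_linear i : linear (column_adj i).
Proof.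
by move=> k f g; rewrite /column_adj linearP scalerDr !scalerDr addrACA !scalerA mulrC.
Qed.
HB.instance Definition _ i := GRing.isLinear.Build R F F *:%R (column_adj i)
  (column_adj_linear i).

Lemma letter_poisson_linear i : linear (letter_poisson i).
Proof. by move=> k f g; rewrite /letter_poisson !linearP. Qed.
HB.instance Definition _ i := GRing.isLinear.Build R F F *:%R (letter_poisson i)
  (letter_poisson_linear i).

Lemma total_poisson_linear : linear total_poisson.
Proof.
move=> k f g; rewrite /total_poisson scaler_sumr -big_split /=.
by apply: eq_bigr => i _; rewrite linearP.
Qed.
HB.instance Definition _ := GRing.isLinear.Build R F F *:%R total_poisson
  total_poisson_linear.

(* The squared norm of f restricted to words shorter than L. *)
Fixpoint sqnorm L f : R :=
  if L is L'.+1 then f [::] ^+ 2 + \sum_i sqnorm L' (annihilation i f) else 0.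

Lemma sqnorm_ge0 L f : 0 <= sqnorm L f.
Proof. by elim: L f => //= L IH f; rewrite addr_ge0 ?sqr_ge0 ?sumr_ge0. Qed.

Lemma sqnorm_leS L f : sqnorm L f <= sqnorm L.+1 f.
Proof.
elim: L f => [|L IH] f; first exact: sqnorm_ge0.
by rewrite [leLHS]/= [leRHS]/= lerD2l ler_sum // => i _; exact: IH.
Qed.

Lemma sqnorm_le L L' f : (L <= L')%N -> sqnorm L f <= sqnorm L' f.
Proof.
move=> LL; rewrite -(subnKC LL); elim: (L' - L)%N => [|n IH]; first by rewrite addn0.
by rewrite addnS (le_trans IH) // sqnorm_leS.
Qed.

Lemma sqnormZ L (k : R) f : sqnorm L (k *: f) = k ^+ 2 * sqnorm L f.
Proof.
elim: L f => [|L IH] f /=; first by rewrite mulr0.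
rewrite fctZE exprMn mulrDr mulr_sumr; congr (_ + _).
by apply: eq_bigr => i _; rewrite linearZ IH.
Qed.

(** Replaces the triangle inequality, which would bring in square roots. The factors 2 in later
    constants come from here. *)
Lemma sqnormD L f g : sqnorm L (f + g) <= 2 * sqnorm L f + 2 * sqnorm L g.
Proof.
elim: L f g => [|L IH] f g /=; first lra.
rewrite !mulrDr addrACA lerD //.
  by rewrite fctDE; have := sqr_ge0 (f [::] - g [::]); lra.
by rewrite !mulr_sumr -big_split ler_sum // => i _; rewrite linearD; exact: IH.
Qed.

Lemma sqr_sum_le (J : finType) (x : J -> R) :
  (\sum_j x j) ^+ 2 <= #|J|%:R * \sum_j x j ^+ 2.
Proof.
have h : 0 <= \sum_i \sum_j (x i - x j) ^+ 2.
  by apply: sumr_ge0 => i _; apply: sumr_ge0 => j _; exact: sqr_ge0.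
rewrite -subr_ge0 -(@pmulr_rge0 _ 2) //; apply: le_trans h _.
rewrite le_eqVlt; apply/orP; left; apply/eqP.
have -> : \sum_i \sum_j (x i - x j) ^+ 2 =
    \sum_i (#|J|%:R * x i ^+ 2 + (\sum_j x j ^+ 2 - 2 * x i * \sum_j x j)).
  apply: eq_bigr => i _; rewrite mulr_sumr -sumrB mulr_natl -sumr_const -big_split /=.
  by apply: eq_bigr => j _; ring.
rewrite big_split /= -mulr_sumr sumrB sumr_const -mulr_suml -mulr_sumr -mulr_natl.
by ring.
Qed.

Lemma sqnorm_sum (J : finType) L (h : J -> F) :
  sqnorm L (\sum_j h j) <= #|J|%:R * \sum_j sqnorm L (h j).
Proof.
elim: L h => [|L IH] h /=; first by rewrite big1 ?mulr0.
rewrite big_split mulrDr lerD //=; first by rewrite fct_sum_apply sqr_sum_le.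
rewrite exchange_big mulr_sumr ler_sum // => i _.
by rewrite linear_sum; exact: IH.
Qed.

Lemma annihilation_creation i j f : annihilation i (creation j f) = (i == j)%:R *: f.
Proof. by apply/funext. Qed.

(** The l_i are isometries with orthogonal ranges; the truncation moves by one letter. *)
Lemma sqnorm_sum_creation L (h : I -> F) : sqnorm L.+1 (\sum_i creation i (h i)) =
  \sum_i sqnorm L (h i).
Proof.
rewrite /= fct_sum_apply big1 // expr0n add0r; apply: eq_bigr => i _; congr sqnorm.
rewrite linear_sum (bigD1 i) //= annihilation_creation eqxx scale1r big1 ?addr0 // => j ji.
by rewrite annihilation_creation eq_sym (negPf ji) scale0r.
Qed.

Lemma sqnorm_creation L i f : sqnorm L (creation i f) <= sqnorm L f.
Proof.
apply: le_trans (sqnorm_leS _ _) _ => /=; rewrite expr0n add0r (bigD1 i) //= big1 ?addr0.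
  by rewrite annihilation_creation eqxx scale1r.
by move=> j ji; rewrite annihilation_creation (negPf ji) scale0r -(scale0r f) sqnormZ
  expr0n mul0r.
Qed.

Lemma sqnorm_sum_annihilation L f : \sum_i sqnorm L (annihilation i f) <= sqnorm L.+1 f.
Proof. by rewrite /= lerDr sqr_ge0. Qed.

Lemma sqnorm_annihilation L i f : sqnorm L (annihilation i f) <= sqnorm L.+1 f.
Proof.
apply: le_trans (sqnorm_sum_annihilation _ _); rewrite (bigD1 i) //= lerDl sumr_ge0 //
  => j _.
exact: sqnorm_ge0.
Qed.

(* The finite propagation d replaces square-summability: no vector of infinite
   norm has to be excluded. *)
Definition op_bounded d T K := forall L f, sqnorm L (T f) <= K * sqnorm (L + d) f.

Lemma op_bounded_le d d' T K K' : (d <= d')%N -> 0 <= K -> K <= K' -> op_bounded d T K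
  -> op_bounded d' T K'.
Proof.
move=> dd K0 KK bT L f; apply: le_trans (bT _ _) _.
by rewrite ler_pM ?sqnorm_ge0 // sqnorm_le // leq_add2l.
Qed.

Lemma op_bounded_comp d d' T T' K K' : 0 <= K -> op_bounded d T K -> op_bounded d' T' K' ->
  op_bounded (d + d') (T \o T') (K * K').
Proof.
move=> K0 bT bT' L f; apply: le_trans (bT _ _) _; rewrite -mulrA ler_wpM2l //.
by rewrite addnA; exact: bT'.
Qed.

Lemma op_bounded_add d T T' K K' : op_bounded d T K -> op_bounded d T' K' ->
  op_bounded d (fun f => T f + T' f) (2 * K + 2 * K').
Proof.
move=> bT bT' L f; apply: le_trans (sqnormD _ _ _) _.
by have := bT L f; have := bT' L f; lra.
Qed.

Lemma op_bounded_scale d T K (k : R) : op_bounded d T K -> op_bounded d (fun f => k *: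
  T f) (k ^+ 2 * K).
Proof. by move=> bT L f; rewrite sqnormZ -mulrA ler_wpM2l // ?sqr_ge0. Qed.

Lemma op_bounded_creation i : op_bounded 0 (creation i) 1.
Proof. by move=> L f; rewrite addn0 mul1r sqnorm_creation. Qed.

Lemma op_bounded_annihilation i : op_bounded 1 (annihilation i) 1.
Proof. by move=> L f; rewrite addn1 mul1r sqnorm_annihilation. Qed.

Lemma op_bounded_id : op_bounded 0 idfun 1.
Proof. by move=> L f; rewrite addn0 mul1r. Qed.

Lemma sqnorm_vacuum L : sqnorm L.+1 vacuum = 1.
Proof.
rewrite /= expr1n big1 ?addr0 // => i _.
have -> : annihilation i vacuum = 0 by apply/funext.
by rewrite -(scale0r vacuum) sqnormZ expr0n mul0r.
Qed.

(** The propagation lengths add up along the iteration, at no cost: the vacuum has norm 1 at every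
    positive truncation length. *)
Lemma op_bounded_iter_vacuum d T K m : 0 <= K -> op_bounded d T K -> (iter m T vacuum)
  [::] ^+ 2 <= K ^+ m.
Proof.
move=> K0 bT; have h L : exists d', sqnorm L (iter m T vacuum) <= K ^+ m * sqnorm (L +
  d') vacuum.
  elim: m L => [|m IH] L; first by exists 0%N; rewrite addn0 mul1r.
  have [d' hd'] := IH (L + d)%N; exists (d + d')%N; rewrite exprS -mulrA addnA.
  by apply: le_trans (bT _ _) _; rewrite ler_wpM2l.
have [d' hd'] := h 1%N; rewrite sqnorm_vacuum mulr1 in hd'; apply: le_trans hd'.
by rewrite /= big1 ?addr0.
Qed.

Section Uniform.
Variables (a s0 : R).
Hypothesis sE : forall i, s i = s0.
Hypothesis aE : #|I|%:R * s0 ^+ 2 = a.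
Local Notation B := (2 * (1 + a)).

Lemma a_ge0 : 0 <= a. Proof. by rewrite -aE mulr_ge0 // sqr_ge0. Qed.

Lemma s0_le_a i : s0 ^+ 2 <= a.
Proof. by rewrite -aE ler_peMl ?sqr_ge0 // ler1n; apply/card_gt0P; exists i. Qed.

(** The creation parts are orthogonal, and the scalar part s0 \sum_i h_i costs #|I| s0^2 = a by
    Cauchy-Schwarz. The constant therefore does not grow with the number of letters. *)
Lemma sqnorm_row L (h : I -> F) : sqnorm L (\sum_i column_op i (h i)) <= B * \sum_i
  sqnorm L (h i).
Proof.
rewrite /column_op big_split /=; apply: le_trans (sqnormD _ _ _) _.
have -> : B * \sum_i sqnorm L (h i) = 2 * (\sum_i sqnorm L (h i)) + 2 * (a * \sum_i
  sqnorm L (h i)).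
  by ring.
rewrite lerD // ler_pM2l //.
  by rewrite (le_trans (sqnorm_leS _ _)) // sqnorm_sum_creation.
have -> : \sum_i s i *: h i = s0 *: \sum_i h i.
  by rewrite scaler_sumr; apply: eq_bigr => i _; rewrite sE.
rewrite sqnormZ -aE (mulrC #|I|%:R) -[leRHS]mulrA ler_wpM2l ?sqr_ge0 //.
exact: sqnorm_sum.
Qed.

Lemma sqnorm_column L f : \sum_i sqnorm L (column_adj i f) <= B * sqnorm L.+1 f.
Proof.
apply: (@le_trans _ _ (\sum_i (2 * sqnorm L (annihilation i f) + 2 * (s0 ^+ 2 * sqnorm
  L f)))).
  by apply: ler_sum => i _; rewrite /column_adj -sqnormZ -(sE i) sqnormD.
rewrite big_split /= -mulr_sumr sumr_const.
have -> : B * sqnorm L.+1 f = 2 * sqnorm L.+1 f + 2 * (a * sqnorm L.+1 f) by ring.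
rewrite lerD //; first by rewrite ler_pM2l // sqnorm_sum_annihilation.
rewrite -mulrnAr ler_pM2l // -mulr_natl mulrA aE ler_wpM2l ?a_ge0 //.
exact: sqnorm_leS.
Qed.

(** The operator is a row times a block diagonal matrix times a column, and row and column cost a
    factor 2 (1 + a) each. *)
Lemma op_bounded_sandwich d (E : I -> F -> F) K : 0 <= K -> (forall i, op_bounded d (E
  i) K) ->
  op_bounded d.+1 (fun f => \sum_i column_op i (E i (column_adj i f))) (B ^+ 2 * K).
Proof.
move=> K0 bE L f; have B0 : 0 <= B by have := a_ge0; lra.
apply: le_trans (sqnorm_row _ _) _; rewrite expr2 -2![leRHS]mulrA ler_wpM2l // addnS.
apply: (@le_trans _ _ (\sum_i K * sqnorm (L + d) (column_adj i f))).
  by apply: ler_sum => i _; exact: bE.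
by rewrite -mulr_sumr mulrCA ler_wpM2l // sqnorm_column.
Qed.

Lemma op_bounded_total_poisson : op_bounded 1 total_poisson (B ^+ 2).
Proof.
rewrite -[B ^+ 2]mulr1; apply: (@op_bounded_sandwich 0 (fun _ => idfun)) => // i.
exact: op_bounded_id.
Qed.

Lemma op_bounded_column_op i : op_bounded 0 (column_op i) B.
Proof.
have -> : B = 2 * 1 + 2 * a by ring.
have h := op_bounded_add (op_bounded_creation i) (op_bounded_scale (s i) op_bounded_id).
apply: op_bounded_le h => //; first by have := sqr_ge0 (s i); lra.
by rewrite sE; have := s0_le_a i; lra.
Qed.

Lemma op_bounded_column_adj i : op_bounded 1 (column_adj i) B.
Proof.
have -> : B = 2 * 1 + 2 * a by ring.
have h := op_bounded_add (op_bounded_annihilation i) (op_bounded_scale (s i)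
  (op_bounded_le (leqnSn 0) ler01 (lexx _) op_bounded_id)).
apply: op_bounded_le h => //; first by have := sqr_ge0 (s i); lra.
by rewrite sE; have := s0_le_a i; lra.
Qed.

Lemma eq_bd d T T' K : T =1 T' -> op_bounded d T K -> op_bounded d T' K.
Proof. by move=> e bT L f; rewrite -e. Qed.

Lemma column_adj_op i f : column_adj i (column_op i f) = f + s0 *: (creation i f +
  annihilation i f) + s0 ^+ 2 *: f.
Proof.
rewrite /column_adj /column_op linearD linearZ /= annihilation_creation eqxx scale1r sE
  scalerDr scalerA -expr2.
by rewrite -addrA [X in _ + X]addrA -scalerDr addrA (addrC (annihilation i f)).
Qed.

Lemma op_bounded_creation_annihilation i : op_bounded 1 (fun f => creation i f +
  annihilation i f) 4.
Proof.
have -> : 4 = 2 * 1 + 2 * 1 :> R by ring.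
exact: op_bounded_add (op_bounded_le (leqnSn 0) ler01 (lexx _) (op_bounded_creation i))
  (op_bounded_annihilation i).
Qed.

Lemma op_bounded_column_adj_op i : op_bounded 1 (fun f => column_adj i (column_op i f)
  - f) ((8 + 2 * a) * s0 ^+ 2).
Proof.
have h := op_bounded_add (op_bounded_scale s0 (op_bounded_creation_annihilation i))
  (op_bounded_scale (s0 ^+ 2) (op_bounded_le (leqnSn 0) ler01 (lexx _) op_bounded_id)).
apply: (eq_bd (T := fun f => s0 *: (creation i f + annihilation i f) + s0 ^+ 2 *: f)).
  by move=> f; rewrite column_adj_op -[f + _ + _]addrA [RHS]addrC addKr.
apply: op_bounded_le h => //; first by have := sqr_ge0 s0; have := sqr_ge0 (s0 ^+ 2); lra.
by have := s0_le_a i; have := sqr_ge0 s0; rewrite (expr2 (s0 ^+ 2)); nra.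
Qed.

Lemma total_poisson_cons f i w : total_poisson f (i :: w) =
  f (i :: w) + s0 * f w + s0 * \sum_j f (j :: i :: w) + a * f (i :: w).
Proof.
rewrite /total_poisson fct_sum_apply.
have -> : \sum_j letter_poisson j f (i :: w) = \sum_j ((i == j)%:R * (f (j :: w) + s0 * f w)
    + s0 * f (j :: i :: w) + s0 ^+ 2 * f (i :: w)).
  by apply: eq_bigr => j _; rewrite /letter_poisson /column_op /column_adj !(fctDE,
    fctZE) /= !(fctDE, fctZE) /annihilation sE; ring.
rewrite !big_split /= -mulr_sumr sumr_const -mulr_natl mulrA aE; congr (_ + _ + _).
rewrite (bigD1 i) //= eqxx mul1r big1 ?addr0 // => j ji.
by rewrite eq_sym (negPf ji) mul0r.
Qed.

(** The main term comes from l_i^* Y l_i: on nonempty words \sum_j l_j l_j^* is the identity, and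
    the scalar part of Y is \sum_j s0^2 = a. Every other term carries a factor s0. *)
Lemma column_adj_total_op i f : column_adj i (total_poisson (column_op i f)) = (1 + a)
  *: f +
  ((s0 *: (creation i f + annihilation i f) + s0 *: annihilation i (total_poisson f)) +
   (s0 *: total_poisson (creation i f) + s0 ^+ 2 *: total_poisson f)).
Proof.
rewrite /column_adj /column_op sE !linearD !linearZ /= scalerA -expr2.
have -> : annihilation i (total_poisson (creation i f)) = (1 + a) *: f + s0 *:
  (creation i f + annihilation i f).
  apply/funext => w; rewrite /annihilation total_poisson_cons /= !(fctDE, fctZE) eqxx mul1r.
  have -> : creation i f w + f (i :: w) = creation i f w + \sum_j (j == i)%:R * f (i :: w).
    congr (_ + _); rewrite (bigD1 i) //= eqxx mul1r big1 ?addr0 // => j ji.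
    by rewrite (negPf ji) mul0r.
  by rewrite -mulr_suml; ring.
by rewrite scalerDr -!addrA.
Qed.

(** There are four error terms, each doubled twice by [op_bounded_add]; the last summand of the
    constant uses s0^4 <= a s0^2. *)
Lemma op_bounded_column_adj_total_op i : op_bounded 2 (fun f => column_adj i
  (total_poisson (column_op i f)) - (1 + a) *: f)
  ((16 + 8 * B ^+ 2 + 4 * a * B ^+ 2) * s0 ^+ 2).
Proof.
have a0 := a_ge0; have s00 := sqr_ge0 s0; have B0 := sqr_ge0 B.
have T1 := op_bounded_le (leqnSn 1) (ler0n R 4) (lexx _)
  (op_bounded_creation_annihilation i).
have T2 := op_bounded_comp ler01 (op_bounded_annihilation i) op_bounded_total_poisson.
have T3 := op_bounded_le (leqnSn 1) (mulr_ge0 B0 ler01) (lexx _) (op_bounded_comp B0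
  op_bounded_total_poisson (op_bounded_creation i)).
have T4 := op_bounded_le (leqnSn 1) B0 (lexx _) op_bounded_total_poisson.
have h := op_bounded_add (op_bounded_add (op_bounded_scale s0 T1) (op_bounded_scale s0 T2))
   (op_bounded_add (op_bounded_scale s0 T3) (op_bounded_scale (s0 ^+ 2) T4)).
apply: (eq_bd _ (op_bounded_le _ _ _ h)) => //.
- by move=> f; rewrite column_adj_total_op [RHS]addrC addKr.
- have h4 := sqr_ge0 (s0 ^+ 2); have := mulr_ge0 s00 B0; have := mulr_ge0 h4 B0; lra.
have := ler_wpM2r B0 (ler_wpM2r s00 (s0_le_a i)); rewrite -expr2.
by move: (s0 ^+ 2) (B ^+ 2) ((s0 ^+ 2) ^+ 2) => x y z; lra.
Qed.

(** The first summand accounts for the error G - kappa Y, placed between c_i^* and c_i, the second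
    for kappa times the error of c_i^* Y c_i. *)
Definition gap_bound (kappa C : R) : R :=
  2 * (B ^+ 2 * C) + 2 * (kappa ^+ 2 * (16 + 8 * B ^+ 2 + 4 * a * B ^+ 2)).

Lemma op_bounded_gap i d (G : F -> F) (kappa C : R) : 0 <= C ->
  op_bounded d (fun f => G f - kappa *: total_poisson f) (C * s0 ^+ 2) ->
  op_bounded d.+2 (fun f => column_adj i (G (column_op i f)) - (kappa * (1 + a)) *: f)
    (gap_bound kappa C * s0 ^+ 2).
Proof.
move=> C0 hG; have a0 := a_ge0; have s00 := sqr_ge0 s0; have B0 : 0 <= B by lra.
have Cs0 : 0 <= C * s0 ^+ 2 by exact: mulr_ge0.
have h1 := op_bounded_comp B0 (op_bounded_column_adj i) (op_bounded_comp Cs0 hG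
  (op_bounded_column_op i)).
have h2 := op_bounded_scale kappa (op_bounded_column_adj_total_op i).
have K0 : 0 <= kappa ^+ 2 * ((16 + 8 * B ^+ 2 + 4 * a * B ^+ 2) * s0 ^+ 2).
  rewrite mulr_ge0 ?sqr_ge0 // mulr_ge0 //.
  by have := mulr_ge0 a0 (sqr_ge0 B); have := sqr_ge0 B; lra.
have K1 : 0 <= B * (C * s0 ^+ 2 * B) by rewrite mulr_ge0 // mulr_ge0.
have h1' := op_bounded_le (_ : (1 + (d + 0) <= d.+2)%N) K1 (lexx _) h1.
have h2' := op_bounded_le (_ : (2 <= d.+2)%N) K0 (lexx _) h2.
have h := op_bounded_add (h1' _) (h2' isT); apply: (eq_bd _ (op_bounded_le _ _ _ (h
  _))) => //.
- by move=> f /=; rewrite linearB linearZ /= scalerBr scalerA addrA subrK.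
- by move: K0 K1; lra.
- by rewrite /gap_bound le_eqVlt; apply/orP; left; apply/eqP; ring.
by rewrite addn0.
Qed.

End Uniform.

End FockModel.

(** * Moments in the model *)

Section Jacobi.
Variables (R : realFieldType).
Implicit Types (q : nat -> R) (a : R).

(** With q read as a sequence of coefficients, [mulXa a] is multiplication by X + a. [jacobi a] is
    the tridiagonal matrix of c c^*, for c = l + s and a = s^2, in the basis of the vectors (s l)^n
    applied to the vacuum. *)
Definition mulXa a q : nat -> R :=
  fun n => (if n is n'.+1 then q n' else 0) + a * q n.
Definition jacobi a q : nat -> R := mulXa a (fun n => q n + q n.+1).
Definition delta_seq : nat -> R := fun n => (n == 0%N)%:R.
Definition poisson_moment a n : R := iter n (jacobi a) delta_seq 0%N.

End Jacobi.

Section ModelMoments.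
Variables (R : realFieldType) (I : finType) (s : I -> R).
Local Notation F := (seq I -> R^o).
Implicit Types (f g : F) (i j : I) (w : seq I) (q : nat -> R).

(* The vector \sum_n q_n (s_i l_i)^n f. *)
Fixpoint mode_lift i q f w {struct w} : R^o :=
  q 0%N * f w + if w is j :: w' then (j == i)%:R * (s i * mode_lift i (q \o S) f w') else 0.

Lemma mode_liftE i q f : mode_lift i q f = q 0%N *: f + s i *: creation i (mode_lift i
  (q \o S) f).
Proof.
by apply/funext => -[|j w]; rewrite !(fctDE, fctZE) /= ?mulr0 // mulrCA.
Qed.

Lemma mode_liftD i q q' f : mode_lift i q f + mode_lift i q' f = mode_lift i (fun n =>
  q n + q' n) f.
Proof.
apply/funext => w; rewrite fctDE; elim: w q q' => [|j w IH] q q' /=; first by ring.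
have := IH (q \o S) (q' \o S) => /= <-; ring.
Qed.

Lemma mode_liftZ i (k : R) q f : k *: mode_lift i q f = mode_lift i (fun n => k * q n) f.
Proof.
apply/funext => w; rewrite fctZE; elim: w q => [|j w IH] q /=; first by ring.
have := IH (q \o S) => /= <-; ring.
Qed.

(** When l_i^* f = 0, the vectors l_i^n f span an invariant subspace of c_i c_i^*, on which it acts
    by a matrix independent of f. The freeness of the model rests on this. *)
Lemma letter_poisson_lift i q f : annihilation i f = 0 ->
  letter_poisson s i (mode_lift i q f) = mode_lift i (jacobi (s i ^+ 2) q) f.
Proof.
rewrite /letter_poisson => fi; have -> : column_adj s i (mode_lift i q f) = s i *:
  mode_lift i (fun n => q n + q n.+1) f.
  have := mode_liftD i q (q \o S) f => /= <-; rewrite /column_adj scalerDr addrC; congr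
    (_ + _).
  by rewrite mode_liftE linearD !linearZ /= fi scaler0 add0r annihilation_creation eqxx
    scale1r.
rewrite linearZ /= /column_op scalerDr scalerA -expr2 mode_liftZ /jacobi /mulXa.
have <- := mode_liftD i (fun n => if n is n'.+1 then q n' + q n'.+1 else 0)
  (fun n => s i ^+ 2 * (q n + q n.+1)) f.
by congr (_ + _); rewrite [RHS]mode_liftE /= scale0r add0r.
Qed.

Lemma mode_lift_delta i f : mode_lift i (delta_seq R) f = f.
Proof.
have lift_zero w : mode_lift i (fun=> 0) f w = 0.
  elim: w => [|j w IH] /=; first by rewrite mul0r addr0.
  by rewrite mul0r add0r -[mode_lift _ _ _ _]/(mode_lift i (fun=> 0) f w) IH !mulr0.
apply/funext => -[|j w] /=; first by rewrite mul1r addr0.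
by rewrite mul1r -[mode_lift _ _ _ _]/(mode_lift i (fun=> 0) f w) lift_zero !mulr0 addr0.
Qed.

Lemma iter_letter_poisson_lift i k f : annihilation i f = 0 ->
  iter k (letter_poisson s i) f = mode_lift i (iter k (jacobi (s i ^+ 2)) (delta_seq R)) f.
Proof.
by move=> fi; elim: k => [|k IH] /=; rewrite ?mode_lift_delta // IH letter_poisson_lift.
Qed.

Definition letter_op (u : I * nat * bool) f : F :=
  let: (i, k, b) := u in
  iter k (letter_poisson s i) f - (poisson_moment (s i ^+ 2) k *+ b) *: f.

(** Recentring cancels exactly the component along f, and all the others begin with the letter i. *)
Lemma letter_op_centered i k f : annihilation i f = 0 ->
  exists g, letter_op (i, k, true) f = creation i g.
Proof.
move=> fi; rewrite /letter_op iter_letter_poisson_lift // mode_liftE mulr1n addrC addrA.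
rewrite -scaleNr -scalerDl /poisson_moment addNr scale0r add0r.
by eexists; rewrite -linearZ.
Qed.

(** An alternating product of centred letters sends the vacuum to a combination of words beginning
    with its first index, which has no component at the empty word. *)
Lemma model_free (l : seq (I * nat * bool)) : l != [::] ->
  sorted (fun u v => u.1.1 != v.1.1) l -> all (fun u => u.2) l ->
  foldr letter_op (@vacuum R I) l [::] = 0.
Proof.
have h u l' : sorted (fun u v => u.1.1 != v.1.1) (u :: l') ->
    all (fun u => u.2) (u :: l') ->
    exists g, foldr letter_op (@vacuum R I) (u :: l') = creation u.1.1 g.
  elim: l' u => [|v l' IH] [[i k] b].
    by move=> _ /andP[/= -> _]; apply: letter_op_centered; apply/funext.
  move=> /andP[/= iv sl] /andP[/= -> al]; have [g hg] := IH v sl al.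
  rewrite -[letter_op v _]/(foldr letter_op (@vacuum R I) (v :: l')) hg.
  by apply: letter_op_centered; rewrite annihilation_creation (negPf iv) scale0r.
by case: l => // u l _ sl al; have [g ->] := h u l sl al.
Qed.

Definition weight w : R := \prod_(j <- w) s j.

Definition radial q : F := fun w => q (size w) * weight w.

(** The radial vectors contain the vacuum and are stable under the sum of all letters, which acts on
    them as a single letter of rate \sum_i s_i^2. So rates add up under free sums. *)
Lemma total_poisson_radial (q : nat -> R) :
  total_poisson s (radial q) = radial (jacobi (\sum_i s i ^+ 2) q).
Proof.
have aE i : column_adj s i (radial q) = s i *: radial (fun n => q n + q n.+1).
  apply/funext => w; rewrite /column_adj /radial !(fctDE, fctZE) /annihilation /=
    /weight big_cons.
  by ring.
pose g : F := radial (fun n => q n + q n.+1).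
have -> : total_poisson s (radial q) = \sum_i s i *: column_op s i g.
  by apply: eq_bigr => i _; rewrite /letter_poisson aE linearZ.
apply/funext => w; rewrite fct_sum_apply /radial; case: w => [|j w].
  rewrite /jacobi /mulXa /= add0r -mulrA mulr_suml; apply: eq_bigr => i _.
  by rewrite fctZE /column_op !(fctDE, fctZE) /= /g /radial /=; ring.
rewrite /jacobi /mulXa [size _]/= mulrDl -mulrA mulr_suml.
have -> : \sum_i (s i *: column_op s i g) (j :: w) =
  \sum_i (s i * ((j == i)%:R * g w) + s i ^+ 2 * g (j :: w)).
  by apply: eq_bigr => i _; rewrite fctZE /column_op fctDE fctZE [creation _ _ _]/=; ring.
rewrite big_split /=; congr (_ + _).
rewrite (bigD1 j) //= eqxx mul1r big1 ?addr0 => [|i ij]; last first.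
  by rewrite eq_sym (negPf ij) mul0r mulr0.
by rewrite /g /radial /weight big_cons; ring.
Qed.

Lemma total_poisson_moment n : iter n (total_poisson s) (@vacuum R I) [::] =
  poisson_moment (\sum_i s i ^+ 2) n.
Proof.
have -> : iter n (total_poisson s) (@vacuum R I) =
    radial (iter n (jacobi (\sum_i s i ^+ 2)) (delta_seq R)).
  elim: n => [|n IH]; last by rewrite iterS IH total_poisson_radial.
  apply/funext => -[|j w]; rewrite /vacuum /radial /delta_seq /=; first by rewrite
    /weight big_nil mulr1.
  by rewrite mul0r.
by rewrite /radial /weight big_nil mulr1.
Qed.

Lemma letter_poisson_moment i n : iter n (letter_poisson s i) (@vacuum R I) [::] =
  poisson_moment (s i ^+ 2) n.
Proof.
rewrite iter_letter_poisson_lift; last by apply/funext.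
by rewrite mode_liftE !(fctDE, fctZE) /= /vacuum /= mulr1 mulr0 addr0.
Qed.

End ModelMoments.

(** * Counting noncrossing partitions *)

Section Rank.
Import fintype mathcomp.boot.finset.
Variables (T : finType) (r : rel T) (A : {set T}).
Hypothesis r_irr : {in A, forall x, ~~ r x x}.
Hypothesis r_tr : {in A & &, forall y x z, r x y -> r y z -> r x z}.
Hypothesis r_total : {in A &, forall x y, x != y -> r x y || r y x}.

(** Applied to outer classes ordered from left to right: a sum over the class that receives a new
    point becomes a sum over its position. *)
Lemma sum_rank (V : nmodType) (f : nat -> V) :
  \sum_(x in A) f #|[set y in A | r y x]| = \sum_(j < #|A|) f j.
Proof.
pose c x := #|[set y in A | r y x]|.
have c_mono : {in A &, forall x y, r x y -> (c x < c y)%N}.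
  move=> x y xA yA rxy; apply: proper_card; apply/properP; split.
    apply/subsetP => z; rewrite !inE => /andP[zA rzx]; rewrite zA.
    exact: r_tr rzx rxy.
  by exists x; rewrite !inE xA //= r_irr.
have c_lt x : x \in A -> (c x < #|A|)%N.
  move=> xA; apply: proper_card; apply/properP; split.
    by apply/subsetP => z; rewrite inE => /andP[].
  by exists x; rewrite // inE xA r_irr.
have c_inj : {in A &, injective c}.
  move=> x y xA yA cxy; apply/eqP; apply/negPn/negP => /(r_total xA yA) /orP[] /c_mono.
    by rewrite cxy ltnn => /(_ xA yA).
  by rewrite cxy ltnn => /(_ yA xA).
have [->|[x0 x0A]] := set_0Vmem A; first by rewrite big_set0 cards0 big_ord0.
have A0 : (0 < #|A|)%N by apply/card_gt0P; exists x0.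
pose h x : 'I_#|A| := insubd (Ordinal A0) (c x).
have hE x : x \in A -> h x = c x :> nat.
  by move=> xA; rewrite /h val_insubd c_lt.
have h_inj : {in A &, injective h}.
  by move=> x y xA yA hxy; apply: c_inj => //; rewrite -!hE // hxy.
transitivity (\sum_(x in A) f (h x)); first by apply: eq_bigr => x xA; rewrite hE.
rewrite -(big_imset (fun j : 'I_#|A| => f j) h_inj); apply: eq_bigl => j.
have : h @: A \subset predT by exact/subsetP.
by move/(subset_cardP _); rewrite card_in_imset // card_ord => /(_ erefl) ->.
Qed.

End Rank.

Section Jacobi2.
Variables (R : realFieldType) (a : R).

(* The coefficients of ('X + a)^o. *)
Fixpoint jbasis o : nat -> R := if o is o'.+1 then mulXa a (jbasis o') else delta_seq R.

Lemma jbasis0 o : jbasis o 0%N = a ^+ o.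
Proof. by elim: o => //= o IH; rewrite /mulXa add0r IH exprS. Qed.

(** The geometric sum for ((X + a)^o - a^o) / X. *)
Lemma jbasis_shift o d : jbasis o d.+1 = \sum_(j < o) a ^+ (o - j.+1) * jbasis j d.
Proof.
elim: o d => [|o IH] d; first by rewrite big_ord0.
rewrite big_ord_recr /= subnn mul1r {1}/mulXa addrC IH mulr_sumr; congr (_ + _).
by apply: eq_bigr => j _; rewrite mulrA -exprS -subSn.
Qed.

(** The two terms are the two ways of adding a last point to a noncrossing partition with o outer
    classes. It forms a new class, or it joins an outer class with j outer classes to its left; the
    o - j - 1 to the right then become inner and are left with a factor a. *)
Lemma jacobi_jbasis o d : jacobi a (jbasis o) d =
  jbasis o.+1 d + \sum_(j < o) a ^+ (o - j.+1) * jbasis j.+1 d.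
Proof.
have -> : jacobi a (jbasis o) d = mulXa a (jbasis o) d + mulXa a (fun n => jbasis o n.+1) d.
  by rewrite /jacobi /mulXa; case: d => [|d]; ring.
congr (_ + _); rewrite /mulXa jbasis_shift mulr_sumr; case: d => [|d].
  rewrite add0r; apply: eq_bigr => j _.
  by rewrite [X in _ = _ * X]/= /mulXa add0r mulrCA.
rewrite jbasis_shift -big_split /=; apply: eq_bigr => j _.
by rewrite /mulXa mulrDr (mulrCA a).
Qed.

Lemma jacobi_sum (J : finType) (P : pred J) (c : J -> R) (q : J -> nat -> R) d :
  jacobi a (fun n => \sum_(j | P j) c j * q j n) d
    = \sum_(j | P j) c j * jacobi a (q j) d.
Proof.
rewrite /jacobi /mulXa; case: d => [|d]; rewrite -!big_split mulr_sumr ?add0r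
  -?big_split /=;
  by apply: eq_bigr => j _; ring.
Qed.

End Jacobi2.

(** * Insertion of a last point into a noncrossing partition *)

Section NoncrossingCount.
Import fintype mathcomp.boot.finset.
Variable k : nat.
Implicit Types (P Q : {set {set 'I_k}}) (B C U V W : {set 'I_k}) (i j l m : 'I_k).

Definition crossfree P : bool :=
  [forall B in P, forall C in P, (B != C) ==>
     ~~ [exists i in B, exists j in C, exists l in B, exists m in C,
          (i < j)%N && (j < l)%N && (l < m)%N]].

Lemma crossfreeP P : reflect (forall B C i j l m, B \in P -> C \in P ->
   i \in B -> j \in C -> l \in B -> m \in C -> (i < j)%N -> (j < l)%N -> (l < m)%N -> B = C)
  (crossfree P).
Proof.
apply: (iffP forall_inP) => [h B C i j l m BP CP iB jC lB mC ij jl lm|h B BP].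
  apply/eqP/negPn/negP => BC; have /forall_inP/(_ C CP)/implyP/(_ BC)/negP := h B BP.
  apply; apply/existsP; exists i; rewrite iB; apply/existsP; exists j; rewrite jC.
  by apply/existsP; exists l; rewrite lB; apply/existsP; exists m; rewrite mC ij jl lm.
apply/forall_inP => C CP; apply/implyP; apply: contra => /existsP[i /andP[iB]].
move=> /existsP[j /andP[jC]] /existsP[l /andP[lB]] /existsP[m /andP[mC]].
by move=> /andP[/andP[ij jl] lm]; apply/eqP; exact: (h B C i j l m).
Qed.

Lemma class_gtP B C : reflect (B != C /\ exists i j l,
  [/\ i \in B, j \in B, l \in C, (i < l)%N & (l < j)%N]) (class_gt B C).
Proof.
apply: (iffP andP) => -[BC h]; split=> //.
  move/existsP: h => [i /andP[iB]] /existsP[j /andP[jB]] /existsP[l /andP[lC]].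
  by move=> /andP[il lj]; exists i, j, l.
move: h => [i [j [l [iB jB lC il lj]]]]; apply/existsP; exists i; rewrite iB.
by apply/existsP; exists j; rewrite jB; apply/existsP; exists l; rewrite lC il lj.
Qed.

Lemma innerP P U : reflect (exists2 W, W \in P & class_gt W U) (inner P U).
Proof. exact: exists_inP. Qed.

(** Partitions of initial segments stay inside one fixed ordinal type, so that the induction on n
    never changes the type. *)
Definition below n : {set 'I_k} := [set i : 'I_k | (i < n)%N].
Definition nc_below n P : bool := partition P (below n) && crossfree P.

Lemma nc_below_full P : nc_below k P = noncrossing P.
Proof.
rewrite /nc_below (_ : below k = [set: 'I_k]%SET) //.
by apply/setP => i; rewrite !inE ltn_ord.
Qed.

Definition left_of B C : bool := [exists l in B, exists u in C, (l < u)%N].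

Lemma left_ofP B C : reflect (exists l u, [/\ l \in B, u \in C & (l < u)%N]) (left_of B C).
Proof.
apply: (iffP exists_inP) => [[l lB /exists_inP[u uC lu]]|[l [u [lB uC lu]]]].
  by exists l, u.
by exists l => //; apply/exists_inP; exists u.
Qed.

Lemma part_eq P D B C x : partition P D -> B \in P -> C \in P -> x \in B -> x \in C ->
  B = C.
Proof.
move=> /partition_trivIset tP BP CP xB xC.
by rewrite -(def_pblock tP BP xB) (def_pblock tP CP xC).
Qed.

Lemma part_sub P D B x : partition P D -> B \in P -> x \in B -> x \in D.
Proof. by move=> /cover_partition <- BP xB; apply/bigcupP; exists B. Qed.

(** Of two outer classes neither encloses a point of the other, so a single pair of points decides
    their order. *)
Lemma outer_left_of P D B C l u : partition P D -> B \in P -> C \in P -> B != C ->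
  ~~ inner P B -> ~~ inner P C -> left_of B C -> l \in B -> u \in C -> (l < u)%N.
Proof.
move=> pP BP CP BC oB oC /left_ofP[l0 [u0 [l0B u0C lu0]]] lB uC.
have neq x y : x \in B -> y \in C -> x <> y :> nat.
  move=> xB yC /val_inj xy; move/eqP: BC; apply; apply: (part_eq pP BP CP xB).
  by rewrite xy.
rewrite ltn_neqAle; apply/andP; split; first exact/eqP/neq.
rewrite leqNgt; apply/negP => ul.
have nul0 := neq _ _ l0B uC; have nlu0 := neq _ _ lB u0C.
have [h|h] := ltnP u0 l.
  move/negP: oC; apply; apply/innerP; exists B => //; apply/class_gtP; split=> //.
  by exists l0, l, u0.
have {}h : (l < u0)%N by rewrite ltn_neqAle h andbT; exact/eqP.
move/negP: oB; apply; apply/innerP; exists C => //; apply/class_gtP.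
by rewrite eq_sym; split=> //; exists u, u0, l.
Qed.

Section Step.
Variables (n : nat) (t : 'I_k).
Hypothesis tn : t = n :> nat.

Lemma in_below i : (i \in below n) = (i < t)%N. Proof. by rewrite inE tn. Qed.

Lemma belowS : below n.+1 = t |: below n.
Proof. by apply/setP => i; rewrite !inE ltnS leq_eqVlt -tn -val_eqE. Qed.

Lemma t_below : t \notin below n. Proof. by rewrite in_below ltnn. Qed.

(* The point t joins the class U of P, or forms a new class if U is empty. *)
Definition extend (j : {set {set 'I_k}} * {set 'I_k}) : {set {set 'I_k}} :=
  (t |: j.2) |: (j.1 :\ j.2).

(** The inverse of [extend]; deleting [set0] takes care of a class reduced to t. *)
Definition restrict Q : {set {set 'I_k}} * {set 'I_k} :=
  let U := pblock Q t :\ t in ((U |: (Q :\ pblock Q t)) :\ set0, U).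

(** As t comes after all other points, joining it to an inner class would cross the enclosing class.
    The empty set stands for a new class. *)
Definition extendable P U := (U == set0) || ((U \in P) && ~~ inner P U).

Lemma partitionD0 P D : partition P D -> P :\ set0 = P.
Proof. by move=> /partition0 h; apply/setP => B; rewrite !inE; case: eqP => // ->. Qed.

Lemma pblock_t Q : partition Q (below n.+1) -> pblock Q t \in Q /\ t \in pblock Q t.
Proof.
move=> pQ; have tc : t \in cover Q by rewrite (cover_partition pQ) inE tn.
by rewrite pblock_mem // mem_pblock.
Qed.

Lemma restrict_notin Q : partition Q (below n.+1) -> (restrict Q).2 \notin Q :\ pblock Q t.
Proof.
move=> pQ; have [TQ tT] := pblock_t pQ; rewrite /restrict /= !inE; apply/negP =>
  /andP[UT UQ].
have [U0|[x xU]] := set_0Vmem (pblock Q t :\ t).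
  by rewrite U0 (partition0 pQ) in UQ.
have := part_eq pQ UQ TQ xU; move: (xU); rewrite inE => /andP[_ xT] /(_ xT) e.
by move: UT; rewrite {1}e eqxx.
Qed.

Lemma restrictK Q : partition Q (below n.+1) -> extend (restrict Q) = Q.
Proof.
move=> pQ; have [TQ tT] := pblock_t pQ; have := restrict_notin pQ.
rewrite /extend /restrict /=; set U := _ :\ t; set T := pblock Q t => UQ.
have -> : t |: U = T by rewrite setD1K.
have -> : ((U |: Q :\ T) :\ set0) :\ U = Q :\ T.
  apply/setP => B; rewrite !inE; case: (eqVneq B U) => [BU|] /=.
    by apply/esym/negbTE; rewrite BU; move: UQ; rewrite !inE.
  by case: (eqVneq B set0) => // -> _; rewrite (partition0 pQ) andbF.
by rewrite setD1K.
Qed.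

Lemma restrict_partition Q : partition Q (below n.+1) -> partition (restrict Q).1 (below n).
Proof.
move=> pQ; have [TQ tT] := pblock_t pQ; rewrite /restrict /=.
set T := pblock Q t; set U := T :\ t.
have p1 := partitionD1 pQ TQ; have [U0|UN0] := eqVneq U set0.
  have TE : T = [set t] by rewrite /T -(setD1K tT) -/T -/U U0 setU0.
  have -> : (U |: Q :\ T) :\ set0 = Q :\ T.
    by rewrite U0 setU1K // !inE (partition0 pQ) andbF.
  move: p1; rewrite -/T {2}TE belowS setU1K //; exact: t_below.
have dU : [disjoint U & below n.+1 :\: T].
  rewrite -setI_eq0; apply/eqP/setP => x; rewrite !inE.
  by case: (x \in T); rewrite ?andbF.
have := partitionU1 p1 UN0 dU; rewrite -/T => p2; rewrite (partitionD0 p2).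
suff -> : below n = U :|: below n.+1 :\: T by [].
apply/setP => x; rewrite belowS !inE -tn; case: (eqVneq x t) => [->|xt] /=.
  by rewrite ltnn tT.
case xT : (x \in T) => //=; have := part_sub pQ TQ xT.
by rewrite belowS !inE (negPf xt) /= tn.
Qed.

Lemma restrict_nc Q : nc_below n.+1 Q ->
  nc_below n (restrict Q).1 && extendable (restrict Q).1 (restrict Q).2.
Proof.
move=> /andP[pQ /crossfreeP cQ]; have [TQ tT] := pblock_t pQ.
have UQ := restrict_notin pQ.
rewrite /nc_below restrict_partition //=.
have pR := restrict_partition pQ; rewrite /restrict /= in UQ pR *.
set T := pblock Q t in TQ tT UQ pR *; set U := T :\ t in UQ pR *.
set P := _ :\ set0 in pR *.
have PE B : B \in P -> B = U \/ B \in Q /\ B != T.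
  by rewrite !inE => /andP[_ /orP[/eqP|/andP[]]]; [left|right].
have lift_block B : B \in P -> exists2 B', B' \in Q & B \subset B' /\ (B' = T <-> B = U).
  move=> BP; have [BU|BU] := eqVneq B U.
    by exists T => //; rewrite BU subD1set.
  have [/eqP|[BQ BT]] := PE _ BP; first by rewrite (negPf BU).
  by exists B => //; split=> //; split=> /eqP; rewrite ?(negPf BU) ?(negPf BT).
have UT x : x \in U -> x \in T by rewrite inE => /andP[].
apply/andP; split.
  apply/crossfreeP => B C i j l m BP CP iB jC lB mC ij jl lm.
  have [B' B'Q [/subsetP BB hB]] := lift_block _ BP.
  have [C' C'Q [/subsetP CC hC]] := lift_block _ CP.
  have BC' := cQ B' C' i j l m B'Q C'Q (BB _ iB) (CC _ jC) (BB _ lB) (CC _ mC) ij jl lm.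
  have [BU|BU] := eqVneq B U; first by rewrite BU; apply/esym/hC; rewrite -BC'; apply/hB.
  have [/eqP|[BQ BT]] := PE _ BP; first by rewrite (negPf BU).
  have [CU|CU] := eqVneq C U; first by rewrite CU; apply/hB; rewrite BC'; apply/hC.
  have [/eqP|[CQ CT]] := PE _ CP; first by rewrite (negPf CU).
  exact: (cQ B C i j l m).
rewrite /extendable; case: eqVneq => //= UN0; apply/andP; split.
  by rewrite !inE UN0 eqxx.
apply/negP => /innerP[W WP /class_gtP[WU [i [j [l [iW jW lU il lj]]]]]].
have [/eqP|[WQ /eqP WT]] := PE _ WP; first by rewrite (negPf WU).
apply: WT; apply: (cQ W T i l j t) => //; first exact: UT.
by have := part_sub pR WP jW; rewrite in_below.
Qed.

Section Extension.
Variables (P : {set {set 'I_k}}) (U : {set 'I_k}).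
Hypothesis ncP : nc_below n P.
Hypothesis eU : extendable P U.

Let pP : partition P (below n). Proof. by case/andP: ncP. Qed.
Let Q := extend (P, U).

Lemma in_ext_lt B x : B \in P -> x \in B -> (x < t)%N.
Proof. by move=> BP xB; rewrite -in_below (part_sub pP BP xB). Qed.

Lemma ext_mem x : x \in U -> U \in P.
Proof. by move: eU => /orP[/eqP ->|/andP[]//]; rewrite inE. Qed.

Lemma ext_U_lt x : x \in U -> (x < t)%N.
Proof. by move=> xU; exact: in_ext_lt (ext_mem xU) xU. Qed.

Lemma ext_t_notin : t \notin U.
Proof. by apply/negP => /ext_U_lt; rewrite ltnn. Qed.

Lemma extE B : B \in Q -> B = t |: U \/ B \in P /\ B != U.
Proof. by rewrite !inE => /orP[/eqP|/andP[]]; [left|right]. Qed.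

Lemma ext_in B : B \in P -> B != U -> B \in Q.
Proof. by move=> BP BU; rewrite !inE BP BU orbT. Qed.

Lemma ext_top_notin : t |: U \notin P :\ U.
Proof.
apply/negP; rewrite inE => /andP[_ TP]; have := in_ext_lt TP (setU11 _ _).
by rewrite ltnn.
Qed.

Lemma ext_partition : partition Q (below n.+1).
Proof.
have tU0 : t |: U != set0 by apply/set0Pn; exists t; rewrite setU11.
have := ext_t_notin; move: eU => /orP[/eqP U0|/andP[UP _]] tU.
  rewrite /Q /extend /= U0 setU0 belowS (partitionD0 pP).
  apply: partitionU1 => //; first by move: tU0; rewrite U0 setU0.
  by rewrite disjoints1 t_below.
have := partitionD1 pP UP => p1; rewrite /Q /extend /=.
have -> : below n.+1 = (t |: U) :|: (below n :\: U).
  rewrite belowS; apply/setP => x; rewrite !inE; case: (x == t) => //=.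
  case xU : (x \in U) => //=; by have := part_sub pP UP xU; rewrite inE.
apply: partitionU1 => //; rewrite -setI_eq0; apply/eqP/setP => x; rewrite !inE.
by case: eqVneq => [->|_] /=; [rewrite -tn ltnn andbF|case: (x \in U); rewrite ?andbF].
Qed.

Lemma ext_pblock : pblock Q t = t |: U.
Proof.
apply: def_pblock; [exact: partition_trivIset ext_partition| |exact: setU11].
by rewrite !inE eqxx.
Qed.

Lemma extendK : restrict Q = (P, U).
Proof.
rewrite /restrict ext_pblock (setU1K ext_t_notin) /Q /extend /= (setU1K ext_top_notin).
congr (_, _); move: eU => /orP[/eqP U0|/andP[UP _]].
  by rewrite U0 (partitionD0 pP) setU1K // (partition0 pP).
by rewrite setD1K // (partitionD0 pP).
Qed.

Lemma ext_outer_U W i j l : W \in P -> W != U -> i \in W -> j \in W -> l \in U ->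
  (i < l)%N -> (l < j)%N -> False.
Proof.
move=> WP WU iW jW lU il lj; move: eU => /orP[/eqP U0|/andP[UP /negP]].
  by rewrite U0 inE in lU.
by apply; apply/innerP; exists W => //; apply/class_gtP; split=> //; exists i, j, l.
Qed.

Lemma ext_nc : nc_below n.+1 Q.
Proof.
case/andP: (ncP) => _ /crossfreeP cP.
rewrite /nc_below ext_partition; apply/crossfreeP => B C i j l m BQ CQ.
have [->|[BP BU]] := extE BQ; have [->|[CP CU]] := extE CQ => // iB jC lB mC ij jl lm.
- have mt := in_ext_lt CP mC.
  have lU : l \in U.
    by move: lB; rewrite !inE => /orP[/eqP lt|//]; move: lm; rewrite lt ltnNge (ltnW mt).
  have iU : i \in U.
    by move: iB; rewrite !inE => /orP[/eqP it|//]; move: ij;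
      rewrite it ltnNge (ltnW (ltn_trans jl (ltn_trans lm mt))).
  have := cP U C i j l m (ext_mem lU) CP iU jC lU mC ij jl lm => /esym/eqP.
  by rewrite (negPf CU).
- have lt := in_ext_lt BP lB.
  have jU : j \in U.
    by move: jC; rewrite !inE => /orP[/eqP jt|//]; move: jl; rewrite jt ltnNge (ltnW lt).
  by case: (ext_outer_U BP BU iB lB jU ij jl).
exact: (cP B C i j l m).
Qed.

(** The enlarged class reaches from U up to t, and thus encloses every class having a point to the
    right of some point of U. *)
Lemma ext_outer : [set C in Q | ~~ inner Q C] =
  (t |: U) |: [set B in P | [&& ~~ inner P B, B != U & ~~ left_of U B]].
Proof.
apply/setP => C; rewrite in_setU1 !inE.
have [->|CT] := eqVneq C (t |: U) => /=.
  apply/negP => /innerP[W WQ /class_gtP[WT [i [j [l [iW jW lT il lj]]]]]].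
  have [/eqP|[WP WU]] := extE WQ; first by rewrite (negPf WT).
  have jt := in_ext_lt WP jW.
  have lU : l \in U.
    by move: lT; rewrite !inE => /orP[/eqP lt|//]; move: lj; rewrite lt ltnNge (ltnW jt).
  exact: (ext_outer_U WP WU iW jW lU il lj).
have [_|CU] := eqVneq C U; first by rewrite !andbF.
case CP: (C \in P) => //=; rewrite -negb_or; congr negb; apply/idP/idP.
  move=> /innerP[W WQ /class_gtP[WC [i [j [l [iW jW lC il lj]]]]]].
  have [WE|[WP WU]] := extE WQ; last first.
    by apply/orP; left; apply/innerP; exists W => //; apply/class_gtP; split=> //;
      exists i, j, l.
  apply/orP; right; apply/left_ofP; exists i, l; split=> //.
  move: iW; rewrite WE !inE => /orP[/eqP it|//].
  by move: il; rewrite it ltnNge (ltnW (in_ext_lt CP lC)).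
case/orP => [/innerP[W WP /class_gtP[WC [i [j [l [iW jW lC il lj]]]]]]|].
  have [WU|WU] := eqVneq W U.
    apply/innerP; exists (t |: U); first by rewrite !inE eqxx.
    apply/class_gtP; rewrite eq_sym; split=> //.
    by exists i, j, l; rewrite !inE -WU iW jW !orbT.
  apply/innerP; exists W; first exact: ext_in.
  by apply/class_gtP; split=> //; exists i, j, l.
move=> /left_ofP[i [l [iU lC il]]]; apply/innerP; exists (t |: U).
  by rewrite !inE eqxx.
apply/class_gtP; rewrite eq_sym; split=> //.
by exists i, t, l; rewrite !inE eqxx iU orbT; split=> //; exact: in_ext_lt CP lC.
Qed.

Lemma ext_num_outer :
  num_outer Q = #|[set B in P | [&& ~~ inner P B, B != U & ~~ left_of U B]]|.+1.
Proof.
rewrite /num_outer ext_outer cardsU1 inE; case tUP : (_ \in P) => //=.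
by have := in_ext_lt tUP (setU11 _ _); rewrite ltnn.
Qed.

Lemma ext_card : #|Q| = #|P :\ U|.+1.
Proof. by rewrite /Q /extend cardsU1 ext_top_notin. Qed.

End Extension.

Lemma num_innerD P : (num_inner P + num_outer P)%N = #|P|.
Proof.
rewrite /num_inner /num_outer -cardsUI [X in (_ + X)%N]eq_card0 => [|B].
  rewrite addn0; apply: eq_card => B; rewrite !inE -andb_orr orbN andbT.
  by [].
by rewrite !inE; case: (B \in P) => //=; rewrite andbN.
Qed.

Section Weight.
Variables (R : realFieldType) (a : R).

(** The coefficient of X^d when inner classes weigh a and outer ones X + a. The extra variable
    records the number of outer classes, on which the possible insertions depend; d = 0 gives back
    a^#|P|. *)
Definition nc_weight P d : R := a ^+ num_inner P * jbasis a (num_outer P) d.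

Lemma nc_weight_ext0 P d : nc_below n P ->
  nc_weight (extend (P, set0)) d = a ^+ num_inner P * jbasis a (num_outer P).+1 d.
Proof.
move=> ncP; have pP : partition P (below n) by case/andP: ncP.
have eU : extendable P set0 by rewrite /extendable eqxx.
have o : num_outer (extend (P, set0)) = (num_outer P).+1.
  rewrite (ext_num_outer ncP eU); congr _.+1; apply: eq_card => B; rewrite !inE.
  case BP : (B \in P) => //=; have -> : B != set0.
    by apply: contraFneq (partition0 pP) => <-.
  have -> : left_of set0 B = false; last by rewrite andbT.
  by apply/negbTE/negP => /left_ofP[l [u []]]; rewrite inE.
have := ext_card set0 ncP; rewrite -num_innerD o (partitionD0 pP) -num_innerD.
by rewrite addnS => -[] /addIn e; rewrite /nc_weight o e.
Qed.

Lemma nc_weight_extU P U d : nc_below n P -> U \in P -> ~~ inner P U ->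
  let c := #|[set B in [set C in P | ~~ inner P C] | (B != U) && left_of B U]| in
  nc_weight (extend (P, U)) d =
    a ^+ num_inner P * (a ^+ (num_outer P - c.+1) * jbasis a c.+1 d).
Proof.
move=> ncP UP oU c; have pP : partition P (below n) by case/andP: ncP.
have eU : extendable P U by rewrite /extendable UP oU orbT.
have o : num_outer (extend (P, U)) = c.+1.
  rewrite (ext_num_outer ncP eU); congr _.+1; apply: eq_card => B; rewrite !inE.
  case BP : (B \in P) => //=; case oB : (inner P B) => //=.
  case: eqVneq => //= BU; move/negbT: oB => oB.
  have [b bB] : exists b, b \in B.
    by apply/set0Pn; apply: contraFneq (partition0 pP) => <-.
  have [u uU] : exists u, u \in U.
    by apply/set0Pn; apply: contraFneq (partition0 pP) => <-.
  apply/negP/idP => [h|/(outer_left_of pP BP UP BU oB oU)/(_ bB uU) bu]; last first.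
    rewrite eq_sym in BU.
    by move=> /(outer_left_of pP UP BP BU oU oB)/(_ uU bB); rewrite ltnNge (ltnW bu).
  apply/left_ofP; exists b, u; split=> //; rewrite ltnNge leq_eqVlt.
  apply/negP => /orP[/eqP/val_inj ub|ub]; last by apply: h; apply/left_ofP; exists u, b.
  by move/eqP: BU; apply; apply: (part_eq pP BP UP bB); rewrite -ub.
have cP := cardsD1 U P; rewrite UP add1n in cP.
have := ext_card U ncP; rewrite -cP -!num_innerD o => /= e.
rewrite /nc_weight o mulrA -exprD; congr (_ ^+ _ * _).
have cn : (c < num_outer P)%N.
  apply: proper_card; apply/properP; split; last by exists U; rewrite !inE ?UP ?eqxx ?andbF.
  by apply/subsetP => B; rewrite !inE => /andP[].
by apply: (@addIn c.+1); rewrite e -addnA subnK.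
Qed.

(** Removing t is a bijection onto the pairs of a partition P and an admissible U. For fixed P,
    ranking the outer classes turns the sum over U into [jacobi_jbasis]. *)
Lemma sum_nc_weightS d : \sum_(Q | nc_below n.+1 Q) nc_weight Q d =
  jacobi a (fun d => \sum_(P | nc_below n P) nc_weight P d) d.
Proof.
have eK Q : nc_below n.+1 Q -> extend (restrict Q) = Q.
  by move=> /andP[pQ _]; exact: restrictK.
rewrite (reindex_onto extend restrict eK) /nc_weight jacobi_sum -/nc_weight.
transitivity (\sum_(j | nc_below n j.1 && extendable j.1 j.2) nc_weight (extend j) d).
  apply: eq_bigl => -[P U]; apply/andP/andP => /= [[ncQ /eqP e]|[ncP eU]].
    by have := restrict_nc ncQ; rewrite e => /andP[].
  by split; [exact: ext_nc|rewrite extendK].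
rewrite -(pair_big_dep (nc_below n) extendable (fun P U => nc_weight (extend (P, U)) d)) /=.
apply: eq_bigr => P ncP; have pP : partition P (below n) by case/andP: ncP.
rewrite (bigD1 set0) /extendable ?eqxx //= nc_weight_ext0 // jacobi_jbasis [RHS]mulrDr.
congr (_ + _); pose A := [set C in P | ~~ inner P C].
transitivity (\sum_(U in A) nc_weight (extend (P, U)) d).
  apply: eq_bigl => U; rewrite inE; case: eqVneq => [->|] //=; last by rewrite andbT.
  by rewrite (partition0 pP).
transitivity (\sum_(U in A) a ^+ num_inner P *
    (fun c => a ^+ (num_outer P - c.+1) * jbasis a c.+1 d)
      #|[set B in A | (B != U) && left_of B U]|).
  by apply: eq_bigr => U; rewrite inE => /andP[UP oU]; exact: nc_weight_extU.
rewrite -mulr_sumr; congr (_ * _).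
apply: (@sum_rank _ (fun B U => (B != U) && left_of B U) A _ _ _ _
          (fun c => a ^+ (num_outer P - c.+1) * jbasis a c.+1 d)).
- by move=> U _; rewrite eqxx.
- move=> V U W; rewrite !inE => /andP[VP oV] /andP[UP oU] /andP[WP oW].
  move=> /andP[UV lUV] /andP[VW lVW].
  have [v vV] : exists v, v \in V.
    by apply/set0Pn; apply: contraFneq (partition0 pP) => <-.
  have [u uU] : exists u, u \in U.
    by apply/set0Pn; apply: contraFneq (partition0 pP) => <-.
  have [w wW] : exists w, w \in W.
    by apply/set0Pn; apply: contraFneq (partition0 pP) => <-.
  have uv := outer_left_of pP UP VP UV oU oV lUV uU vV.
  have vw x := outer_left_of pP VP WP VW oV oW lVW vV x.
  apply/andP; split; last first.
    by apply/left_ofP; exists u, w; split=> //; apply: ltn_trans uv (vw _ wW).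
  by apply/eqP => UW; rewrite UW in uU; have := vw _ uU; rewrite ltnNge (ltnW uv).
- move=> U V; rewrite !inE => /andP[UP oU] /andP[VP oV] UV.
  rewrite UV eq_sym UV /=.
  have [v vV] : exists v, v \in V.
    by apply/set0Pn; apply: contraFneq (partition0 pP) => <-.
  have [u uU] : exists u, u \in U.
    by apply/set0Pn; apply: contraFneq (partition0 pP) => <-.
  have [uv|vu|/val_inj uv] := ltngtP u v.
  + by apply/orP; left; apply/left_ofP; exists u, v.
  + by apply/orP; right; apply/left_ofP; exists v, u.
  by move/eqP: UV; case; apply: (part_eq pP UP VP uU); rewrite uv.
Qed.

End Weight.

End Step.

Lemma sum_nc_weight (R : realFieldType) (a : R) n d : (n <= k)%N ->
  \sum_(P | nc_below n P) nc_weight a P d = iter n (jacobi a) (delta_seq R) d.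
Proof.
elim: n d => [|n IH] d nk; last first.
  rewrite (@sum_nc_weightS n (Ordinal nk) erefl) /= /jacobi /mulXa.
  by case: d => [|d]; rewrite !IH // ltnW.
rewrite (big_pred1 set0) => [|P].
  rewrite /nc_weight /num_inner /num_outer !eq_card0 ?expr0 ?mul1r // => B; by rewrite !inE.
rewrite /nc_below (_ : below 0 = set0); last by apply/setP => i; rewrite !inE.
rewrite partition_set0; apply/andP/eqP => [[/eqP -> //]|->]; split; first by rewrite eqxx.
by apply/crossfreeP => B C i j l m; rewrite inE.
Qed.

End NoncrossingCount.

(** Identifies the moments of a variable with all free cumulants equal to a as those of the
    model. *)
Lemma noncrossing_moment (R : realFieldType) (a : R) n :
  \sum_(P : {set {set 'I_n}} | noncrossing P) a ^+ #|P| = poisson_moment a n.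
Proof.
rewrite /poisson_moment -(sum_nc_weight a 0 (leqnn n)); apply: eq_big => P.
  by rewrite nc_below_full.
by move=> _; rewrite /nc_weight jbasis0 -exprD num_innerD.
Qed.

(** * Transfer of joint moments *)

Lemma has_cat_split (T : Type) (p : pred T) (l : seq T) : has p l ->
  exists l1 u l2, l = l1 ++ u :: l2 /\ p u.
Proof.
elim: l => //= u l IH; case pu : (p u) => /=; first by exists [::], u, l.
by move=> /IH[l1 [v [l2 [-> pv]]]]; exists (u :: l1), v, l2.
Qed.

Lemma unsorted_cat_split (T : Type) (e : rel T) (l : seq T) : ~~ sorted e l ->
  exists l1 u v l2, l = l1 ++ u :: v :: l2 /\ ~~ e u v.
Proof.
case: l => //= u l; elim: l u => //= v l IH u; case uv : (e u v) => /=.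
  by move=> /IH[l1 [x [y [l2 [e1 exy]]]]]; exists (u :: l1), x, y, l2; rewrite e1.
by move=> _; exists [::], u, v, l; rewrite uv.
Qed.

Section JointMoments.
Variables (K : comNzRingType) (I : eqType).
Local Notation letter := (I * nat * bool)%type.
Implicit Types (l : seq letter) (m : I -> nat -> K) (Phi : seq letter -> K).

(* A letter (i, k, b) stands for x_i^k, recentred by its expectation m i k if b. *)
Record free_functional Phi m : Prop := {
  ff_nil : Phi [::] = 1;
  ff_centered : forall l1 l2 i k, Phi (l1 ++ (i, k, true) :: l2) =
    Phi (l1 ++ (i, k, false) :: l2) - m i k * Phi (l1 ++ l2);
  ff_merge : forall l1 l2 i k k', Phi (l1 ++ (i, k, false) :: (i, k', false) :: l2) =
    Phi (l1 ++ (i, k + k', false)%N :: l2);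
  ff_free : forall l, l != [::] -> sorted (fun u v : letter => u.1.1 != v.1.1) l ->
    all (fun u => u.2) l -> Phi l = 0
}.

Definition letter_deg i l := (\sum_(u <- l | u.1.1 == i) u.1.2)%N.

Lemma letter_deg_cat i l1 l2 : letter_deg i (l1 ++ l2) = (letter_deg i l1 + letter_deg
  i l2)%N.
Proof. by rewrite /letter_deg big_cat. Qed.

Lemma letter_deg_cons i j k b l :
  letter_deg i ((j, k, b) :: l) = ((j == i) * k + letter_deg i l)%N.
Proof. by rewrite /letter_deg big_cons /=; case: eqP => _; rewrite ?mul1n ?mul0n. Qed.

(* The degrees are bounded letter by letter, so that all mixed moments of degree
   n + 1 are known before the pure ones. *)
Lemma free_functional_uniq Phi Phi' m m' n :
  free_functional Phi m -> free_functional Phi' m' ->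
  (forall i k, (k <= n)%N -> m i k = m' i k) ->
  forall l, (forall i, letter_deg i l <= n)%N -> Phi l = Phi' l.
Proof.
(* Induction on the length, then on the number of uncentred letters. Centring a letter lowers this
   number or shortens the word; once all letters are centred, an alternating word has value 0, and
   two neighbours of equal index merge into shorter words. *)
move=> F F' mm l; have [N] := ubnP (size l); elim: N l => // N IHN l lN.
have [c] := ubnP (count (fun u => ~~ u.2) l); elim: c l lN => // c IHc l lN lc dl.
have [/has_cat_split[l1 [[[i k] b] [l2 [lE /= bF]]]]|] := boolP (has (fun u => ~~ u.2) l).
  have {bF}b0 : b = false by case: b bF {lE}.
  rewrite b0 in lE => {b b0}.
  have dl' j : (letter_deg j l1 + ((i == j) * k + letter_deg j l2) <= n)%N.
    by have := dl j; rewrite lE letter_deg_cat letter_deg_cons.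
  have e1 : Phi (l1 ++ (i, k, true) :: l2) = Phi' (l1 ++ (i, k, true) :: l2).
    apply: IHc.
    - by move: lN; rewrite lE !size_cat.
    - by move: lc; rewrite lE !count_cat /=; lia.
    by move=> j; rewrite letter_deg_cat letter_deg_cons.
  have e2 : Phi (l1 ++ l2) = Phi' (l1 ++ l2).
    apply: IHN; first by move: lN; rewrite lE !size_cat /=; lia.
    by move=> j; rewrite letter_deg_cat; have := dl' j; lia.
  have kn : (k <= n)%N by have := dl' i; rewrite eqxx; lia.
  rewrite lE -(subrK (m i k * Phi (l1 ++ l2)) (Phi _)) -(ff_centered F) e1 e2 mm //.
  by rewrite (ff_centered F') subrK.
move=> /hasPn al; have {}al : all (fun u => u.2) l by apply/allP => u /al; rewrite negbK.
have [sl|/unsorted_cat_split] := boolP (sorted (fun u v : letter => u.1.1 != v.1.1) l).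
  have [->|l0] := eqVneq l [::]; first by rewrite (ff_nil F) (ff_nil F').
  by rewrite (ff_free F) // (ff_free F').
move=> [l1 [[[i k] b] [[[j k'] b'] [l2 [lE /=]]]]]; rewrite negbK => /eqP ji.
subst j l; move: al dl lN; rewrite all_cat /= => /and4P[_ bT bT' _].
case: b bT {lc} => // _; case: b' bT' => // _ dl lN.
have dl' j : (letter_deg j l1 + ((i == j) * k + ((i == j) * k' + letter_deg j l2)) <= n)%N.
  by have := dl j; rewrite letter_deg_cat !letter_deg_cons.
have kn : (k + k' <= n)%N by have := dl' i; rewrite eqxx; lia.
have sl : (size l1 + (size l2).+2 < N.+1)%N by move: lN; rewrite size_cat.
have e1 : Phi (l1 ++ (i, k + k', false)%N :: l2) = Phi' (l1 ++ (i, k + k', false)%N :: l2).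
  apply: IHN; first by rewrite size_cat /=; lia.
  by move=> j; rewrite letter_deg_cat letter_deg_cons; have := dl' j; lia.
have e2 : Phi (l1 ++ (i, k, false) :: l2) = Phi' (l1 ++ (i, k, false) :: l2).
  apply: IHN; first by rewrite size_cat /=; lia.
  by move=> j; rewrite letter_deg_cat letter_deg_cons; have := dl' j; lia.
have e3 : Phi (l1 ++ (i, k', true) :: l2) = Phi' (l1 ++ (i, k', true) :: l2).
  apply: IHN; first by rewrite size_cat /=; lia.
  by move=> j; rewrite letter_deg_cat letter_deg_cons; have := dl' j; lia.
have step (G : seq letter -> K) mG : free_functional G mG ->
    G (l1 ++ (i, k, true) :: (i, k', true) :: l2) =
    G (l1 ++ (i, k + k', false)%N :: l2) - mG i k' * G (l1 ++ (i, k, false) :: l2)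
      - mG i k * G (l1 ++ (i, k', true) :: l2).
  move=> FG; rewrite (ff_centered FG) -(ff_merge FG).
  by rewrite -(cat_rcons (i, k, false)) (ff_centered FG) !cat_rcons.
rewrite (step _ _ F) (step _ _ F') e1 e2 e3 !mm //; lia.
Qed.

End JointMoments.

Section Transfer.
Variables (R : realType) (M : von_neumann_algebra R) (phi : M -> R[i]).
Hypothesis tr : faithful_normal_tracial_state phi.
Local Notation Re := (@complex.Re R).

Section Algebra.
Variables (I : eqType) (x : I -> M).
Hypothesis x_free : freely_independent phi x.

Definition letter_val (u : I * nat * bool) : M :=
  let: (i, k, b) := u in x i ^+ k - (phi (x i ^+ k) *+ b) *: 1.

Lemma algebra_functional :
  free_functional (fun l => phi (\prod_(u <- l) letter_val u)) (fun i k => phi (x i ^+ k)).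
Proof.
split.
- by rewrite big_nil (state_unital tr).
- move=> l1 l2 i k; rewrite !big_cat !big_cons /= mulr0n scale0r subr0 mulr1n.
  rewrite mulrBl mulrBr -scalerAl mul1r -scalerAr.
  by rewrite -scaleN1r (phiD tr) !(phiZ tr) mulN1r.
- move=> l1 l2 i k k'; rewrite !big_cat !big_cons /= !mulr0n !scale0r !subr0.
  by rewrite [in RHS]exprD -(mulrA (x i ^+ k)).
move=> l l0 sl al; pose s := [seq (u.1.1, letter_val u) | u <- l].
have -> : \prod_(u <- l) letter_val u = \prod_(u <- s) u.2 by rewrite big_map.
apply: x_free.
- by rewrite /s; case: l l0 {sl al s}.
- by rewrite sorted_map; apply: sub_sorted sl.
move=> _ /mapP[[[i k] b] ul ->] /=; move/allP: al => /(_ _ ul) /= ->; split.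
  exists ('X^k - (phi (x i ^+ k))%:P) => //.
  by rewrite rmorphB rmorphXn /= horner_algX horner_algC mulr1n.
by rewrite mulr1n -scaleNr (phiD tr) (phiZ tr) (state_unital tr) mulr1 subrr.
Qed.

End Algebra.

Section Model.
Variables (I : finType) (s : I -> R).

Lemma letter_op_linear u : linear (letter_op s u).
Proof.
case: u => [[i k] b] c f g; rewrite /letter_op.
have -> : iter k (letter_poisson s i) (c *: f + g) = c *: iter k (letter_poisson s i) f
  + iter k (letter_poisson s i) g.
  by elim: k => //= k ->; rewrite linearP.
rewrite scalerDr scalerBr scalerA mulrC -scalerA opprD addrACA.
by [].
Qed.

Lemma model_functional : free_functional
  (fun l => (foldr (letter_op s) (@vacuum R I) l [::])%:C%C)
  (fun i k => (poisson_moment (s i ^+ 2) k)%:C%C).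
Proof.
have fold_linear l f g (c : R) : foldr (letter_op s) (c *: f + g) l =
    c *: foldr (letter_op s) f l + foldr (letter_op s) g l.
  by elim: l => //= u l ->; rewrite letter_op_linear.
split=> //=.
- by move=> l1 l2 i k; rewrite !foldr_cat /= mulr0n scale0r subr0 mulr1n
    addrC -scaleNr fold_linear fctDE fctZE rmorphD rmorphM rmorphN /= mulNr addrC.
- by move=> l1 l2 i k k'; rewrite !foldr_cat /= !mulr0n !scale0r !subr0 iterD.
by move=> l l0 sl al; rewrite model_free.
Qed.

Fixpoint words n : seq (seq I) :=
  if n is n'.+1 then [seq i :: w | i <- enum I, w <- words n'] else [:: [::]].

Lemma size_words n w : w \in words n -> size w = n.
Proof.
by elim: n w => [|n IH] w /=; [rewrite inE => /eqP ->|case/allpairsP => -[i v] [_ /IH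
  /= <- ->]].
Qed.

Lemma nseq_words n i : nseq n i \in words n.
Proof.
elim: n => //= n IH; apply/allpairsP; exists (i, nseq n i); split=> //.
by rewrite mem_enum.
Qed.

Lemma sum_expr_words (A : pzRingType) (x : I -> A) n :
  (\sum_i x i) ^+ n = \sum_(w <- words n) \prod_(i <- w) x i.
Proof.
elim: n => [|n IH] /=; first by rewrite big_seq1 big_nil.
rewrite big_allpairs_dep big_enum exprS IH mulr_suml; apply: eq_bigr => i _.
by rewrite mulr_sumr; apply: eq_bigr => w _; rewrite big_cons.
Qed.

Lemma iter_total_poisson_words n (f : seq I -> R^o) :
  iter n (total_poisson s) f = \sum_(w <- words n) foldr (letter_poisson s) f w.
Proof.
elim: n => [|n IH] /=; first by rewrite big_seq1.
rewrite big_allpairs_dep big_enum IH; apply: eq_bigr => i _.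
by rewrite linear_sum.
Qed.

Section Words.
Variable x : I -> M.
Hypothesis x_free : freely_independent phi x.

Definition word_moment w : R := foldr (letter_poisson s) (@vacuum R I) w [::].

Lemma word_transfer_le n w :
  (forall i k, (k <= n)%N -> phi (x i ^+ k) = (poisson_moment (s i ^+ 2) k)%:C%C) ->
  (forall i, (count_mem i w <= n)%N) ->
  phi (\prod_(i <- w) x i) = (word_moment w)%:C%C.
Proof.
move=> mx cw; pose l : seq (I * nat * bool) := [seq (i, 1%N, false) | i <- w].
have := free_functional_uniq (algebra_functional x_free) model_functional mx (l := l).
rewrite big_map; under eq_bigr => i _ do rewrite /= expr1 mulr0n scale0r subr0.
have -> : foldr (letter_op s) (@vacuum R I) l = foldr (letter_poisson s) (@vacuum R I) w.
  by rewrite /l; elim: w {cw l} => //= i w ->; rewrite scale0r subr0.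
apply=> i; rewrite /letter_deg big_map /=.
by rewrite sum1_count; exact: cw.
Qed.

Hypothesis mx : forall i k, phi (x i ^+ k) = (poisson_moment (s i ^+ 2) k)%:C%C.

Lemma word_transfer w : phi (\prod_(i <- w) x i) = (word_moment w)%:C%C.
Proof.
by apply: (@word_transfer_le (size w)) => // i; exact: count_size.
Qed.

(** Additivity of the rates is transported from the model word by word. *)
Lemma poisson_sum n : phi ((\sum_i x i) ^+ n) =
  (poisson_moment (\sum_i s i ^+ 2) n)%:C%C.
Proof.
rewrite -total_poisson_moment iter_total_poisson_words sum_expr_words (phi_sum tr)
  fct_sum_apply rmorph_sum /=.
by apply: eq_bigr => w _; exact: word_transfer.
Qed.

End Words.

(** In degree n + 1, every nonconstant word uses each letter at most n times, so its moment agrees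
    with the model by induction. The constant words all contribute the same discrepancy d, and their
    number is not zero; comparing the moments of the sum gives d = 0. *)
Lemma iid_poisson (x : I -> M) (s0 a : R) : (0 < #|I|)%N ->
  freely_independent phi x -> (forall i j, same_distribution phi (x i) (x j)) ->
  (forall i, s i = s0) -> \sum_i s i ^+ 2 = a ->
  (forall n, phi ((\sum_i x i) ^+ n) = (poisson_moment a n)%:C%C) ->
  forall i k, phi (x i ^+ k) = (poisson_moment (s i ^+ 2) k)%:C%C.
Proof.
move=> /card_gt0P[i0 _] x_free x_id sE aE mX.
have x_id' i j k : phi (x i ^+ k) = phi (x j ^+ k).
  by have := x_id i j ('X^k); rewrite !rmorphXn /= !horner_algX.
suff h n : forall i k, (k <= n)%N -> phi (x i ^+ k) = (poisson_moment (s i ^+ 2) k)%:C%C.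
  by move=> i k; exact: (h k).
elim: n => [|n IH] i k.
  rewrite leqn0 => /eqP ->; rewrite expr0 (state_unital tr).
  by rewrite /poisson_moment /= /delta_seq.
rewrite leq_eqVlt => /orP[/eqP -> {k}|]; last by rewrite ltnS; exact: IH.
pose d := phi (x i ^+ n.+1) - (poisson_moment (s i ^+ 2) n.+1)%:C%C.
pose const (w : seq I) := [exists j : I, w == nseq n.+1 j].
have dw w : w \in words n.+1 ->
    phi (\prod_(i <- w) x i) - (word_moment w)%:C%C = (const w)%:R * d.
  move=> /size_words sw; rewrite /const; case: existsP => [[j /eqP wE]|nw].
    have -> : \prod_(i <- w) x i = x j ^+ n.+1.
      by rewrite wE; elim: (n.+1) => [|m IHm]; rewrite ?big_nil // exprS -IHm big_cons.
    have -> : word_moment w = poisson_moment (s j ^+ 2) n.+1.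
      rewrite -letter_poisson_moment /word_moment wE; congr (_ [::]).
      by elim: (n.+1) => //= m ->.
    by rewrite mul1r /d (x_id' i j) !sE.
  rewrite mul0r (@word_transfer_le x x_free n) ?subrr // => j.
  rewrite -ltnS -sw ltn_neqAle count_size andbT; apply/eqP => cj.
  apply: nw; exists j; rewrite -sw; apply/eqP/all_pred1P.
  by rewrite all_count cj.
have := mX n.+1; rewrite -aE -total_poisson_moment iter_total_poisson_words
  sum_expr_words (phi_sum tr).
rewrite fct_sum_apply rmorph_sum /= => /eqP; rewrite -subr_eq0 -sumrB big_seq.
under eq_bigr => w hw do rewrite dw //.
rewrite -big_seq -mulr_suml mulf_eq0 => /orP[|]; last by rewrite subr_eq0 => /eqP.
rewrite -natr_sum pnatr_eq0 sum_nat_seq_eq0 => /allP/(_ _ (nseq_words n.+1 i0)) /=.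
by rewrite eqb0 => /existsP; case; exists i0.
Qed.

End Model.

End Transfer.

(** * Words of labels *)

Section ColoredSum.
Variables (T : eqType) (I : finType) (V : nmodType) (act : I -> V -> V).
Implicit Types (c : T -> option I) (w : seq T) (v : V) (t : T) (i : I).

Definition recolor c t i : T -> option I := fun u => if u == t then Some i else c u.

(* The letters coloured by c act with their colour; each other label is summed
   over all its colours. *)
Fixpoint colored_sum c w v : V :=
  if w is t :: w' then
    if c t is Some i then act i (colored_sum c w' v)
    else \sum_i act i (colored_sum (recolor c t i) w' v)
  else v.

Lemma eq_colored_sum c c' w v : {in w, c =1 c'} -> colored_sum c w v = colored_sum c' w v.
Proof.
elim: w c c' => //= t w IH c c' cc; rewrite -(cc t) ?mem_head //.
have cw : {in w, c =1 c'} by move=> u uw; apply: cc; rewrite inE uw orbT.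
case: (c t) => [i|]; first by congr (act i _); exact: IH.
apply: eq_bigr => i _; congr (act i _); apply: IH => u uw.
by rewrite /recolor cw.
Qed.

Lemma colored_sum_cons c t i w v : c t = Some i ->
  colored_sum c (t :: w) v = act i (colored_sum c w v).
Proof. by move=> /= ->. Qed.

(** A label occurring on both sides must be coloured beforehand, since otherwise one sum over its
    colour would run through both factors. *)
Lemma colored_sum_cat c w1 w2 v : {in w1, forall t, t \in w2 -> c t != None} ->
  colored_sum c (w1 ++ w2) v = colored_sum c w1 (colored_sum c w2 v).
Proof.
elim: w1 c => //= t w IH c cc.
have cw : {in w, forall t, t \in w2 -> c t != None}.
  by move=> u uw; apply: cc; rewrite inE uw orbT.
case ct : (c t) => [i|]; first by congr (act i _); exact: IH.
apply: eq_bigr => i _; congr (act i _).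
have tw2 : t \notin w2 by apply/negP => /(cc t (mem_head _ _)); rewrite ct.
rewrite IH; last first.
  by move=> u uw uw2; rewrite /recolor; case: (u == t) => //; exact: (cw u uw).
congr (colored_sum _ _ _); apply: eq_colored_sum => u uw2; rewrite /recolor.
by case: eqP => // ut; rewrite -ut uw2 in tw2.
Qed.

End ColoredSum.

(** * Estimates uniform in N for the operators of a word *)

Section Asymptotics.
Variables (R : realFieldType) (a : R) (sigma : nat -> R).
Hypothesis sigmaE : forall N, (0 < N)%N -> N%:R * sigma N ^+ 2 = a.

Local Notation F N := (seq 'I_N -> R^o).
Local Notation wt N := (fun _ : 'I_N => sigma N).
Local Notation column_op N := (column_op (wt N)).
Local Notation column_adj N := (column_adj (wt N)).
Local Notation letter_poisson N := (letter_poisson (wt N)).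
Local Notation total_poisson N := (total_poisson (wt N)).
Local Notation family := (forall N, 'I_N -> F N -> F N).

(** C is uniform in N and i, whereas d may depend on N, as it disappears on the vacuum. An operator
    without index is a constant family. *)
Definition uniformly (K : nat -> R -> R) (T : family) :=
  exists2 C, 0 <= C & forall N, (0 < N)%N -> exists d, forall i, op_bounded d (T N i)
    (K N C).

Definition bounded := uniformly (fun _ C => C).
(** Squared norms are bounded and [sigma N ^+ 2] is a / N, so [small] means a norm of order
    N^(-1/2). *)
Definition small := uniformly (fun N C => C * sigma N ^+ 2).

Lemma aN N : (0 < N)%N -> #|'I_N|%:R * sigma N ^+ 2 = a.
Proof. by move=> N0; rewrite card_ord sigmaE. Qed.

Lemma a_pos : 0 <= a.
Proof. by rewrite -(sigmaE (ltn0Sn 0)) mulr_ge0 // sqr_ge0. Qed.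

Lemma sigma_le N : (0 < N)%N -> sigma N ^+ 2 <= a.
Proof.
by move=> N0; rewrite -(sigmaE N0) ler_peMl ?sqr_ge0 // ler1n.
Qed.

Lemma small_bounded T : small T -> bounded T.
Proof.
move=> [C C0 h]; exists (C * a); first by rewrite mulr_ge0 // a_pos.
move=> N N0; have [d hd] := h N N0; exists d => i.
apply: op_bounded_le (hd i) => //; first by rewrite mulr_ge0 // sqr_ge0.
by rewrite ler_wpM2l // sigma_le.
Qed.

Lemma uniformly_ext K T T' : (forall N i f, T N i f = T' N i f) ->
  uniformly K T -> uniformly K T'.
Proof.
move=> e [C C0 h]; exists C => // N N0; have [d hd] := h N N0; exists d => i.
by apply: eq_bd (hd i) => f; exact: e.
Qed.

Lemma bounded_comp T T' : bounded T -> bounded T' -> bounded (fun N i f => T N i (T' N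
  i f)).
Proof.
move=> [C C0 h] [C' C'0 h']; exists (C * C'); first exact: mulr_ge0.
move=> N N0; have [d hd] := h N N0; have [d' hd'] := h' N N0; exists (d + d')%N => i.
exact: op_bounded_comp.
Qed.

Lemma small_comp T T' : small T -> bounded T' -> small (fun N i f => T N i (T' N i f)).
Proof.
move=> [C C0 h] [C' C'0 h']; exists (C * C'); first exact: mulr_ge0.
move=> N N0; have [d hd] := h N N0; have [d' hd'] := h' N N0; exists (d + d')%N => i.
by rewrite mulrAC; apply: op_bounded_comp => //; rewrite mulr_ge0 // sqr_ge0.
Qed.

Lemma comp_small T T' : bounded T -> small T' -> small (fun N i f => T N i (T' N i f)).
Proof.
move=> [C C0 h] [C' C'0 h']; exists (C * C'); first exact: mulr_ge0.
move=> N N0; have [d hd] := h N N0; have [d' hd'] := h' N N0; exists (d + d')%N => i.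
by rewrite -mulrA; exact: op_bounded_comp.
Qed.

Lemma uniformly_add (K : nat -> R -> R) T T' :
  (forall N C, 0 <= C -> 0 <= K N C) ->
  (forall N C C', K N (2 * C + 2 * C') = 2 * K N C + 2 * K N C') ->
  uniformly K T -> uniformly K T' -> uniformly K (fun N i f => T N i f + T' N i f).
Proof.
move=> K0 KD [C C0 h] [C' C'0 h']; exists (2 * C + 2 * C').
  by rewrite addr_ge0 // mulr_ge0.
move=> N N0; have [d hd] := h N N0; have [d' hd'] := h' N N0; exists (d + d')%N => i.
by rewrite KD; apply: op_bounded_add; [apply: op_bounded_le (hd i)|apply: op_bounded_le
  (hd' i)];
  rewrite ?leq_addr ?leq_addl ?K0.
Qed.

Lemma bounded_add T T' : bounded T -> bounded T' -> bounded (fun N i f => T N i f + T'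
  N i f).
Proof. exact: uniformly_add. Qed.

Lemma small_add T T' : small T -> small T' -> small (fun N i f => T N i f + T' N i f).
Proof.
apply: uniformly_add => [N C C0|N C C']; last by ring.
by rewrite mulr_ge0 // sqr_ge0.
Qed.

Lemma small_scale T (r : R) : small T -> small (fun N i f => r *: T N i f).
Proof.
move=> [C C0 h]; exists (r ^+ 2 * C); first by rewrite mulr_ge0 // sqr_ge0.
move=> N N0; have [d hd] := h N N0; exists d => i; rewrite -mulrA.
exact: op_bounded_scale.
Qed.

Lemma bounded_scalar (r : R) : bounded (fun N i f => r *: f).
Proof.
exists (r ^+ 2 * 1); first by rewrite mulr1 sqr_ge0.
by move=> N N0; exists 0%N => i; apply: op_bounded_scale; exact: op_bounded_id.
Qed.

Lemma bounded_total_poisson : bounded (fun N i f => total_poisson N f).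
Proof.
exists ((2 * (1 + a)) ^+ 2); first exact: sqr_ge0.
move=> N N0; exists 1%N => _; exact: (op_bounded_total_poisson (s0 := sigma N)) (aN N0).
Qed.

Lemma small_bounded_sub T T' : bounded T' -> small (fun N i f => T N i f - T' N i f) ->
  bounded T.
Proof.
move=> bT' /small_bounded sT; apply: uniformly_ext (bounded_add sT bT') => N i f.
by rewrite subrK.
Qed.

Lemma small_column_adj_op : small (fun N i f => column_adj N i (column_op N i f) - f).
Proof.
exists (8 + 2 * a); first by have := a_pos; lra.
by move=> N N0; exists 1%N => i; apply: op_bounded_column_adj_op (aN N0) _.
Qed.

Lemma small_gap (G : forall N, F N -> F N) (kappa : R) :
  small (fun N i f => G N f - kappa *: total_poisson N f) ->
  small (fun N i f => column_adj N i (G N (column_op N i f)) - (kappa * (1 + a)) *: f).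
Proof.
move=> [C C0 h]; exists (gap_bound a kappa C).
  have B0 := sqr_ge0 (2 * (1 + a)); have aB := mulr_ge0 a_pos B0.
  rewrite /gap_bound addr_ge0 // mulr_ge0 //; first exact: mulr_ge0.
  by rewrite mulr_ge0 ?sqr_ge0 //; lra.
move=> N N0; have [d hd] := h N N0; exists d.+2 => i.
by apply: (op_bounded_gap _ (aN N0)) (hd i).
Qed.

Lemma small_sandwich T : small T ->
  small (fun N (_ : 'I_N) f => \sum_i column_op N i (T N i (column_adj N i f))).
Proof.
move=> [C C0 h]; exists ((2 * (1 + a)) ^+ 2 * C); first by rewrite mulr_ge0 // sqr_ge0.
move=> N N0; have [d hd] := h N N0; exists d.+1 => _.
rewrite -mulrA; apply: (op_bounded_sandwich _ (aN N0)) => //.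
by rewrite mulr_ge0 // sqr_ge0.
Qed.

Section Words.
Variables (T : eqType) (k : nat) (lab : nat -> T).
Local Notation csum N := (@colored_sum T _ (F N) (letter_poisson N)).
Implicit Types (p q : nat) (t : T).

Hypothesis lab_nc : forall i j l m, (i < j)%N -> (j < l)%N -> (l < m)%N -> (m < k)%N ->
  lab i = lab l -> lab j = lab m -> lab i = lab j.
(* In a gap between consecutive letters of a class, the classes covered by it
   reduce to at most one, which therefore spans the gap. *)
Hypothesis lab_gap : forall p q, (p.+1 < q)%N -> (q < k)%N -> lab p = lab q ->
  (forall j, (p < j < q)%N -> lab j != lab p) -> lab p.+1 = lab q.-1.

Definition factor p q := [seq lab j | j <- iota p (q - p)].
Definition no_color N : T -> option 'I_N := fun=> None.

(** The positions from p to q - 1 form a union of whole classes. *)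
Definition saturated p q := forall i j, (p <= i < q)%N -> (j < k)%N ->
  lab i = lab j -> (p <= j < q)%N.
(** Classes are counted at their first letters, which makes the counts additive over adjacent
    factors. *)
Definition first_occ j := all (fun i => lab i != lab j) (iota 0 j).

Lemma first_occP j : reflect (forall i, (i < j)%N -> lab i != lab j) (first_occ j).
Proof.
by apply: (iffP allP) => h i; [move=> ij; apply: h; rewrite mem_iota|rewrite mem_iota;
  exact: h].
Qed.

Definition nfirst p q := count first_occ (iota p (q - p)).

Lemma mem_factor p q t : reflect (exists2 j, (p <= j < q)%N & lab j = t) (t \in factor p q).
Proof.
apply: (iffP mapP) => -[j jpq e]; exists j => //.
  by move: jpq; rewrite mem_iota; lia.
by rewrite mem_iota; lia.
Qed.

Lemma factor_cat p q r : (p <= q)%N -> (q <= r)%N -> factor p r = factor p q ++ factor q r.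
Proof.
move=> pq qr; rewrite /factor -map_cat; congr map.
by rewrite (_ : (r - p = (q - p) + (r - q))%N) ?iotaD ?subnKC //; lia.
Qed.

Lemma factor_cons p q : (p < q)%N -> factor p q = lab p :: factor p.+1 q.
Proof. by move=> pq; rewrite /factor -[(q - p)%N]prednK ?subn_gt0 //= subnS. Qed.

Lemma nfirst_cat p q r : (p <= q)%N -> (q <= r)%N -> nfirst p r = (nfirst p q + nfirst
  q r)%N.
Proof.
move=> pq qr; rewrite /nfirst -count_cat; congr count.
by rewrite (_ : (r - p = (q - p) + (r - q))%N) ?iotaD ?subnKC //; lia.
Qed.

Lemma nfirst1 p : nfirst p p.+1 = first_occ p.
Proof. by rewrite /nfirst subSnn /= addn0. Qed.

(** A class with first letter p and last letter [q.-1], together with everything nested in it. *)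
Definition block p q :=
  [/\ (p < q)%N, (q <= k)%N, lab p = lab q.-1 & saturated p q].

Lemma block_first p q : block p q -> first_occ p.
Proof.
move=> [pq qk _ sat]; apply/first_occP => i ip; apply/eqP => e.
have ik : (i < k)%N by lia.
have pp : (p <= p < q)%N by rewrite leqnn.
by have := sat p i pp ik (esym e); lia.
Qed.

(** The exponent is the number of classes nested in that of p, at any depth. *)
Definition block_small p q := small (fun N (_ : 'I_N) f =>
  csum N (no_color N) (factor p q) f - (1 + a) ^+ nfirst p.+1 q *: total_poisson N f).

Lemma next_occ p q : (p < q.-1)%N -> lab p = lab q.-1 -> exists r,
  [/\ (p < r < q)%N, lab r = lab p & forall j, (p < j < r)%N -> lab j != lab p].
Proof.
move=> pq e; have ex : exists r, (p < r)%N && (lab r == lab p).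
  by exists q.-1; rewrite pq e eqxx.
exists (ex_minn ex); case: ex_minnP => r /andP[pr /eqP er] rmin; split=> //.
  by have := rmin q.-1; rewrite pq e eqxx => /(_ isT); lia.
move=> j /andP[pj jr]; apply/negP => ej; have := rmin j; rewrite pj ej => /(_ isT).
by lia.
Qed.

Section Block.
Variables (p q : nat).
Hypothesis pq_block : block p q.
Hypothesis IH : forall p' q', (p < p')%N -> (q' < q)%N -> block p' q' -> block_small p' q'.
Local Notation t := (lab p).

Let pq : (p < q)%N. Proof. by case: pq_block. Qed.
Let qk : (q <= k)%N. Proof. by case: pq_block. Qed.
Let tq : lab p = lab q.-1. Proof. by case: pq_block. Qed.

Definition colored N (i : 'I_N) : T -> option 'I_N := recolor (no_color N) t i.

Lemma coloredE N (i : 'I_N) r : lab r = t -> colored i (lab r) = Some i.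
Proof. by move=> ->; rewrite /colored /recolor eqxx. Qed.

(* Once the class of p is coloured by i, the word from any of its letters on
   acts as c_i E c_i^* with E close to a scalar. *)
Lemma block_tail r : (p <= r < q)%N -> lab r = t -> exists2 E : family,
  forall N i f, csum N (colored i) (factor r q) f = column_op N i (E N i (column_adj N
    i f)) &
  small (fun N i f => E N i f - (1 + a) ^+ nfirst r.+1 q *: f).
Proof.
have [n] := ubnP (q - r); elim: n r => // n IHn r rn /andP[pr rq] er.
have rqk : (r < k)%N by apply: leq_trans qk.
have [rlast|rlast] := eqVneq r q.-1.
  have qE : q = r.+1 by rewrite rlast prednK // (leq_ltn_trans _ pq).
  exists (fun N i f => f) => [N i f|].
    by rewrite qE factor_cons // (colored_sum_cons _ _ _ (coloredE i er)) /factor subnn.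
  exists 0 => // N N0; exists 0%N => i L f.
  rewrite qE /nfirst subnn expr0 scale1r subrr mul0r -(scale0r (0 : F N)).
  by rewrite sqnormZ expr0n !mul0r.
have rq1 : (r < q.-1)%N by rewrite ltn_neqAle rlast /=; lia.
have [r' [/andP[rr' r'q] er' gap]] := @next_occ r q rq1 (etrans er tq).
have [||E' E'E sE'] := IHn r' _ _ (etrans er' er); [lia|lia|].
have not_first : first_occ r' = false.
  by apply/negP => /first_occP/(_ r rr'); rewrite er' eqxx.
(* Adjacent letters of the class meet as c_i^* c_i, which is close to 1; otherwise a nested word
   stands between them. *)
have [re|re] := eqVneq r' r.+1.
  exists (fun N i f => column_adj N i (column_op N i (E' N i f))) => [N i f|].
    by rewrite factor_cons // (colored_sum_cons _ _ _ (coloredE i er)) -re E'E.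
  have -> : nfirst r.+1 q = nfirst r'.+1 q.
    by rewrite -re (@nfirst_cat r' r'.+1 q) // nfirst1 not_first.
  have bE' := small_bounded_sub (bounded_scalar _) sE'.
  apply: uniformly_ext (small_add (small_comp small_column_adj_op bE') sE') => N i f.
  by rewrite subrKA.
have {re}rr1 : (r.+1 < r')%N by rewrite ltn_neqAle eq_sym re.
(* [lab_gap] gives the gap equal end labels, and noncrossingness confines its labels to it. *)
have gap_block : block r.+1 r'.
  split=> //; first exact: leq_trans (ltnW r'q) qk.
    by apply: lab_gap => //; exact: leq_trans r'q qk.
  move=> i j /andP[ri ir'] jk eij.
  have hi : lab i != lab r by apply: gap; rewrite ri ir'.
  have jr : j != r by apply: contraNneq hi => jr; rewrite eij jr.
  have jr' : j != r' by apply: contraNneq hi => jr'; rewrite eij jr' er'.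
  have [jlt|jge] := ltnP j r.
    move/eqP: hi; case; rewrite eij; apply: (@lab_nc j r i r') => //.
    exact: leq_trans r'q qk.
  have [r'j|jr''] := ltnP r' j; last by lia.
  by move/eqP: hi; case; apply/esym; apply: (@lab_nc r i r' j).
have tgap : t \notin factor r.+1 r'.
  apply/negP => /mem_factor[j /gap /eqP + e]; by rewrite e er.
have [||] := IH _ _ gap_block; [lia|lia|move=> C C0 hC].
pose G N := csum N (no_color N) (factor r.+1 r').
pose kappa := (1 + a) ^+ nfirst r.+2 r'.
have sG : small (fun N (_ : 'I_N) f => G N f - kappa *: total_poisson N f) by exists C.
have sG' := small_gap sG.
exists (fun N i f => column_adj N i (G N (column_op N i (E' N i f)))) => [N i f|].
  rewrite factor_cons // (@factor_cat r.+1 r') //; last exact: ltnW.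
  rewrite (colored_sum_cons _ _ _ (coloredE i er)) colored_sum_cat.
    rewrite E'E; congr (column_op N i (column_adj N i _)); apply: eq_colored_sum => u ug.
    by rewrite /colored /recolor; case: eqP => // ut; rewrite -ut ug in tgap.
  move=> u ug; rewrite /colored /recolor; case: eqP => //= ut /mem_factor[j jr' ju].
  case/mem_factor: ug => j' j'r j'u; case: gap_block => _ _ _ sat.
  have jk : (j < k)%N by lia.
  by have := sat j' j j'r jk (etrans j'u (esym ju)); lia.
(* The extra unit is the class that spans the gap, first met at [r.+1]; it accounts for the factor 1
   + a of [small_gap]. *)
have -> : nfirst r.+1 q = (nfirst r.+2 r' + nfirst r'.+1 q).+1.
  rewrite (@nfirst_cat r.+1 r'.+1 q) ?(@nfirst_cat r.+1 r' r'.+1) ?nfirst1 ?not_first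
    //; try lia.
  rewrite (@nfirst_cat r.+1 r.+2 r') ?nfirst1 ?(block_first gap_block) //; lia.
have bE' := small_bounded_sub (bounded_scalar _) sE'.
apply: uniformly_ext (small_add (small_comp sG' bE') (small_scale (kappa * (1 + a))
  sE')) => N i f.
rewrite scalerBr scalerA subrKA; congr (_ - _ *: _).
by rewrite /kappa -exprSr -exprD addSn.
Qed.

Lemma block_small_step : block_small p q.
Proof.
have [||E EE sE] := @block_tail p; [lia|by []|].
apply: uniformly_ext (small_sandwich sE) => N _ f.
rewrite factor_cons //= scaler_sumr -sumrB; apply: eq_bigr => i _.
have := EE N i f; rewrite factor_cons //= /colored /recolor eqxx => ->.
by rewrite linearB linearZ.
Qed.

End Block.

Lemma block_smallP p q : block p q -> block_small p q.
Proof.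
have [n] := ubnP (q - p); elim: n p q => // n IHn p q pqn pqb.
have [pq _ _ _] := pqb; apply: block_small_step => // p' q' pp' q'q b.
by apply: IHn => //; have [] := b; lia.
Qed.

Variable outer : T -> bool.
Hypothesis outerP : forall t, reflect
  (forall i j l, (i < j)%N -> (j < l)%N -> (l < k)%N -> lab i = lab l -> lab j = t ->
     lab i = t) (outer t).

Definition nouter p q := count (fun j => first_occ j && outer (lab j)) (iota p (q - p)).
Definition ninner p q := count (fun j => first_occ j && ~~ outer (lab j)) (iota p (q - p)).

Lemma ninner_cat p q r : (p <= q)%N -> (q <= r)%N -> ninner p r = (ninner p q + ninner
  q r)%N.
Proof.
move=> pq qr; rewrite /ninner -count_cat; congr count.
by rewrite (_ : (r - p = (q - p) + (r - q))%N) ?iotaD ?subnKC //; lia.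
Qed.

Lemma nouter_cat p q r : (p <= q)%N -> (q <= r)%N -> nouter p r = (nouter p q + nouter
  q r)%N.
Proof.
move=> pq qr; rewrite /nouter -count_cat; congr count.
by rewrite (_ : (r - p = (q - p) + (r - q))%N) ?iotaD ?subnKC //; lia.
Qed.

(** When no class straddles p, the class of p is outer; all other classes of the block lie between
    its first and last letters and are inner. *)
Lemma block_counts p q : block p q -> saturated p k ->
  nouter p q = 1%N /\ ninner p q = nfirst p.+1 q.
Proof.
move=> pqb satk; have [pq qk e sat] := pqb; have fp := block_first pqb.
have op : outer (lab p).
  apply/outerP => i j l ij jl lk eil ej.
  have jp : (p <= j < q)%N by apply: (sat p j) => //; lia.
  have /andP[pi _] : (p <= i < k)%N by apply: (satk l i) => //; lia.
  have [<- //|pi'] := eqVneq p i; apply/esym/(@lab_nc p i j l) => //.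
  by rewrite ltn_neqAle pi'.
have inn r : (p < r < q)%N -> first_occ r -> ~~ outer (lab r).
  move=> /andP[pr rq] /first_occP fr; apply/negP => /outerP h.
  have /eqP := fr p pr; apply; have [rq1|rq1] := eqVneq r q.-1; first by rewrite rq1.
  by apply: (h p r q.-1) => //; lia.
have e1 : nouter p.+1 q = 0%N.
  apply/eqP; rewrite -leqn0 leqNgt -has_count; apply/hasPn => r; rewrite mem_iota => hr.
  have hr' : (p < r < q)%N by lia.
  by case fr : (first_occ r) => //=; rewrite (negPf (inn r hr' fr)).
have e2 : ninner p.+1 q = nfirst p.+1 q.
  apply: eq_in_count => r; rewrite mem_iota => hr.
  by case fr : (first_occ r) => //=; rewrite inn //; lia.
rewrite (@nouter_cat p p.+1 q) // (@ninner_cat p p.+1 q) // e1 e2 addn0.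
by rewrite /nouter /ninner subSnn /= fp op.
Qed.

(** The block ends at the last occurrence of [lab p]; a class leaving it would cross the class of
    p. *)
Lemma first_block p : (p < k)%N -> saturated p k -> exists2 q,
  block p q & saturated q k.
Proof.
move=> pk satk; have ex : exists r, (r < k)%N && (lab r == lab p) by exists p; rewrite
  pk eqxx.
have bnd r : (r < k)%N && (lab r == lab p) -> (r <= k)%N by case/andP => /ltnW.
pose m := ex_maxn ex bnd; have [mk /eqP me mmax] : [/\ (m < k)%N, lab m == lab p &
    forall j, (j < k)%N && (lab j == lab p) -> (j <= m)%N].
  by rewrite /m; case: ex_maxnP => r /andP[].
have pm : (p <= m)%N by apply: mmax; rewrite pk eqxx.
have sat : saturated p m.+1.
  move=> i j im jk eij; have /andP[pj _] : (p <= j < k)%N by apply: (satk i j) => //; lia.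
  rewrite pj ltnS leqNgt; apply/negP => mj.
  have nj : lab j != lab p by apply/negP => ej; have := mmax j; rewrite jk ej; lia.
  have ip : p != i by apply: contraNneq nj => pi; rewrite pi eij.
  have im' : i != m by apply: contraNneq nj => im'; rewrite -eij im' me.
  move/eqP: nj; apply; rewrite -eij; apply/esym/(@lab_nc p i m j) => //; lia.
exists m.+1; first by split.
move=> i j im jk eij; rewrite jk andbT ltnNge; apply/negP => jm.
have jp : (p <= j < k)%N by apply: (satk i j) => //; lia.
by have := sat j i; rewrite eij => /(_ _ _ erefl); lia.
Qed.

(** A suffix made of whole classes is a concatenation of blocks, one for each outer class; a block
    yields Y and one factor 1 + a per nested class. *)
Lemma saturated_small p : (p <= k)%N -> saturated p k -> small (fun N (_ : 'I_N) f =>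
  csum N (no_color N) (factor p k) f - (1 + a) ^+ ninner p k *: iter (nouter p k)
    (total_poisson N) f).
Proof.
have [n] := ubnP (k - p); elim: n p => // n IHn p pn pk satp.
have [->|pk'] := eqVneq p k.
  exists 0 => // N N0; exists 0%N => i L f.
  rewrite /factor /ninner /nouter subnn /= expr0 scale1r subrr mul0r -(scale0r (0 : F N)).
  by rewrite sqnormZ expr0n !mul0r.
have {}pk' : (p < k)%N by rewrite ltn_neqAle pk'.
have [q pqb satq] := first_block pk' satp; have [pq qk e sat] := pqb.
have [nout ninn] := block_counts pqb satp.
have [|C C0 hC] := IHn q _ qk satq; first by lia.
pose G N := csum N (no_color N) (factor p q).
pose G' N := csum N (no_color N) (factor q k).
pose kap := (1 + a) ^+ nfirst p.+1 q; pose kap' := (1 + a) ^+ ninner q k.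
have sG : small (fun N (_ : 'I_N) f => G N f - kap *: total_poisson N f) :=
  block_smallP pqb.
have sG' : small (fun N (_ : 'I_N) f => G' N f - kap' *: iter (nouter q k)
  (total_poisson N) f).
  by exists C.
have bY : bounded (fun N (_ : 'I_N) f => kap' *: iter (nouter q k) (total_poisson N) f).
  apply: (bounded_comp (bounded_scalar kap')); elim: (nouter q k) => [|m IHm] /=.
    by apply: uniformly_ext (bounded_scalar 1) => N i f; rewrite scale1r.
  exact: bounded_comp bounded_total_poisson IHm.
have bG' := small_bounded_sub bY sG'.
have bkY := bounded_comp (bounded_scalar kap) bounded_total_poisson.
apply: uniformly_ext (small_add (small_comp sG bG') (comp_small bkY sG')) => N i f.
rewrite (_ : total_poisson N (_ - _) = total_poisson N (G' N f) - kap' *: total_poisson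
  N (iter (nouter q k) (total_poisson N) f)).
  rewrite [X in _ + X]scalerBr addrA subrK.
  2: by rewrite linearB linearZ.
have pq' := ltnW pq; rewrite (@factor_cat p q k) // colored_sum_cat; last first.
  move=> u /mem_factor[j jp ju] /mem_factor[j' j'p j'u].
  have jk : (j' < k)%N by lia.
  by have := sat j j' jp jk (etrans ju (esym j'u)); lia.
rewrite (@ninner_cat p q k pq' qk) (@nouter_cat p q k pq' qk) nout ninn exprD scalerA.
by rewrite add1n iterS.
Qed.

End Words.

End Asymptotics.

(** * Labels of a noncrossing partition *)

Section Labels.
Variables (k : nat) (P : {set {set 'I_k}}).
Hypothesis pP : finset.partition P [set: 'I_k]%SET.
Local Notation blk := (finset.pblock P).

(** The word calculus uses natural numbers as positions; from k on the value is [set0], which is not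
    a class. *)
Definition label (n : nat) : {set 'I_k} := if insub n is Some j then blk j else finset.set0.

Lemma label_ord (j : 'I_k) : label j = blk j.
Proof. by rewrite /label valK. Qed.

Lemma map_label : [seq label j | j <- iota 0 k] = [seq blk j | j <- enum 'I_k].
Proof.
by rewrite -val_enum_ord -map_comp; apply: eq_map => j; rewrite /= label_ord.
Qed.

Lemma blk_mem j : blk j \in P.
Proof. by rewrite finset.pblock_mem // (finset.cover_partition pP) inE. Qed.

Lemma mem_blk j : j \in blk j.
Proof. by rewrite finset.mem_pblock (finset.cover_partition pP) inE. Qed.

Lemma blkE B j : B \in P -> (j \in B) = (blk j == B).
Proof.
move=> BP; apply/idP/eqP => [jB|<-]; last exact: mem_blk.
exact: finset.def_pblock (finset.partition_trivIset pP) BP jB.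
Qed.

Lemma labelE B n (nk : (n < k)%N) : B \in P -> (Ordinal nk \in B) = (label n == B).
Proof. by move=> BP; rewrite blkE // -label_ord. Qed.

Lemma label_mem n : (n < k)%N -> label n \in P.
Proof. by move=> nk; rewrite -[n]/(val (Ordinal nk)) label_ord blk_mem. Qed.

Lemma label_nc : noncrossing P -> forall i j l m, (i < j)%N -> (j < l)%N -> (l < m)%N ->
  (m < k)%N -> label i = label l -> label j = label m -> label i = label j.
Proof.
move=> /andP[_ ncP] i j l m ij jl lm mk eil ejm.
have lk := ltn_trans lm mk; have jk := ltn_trans jl lk; have ik := ltn_trans ij jk.
have cP : crossfree P by [].
move/crossfreeP: cP => /(_ _ _ (Ordinal ik) (Ordinal jk) (Ordinal lk) (Ordinal mk)).
apply; rewrite ?label_mem ?labelE ?label_mem ?eqxx //.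
  by rewrite eil.
by rewrite ejm.
Qed.

Lemma class_gt_label B C : B \in P -> C \in P -> reflect
  (B != C /\ exists i j l, [/\ (i < l)%N, (l < j)%N & (j < k)%N] /\
    [/\ label i = B, label j = B & label l = C]) (class_gt B C).
Proof.
move=> BP CP; apply: (iffP (class_gtP B C)) => -[BC [i [j [l]]]].
  move=> [iB jB lC il lj]; split=> //; exists i, j, l.
  by split; split=> //; apply/eqP; rewrite label_ord -blkE.
move=> [[il lj jk] [iB jB lC]]; split=> //.
have lk := ltn_trans lj jk; have ik := ltn_trans il lk.
by exists (Ordinal ik), (Ordinal jk), (Ordinal lk); split; rewrite // labelE //; apply/eqP.
Qed.

(** Sets that are not classes count as outer, in accordance with the vacuous truth of the
    characterization below for labels that never occur. *)
Definition outer_label t := (t \in P) ==> ~~ inner P t.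

Lemma outer_labelP t : reflect
  (forall i j l, (i < j)%N -> (j < l)%N -> (l < k)%N -> label i = label l -> label j = t ->
     label i = t) (outer_label t).
Proof.
apply: (iffP implyP) => [h i j l ij jl lk eil ej|h tP].
  have jk := ltn_trans jl lk; have ik := ltn_trans ij jk.
  have tP : t \in P by rewrite -ej label_mem.
  apply/eqP/negPn/negP => it; move/negP: (h tP); apply; apply/innerP.
  exists (label i); first exact: label_mem.
  by apply/class_gt_label => //; [exact: label_mem|split=> //; exists i, l, j].
apply/negP => /innerP[W WP /(class_gt_label WP tP)[/eqP Wt]].
move=> [i [j [l [[il lj jk] [iW jW lt]]]]]; apply: Wt; rewrite -iW.
by apply: (h i l j) => //; rewrite iW jW.
Qed.

Hypothesis ncP : noncrossing P.
Hypothesis sepP : separated_inner_classes P.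

(** If the classes U and V at the two ends of a gap of W differed, noncrossingness would place U
    entirely before V, with both covered by W. The separation hypothesis would then supply a point
    of W strictly inside the gap, whose ends are consecutive in W. *)
Lemma label_gap p q : (p.+1 < q)%N -> (q < k)%N -> label p = label q ->
  (forall j, (p < j < q)%N -> label j != label p) -> label p.+1 = label q.-1.
Proof.
move=> pq qk e gap; set W := label p; set U := label p.+1; set V := label q.-1.
have pk : (p.+1 < k)%N by lia.
have qk' : (q.-1 < k)%N by lia.
have nc := label_nc ncP.
have Wp : W \in P by rewrite label_mem //; lia.
have UP : U \in P by rewrite label_mem //; lia.
have VP : V \in P by rewrite label_mem //; lia.
apply/eqP/negPn/negP => UV.
have inW j : (p < j < q)%N -> class_gt W (label j).
  move=> /andP[pj jq]; have jk : (j < k)%N by lia.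
  apply/(class_gt_label Wp (label_mem jk)); split; first by rewrite eq_sym gap ?pj.
  by exists p, q, j; split; split => //; rewrite -e.
have gap_block i j : (p < i < q)%N -> (j < k)%N -> label i = label j -> (p < j < q)%N.
  move=> hi jk eij; have hn := gap _ hi.
  have jp : j != p by apply: contraNneq hn => <-; rewrite eij.
  have jq : j != q by apply: contraNneq hn => jq; rewrite eij jq e.
  have [jp'|pj] := ltnP j p.
    by move/eqP: hn; case; rewrite eij; apply: (nc j p i q) => //; lia.
  have [qj|jq'] := ltnP q j; last by lia.
  by move/eqP: hn; case; apply/esym/(nc p i q j) => //; lia.
have UV_lt u v : (u < k)%N -> (v < k)%N -> label u = U -> label v = V -> (u < v)%N.
  move=> uk vk uU vV.
  have hu : (p < u < q)%N by apply: (gap_block p.+1 u) => //; lia.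
  have hv : (p < v < q)%N by apply: (gap_block q.-1 v) => //; lia.
  rewrite ltnNge; apply/negP => vu; move/eqP: (UV); apply.
  have uv : v != u by apply: contra_neq (UV) => vu'; rewrite -uU -vV vu'.
  have pv : p.+1 != v by apply: contraNneq UV => pv; rewrite -vV -pv.
  have uq : u != q.-1 by apply: contraNneq UV => uq; rewrite -uU uq.
  rewrite -vV; apply: (nc p.+1 v u q.-1) => //; try lia; by rewrite ?uU ?vV.
(* A class between W and [label r] would cross W unless confined to the gap. The premise rules out
   the confined case; it holds at the two ends of the gap because such a class would cross
   [label r]. *)
have covered r : (p < r < q)%N ->
    (forall i j, (p < i)%N -> (i < j)%N -> (j < q)%N -> (exists l, [/\ (i < l)%N, (l <
      j)%N &
       label l = label r]) -> label i = label j -> label i = label r) ->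
    covered_class P (label r) W.
  move=> hr hout; have rk : (r < k)%N by lia.
  rewrite /covered_class inW //=; apply/negP => /existsP[Z /and3P[ZP WZ ZR]].
  move/(class_gt_label Wp ZP): WZ => [WZ [w1 [w2 [z [[w1z zw2 w2k] [w1W w2W zZ]]]]]].
  move/(class_gt_label ZP (label_mem rk)): ZR => [ZR [z1 [z2 [l [[z1l lz2 z2k] [z1Z z2Z
    lr]]]]]].
  have hl : (p < l < q)%N by apply: (gap_block r l) => //; lia.
  have WZ' : W <> Z by apply/eqP.
  have zp y : label y = Z -> y != p by move=> yZ; apply: contraNneq WZ => yp; rewrite
    -yZ yp.
  have zq y : label y = Z -> y != q.
    by move=> yZ; apply: contraNneq WZ => yq; rewrite -yZ yq -e.
  have [z1p|pz1] := ltnP z1 p.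
    have [zlp|plz] := ltnP z p.
      by apply: WZ'; rewrite -w1W -zZ; apply: (nc w1 z p z2) => //; rewrite ?w1W ?zZ
        ?z2Z //; lia.
    have pz : (p < z)%N by rewrite ltn_neqAle eq_sym zp.
    apply: WZ'; rewrite -[in RHS]z1Z; apply/esym.
    by apply: (nc z1 p z w2) => //; rewrite ?z1Z ?w2W //; lia.
  have {}pz1 : (p < z1)%N by rewrite ltn_neqAle eq_sym zp.
  have [z2q|qz2] := ltnP z2 q.
    move/eqP: ZR; apply; rewrite -z1Z; apply: (hout z1 z2) => //; try lia.
      by exists l.
    by rewrite z1Z z2Z.
  have {}qz2 : (q < z2)%N by rewrite ltn_neqAle eq_sym zq.
  by apply: WZ'; rewrite -z1Z; apply: (nc p z1 q z2) => //; rewrite ?z1Z ?z2Z //; lia.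
have cU : covered_class P U W.
  apply: covered; first by lia.
  move=> i j pi ij jq [l [il lj lr]] eij.
  have [->//|pi'] := eqVneq i p.+1.
  by apply/esym; apply: (nc p.+1 i l j) => //; lia.
have cV : covered_class P V W.
  apply: covered; first by lia.
  move=> i j pi ij jq [l [il lj lr]] eij.
  have [jq1|jq'] := eqVneq j q.-1; first by rewrite eij jq1.
  by rewrite -lr; apply: (nc i l j q.-1) => //; lia.
have iU : inner P U by apply/innerP; exists W => //; apply: inW; lia.
have iV : inner P V by apply/innerP; exists W => //; apply: inW; lia.
have uvlt (u v : 'I_k) : u \in U -> v \in V -> (u < v)%N.
  by move=> uU vV; apply: UV_lt; rewrite ?ltn_ord // label_ord; apply/eqP; rewrite -blkE.
have [w wW hw] := sepP UP VP Wp iU iV cU cV uvlt.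
have := hw (Ordinal pk) (Ordinal qk'); rewrite !labelE ?eqxx //= => /(_ isT isT)
  /andP[pw wq].
have := gap w; rewrite label_ord; move: wW; rewrite blkE // => /eqP ->.
have hw' : (p < w < q)%N by rewrite (ltnW pw) (leq_trans wq (leq_pred q)).
by rewrite hw' eqxx => /(_ isT).
Qed.

End Labels.

Lemma count_first_occ (T : finType) (lab : nat -> T) (A : pred T) n :
  count (fun j => first_occ lab j && A (lab j)) (iota 0 n) =
  #|[pred t | A t && (t \in [seq lab j | j <- iota 0 n])]|.
Proof.
elim: n => [|n IH]; first by rewrite eq_card0 // => t; rewrite !inE andbF.
rewrite -addn1 iotaD add0n count_cat IH /= addn0; set s := map _ (iota 0 n).
have sE : map lab (iota 0 n ++ [:: n]) = s ++ [:: lab n] by rewrite map_cat.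
rewrite sE; have fo : first_occ lab n = (lab n \notin s).
  apply/idP/idP => [/first_occP h|h].
    apply/negP => hn; have [i0] := mapP hn.
    by rewrite mem_iota /= => /h /eqP + e; rewrite e.
  apply/first_occP => i i_n; apply: contraNneq h => <-.
  by apply/mapP; exists i; rewrite // mem_iota.
rewrite fo; case hn : (lab n \in s) => /=.
  rewrite addn0; apply: eq_card => t; rewrite !inE mem_cat inE.
  by case: eqVneq => [->|]; rewrite ?hn ?orbF.
case An : (A (lab n)); last first.
  rewrite addn0; apply: eq_card => t; rewrite !inE mem_cat inE.
  by case: eqVneq => [->|]; rewrite ?An ?orbF.
rewrite [in RHS](cardD1 (lab n)) !inE mem_cat inE An eqxx orbT /= addnC; congr (_ + _)%N.
apply: eq_card => t; rewrite !inE mem_cat inE.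
by case: eqVneq => [->|]; rewrite ?hn ?andbF ?orbF.
Qed.

(** * Reversed words *)

Section Reversal.
Variables (T : eqType) (k : nat) (lab : nat -> T).

(** The adjoint of a product sum belongs to the reversed word, so the conditions on labels have to
    survive reversal. *)
Definition rev_label j := lab (k - j.+1).

Lemma rev_label_nc :
  (forall i j l m, (i < j)%N -> (j < l)%N -> (l < m)%N -> (m < k)%N ->
    lab i = lab l -> lab j = lab m -> lab i = lab j) ->
  forall i j l m, (i < j)%N -> (j < l)%N -> (l < m)%N -> (m < k)%N ->
    rev_label i = rev_label l -> rev_label j = rev_label m -> rev_label i = rev_label j.
Proof.
move=> nc i j l m ij jl lm mk eil ejm; rewrite eil ejm; apply/esym.
apply: (nc (k - m.+1) (k - l.+1) (k - j.+1) (k - i.+1))%N => //; lia.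
Qed.

Lemma rev_label_gap :
  (forall p q, (p.+1 < q)%N -> (q < k)%N -> lab p = lab q ->
    (forall j, (p < j < q)%N -> lab j != lab p) -> lab p.+1 = lab q.-1) ->
  forall p q, (p.+1 < q)%N -> (q < k)%N -> rev_label p = rev_label q ->
    (forall j, (p < j < q)%N -> rev_label j != rev_label p) ->
    rev_label p.+1 = rev_label q.-1.
Proof.
move=> hgap p q pq qk e gap; rewrite /rev_label in e gap *.
have := hgap (k - q.+1)%N (k - p.+1)%N.
have -> : (k - q.+1).+1 = (k - q.-1.+1)%N by lia.
have -> : (k - p.+1).-1 = (k - p.+2)%N by lia.
move=> h; apply/esym/h; [lia|lia|by []|].
move=> j hj; rewrite -e; have := gap (k - j.+1)%N; rewrite (_ : (k - (k - j.+1).+1)%N =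
  j); last by lia.
by apply; lia.
Qed.

Lemma rev_label_outer t (b : bool) :
  reflect (forall i j l, (i < j)%N -> (j < l)%N -> (l < k)%N -> lab i = lab l ->
    lab j = t -> lab i = t) b ->
  reflect (forall i j l, (i < j)%N -> (j < l)%N -> (l < k)%N ->
    rev_label i = rev_label l -> rev_label j = t -> rev_label i = t) b.
Proof.
move=> hb; apply: (iffP hb) => h i j l ij jl lk e ej.
  by rewrite e; apply: (h (k - l.+1) (k - j.+1) (k - i.+1))%N => //; lia.
have := h (k - l.+1)%N (k - j.+1)%N (k - i.+1)%N; rewrite /rev_label.
have -> : (k - (k - l.+1).+1 = l)%N by lia.
have -> : (k - (k - j.+1).+1 = j)%N by lia.
have -> : (k - (k - i.+1).+1 = i)%N by lia.
by rewrite e => h'; apply: h' => //; lia.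
Qed.

Lemma rev_factor : factor rev_label 0 k = rev (factor lab 0 k).
Proof.
rewrite /factor subn0 -map_rev; apply: (@eq_from_nth _ (lab 0)).
  by rewrite !size_map size_rev !size_iota.
move=> i; rewrite size_map size_iota => ik.
rewrite !(nth_map 0%N) ?size_rev ?size_iota // nth_rev ?size_iota //.
by rewrite !nth_iota ?add0n //; lia.
Qed.

End Reversal.

Section Colorings.
Variables (T : eqType) (I : finType).

(** The index words over which [colored_sum] sums, listed so as to exhibit a polynomial in the
    letters. *)
Fixpoint colorings (c : T -> option I) w : seq (seq I) :=
  if w is t :: w' then
    if c t is Some i then [seq i :: u | u <- colorings c w']
    else [seq i :: u | i <- enum I, u <- colorings (recolor c t i) w']
  else [:: [::]].

Lemma colored_sumE (V : nmodType) (act : I -> V -> V) c w v :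
  (forall i (L : seq (seq I)) F, act i (\sum_(u <- L) F u) = \sum_(u <- L) act i (F u)) ->
  colored_sum act c w v = \sum_(u <- colorings c w) foldr act v u.
Proof.
move=> act_sum; elim: w c => [|t w IH] c /=; first by rewrite big_seq1.
case: (c t) => [i|]; first by rewrite IH act_sum big_map.
rewrite big_allpairs_dep big_enum; apply: eq_bigr => i _.
by rewrite IH act_sum.
Qed.

End Colorings.

(** * Product sums as coloured sums *)

Section ProductSum.
Variables (R : realType) (M : von_neumann_algebra R) (k : nat) (P : {set {set 'I_k}}).
Hypothesis pP : finset.partition P [set: 'I_k]%SET.
Variables (N : nat) (x : 'I_N -> M).
Local Notation blk := (finset.pblock P).
Local Notation coloring := {ffun 'I_k -> 'I_N}.
Implicit Types f : coloring.

Definition class_constant (f : coloring) :=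
  [forall B in P, forall a in B, forall b in B, f a == f b].

Lemma class_constantP f : reflect (forall a b, blk a = blk b -> f a = f b)
  (class_constant f).
Proof.
apply: (iffP forall_inP) => [h a b ab|h B BP].
  have /forall_inP/(_ a (mem_blk pP a))/forall_inP/(_ b) := h _ (blk_mem pP a).
  by rewrite ab (mem_blk pP) => /(_ isT)/eqP.
apply/forall_inP => a aB; apply/forall_inP => b bB; apply/eqP/h.
by apply/eqP; move: aB bB; rewrite !(blkE pP) // => /eqP -> /eqP ->.
Qed.

Definition extends_color (c : {set 'I_k} -> option 'I_N) (f : coloring) :=
  [forall j, if c (blk j) is Some i then f j == i else true].

Lemma extends_colorP c f : reflect (forall j i, c (blk j) = Some i -> f j = i)
  (extends_color c f).
Proof.
apply: (iffP forallP) => h j; last first.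
  by have := h j; case: (c _) => // i h'; apply/eqP/h'.
by move=> i e; have := h j; rewrite e => /eqP.
Qed.

(** Partial colourings make the induction on the word possible. Every uncoloured class is still to
    be met, so at the empty word c leaves exactly one f. *)
Lemma sum_colorings_word c js :
  (forall j, c (blk j) = None -> blk j \in [seq blk j' | j' <- js]) ->
  \sum_(f | class_constant f && extends_color c f) \prod_(j <- js) x (f j) =
  colored_sum (fun i v => x i * v) c [seq blk j | j <- js] 1.
Proof.
elim: js c => [|j js IH] c hc /=.
  have [g hg] : exists g : coloring, forall j, c (blk j) = Some (g j).
    have /fin_all_exists[g hg] : forall j, exists i, c (blk j) = Some i.
      by move=> j; case e : (c (blk j)) => [i|]; [exists i|have := hc j e].
    by exists (finfun g) => j; rewrite ffunE.
  rewrite (big_pred1 g) ?big_nil // => f /=; apply/andP/eqP => [[_ /extends_colorP h]|->].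
    by apply/ffunP => j; exact: h.
  split; first by apply/class_constantP => a b ab; have := hg a; rewrite ab hg => -[].
  by apply/extends_colorP => j i; rewrite hg => -[].
case cj : (c (blk j)) => [i|].
  rewrite -IH => [|j' /[dup] cj' /hc]; last first.
    by rewrite inE => /orP[/eqP e|//]; rewrite e cj in cj'.
  rewrite mulr_sumr; apply: eq_bigr => f /andP[_ /extends_colorP h].
  by rewrite big_cons (h j i cj).
rewrite (partition_big (fun f : coloring => f j) xpredT) //=; apply: eq_bigr => i _.
rewrite -IH => [|j']; last first.
  rewrite /recolor; case: eqVneq => // ne /hc; rewrite inE (negPf ne).
  by [].
rewrite mulr_sumr; apply: eq_big => [f|f /andP[_ /eqP <-]]; last by rewrite big_cons.
apply/andP/andP => [[/andP[cf /extends_colorP h] /eqP fj]|[cf /extends_colorP h]].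
  split=> //; apply/extends_colorP => j' i'; rewrite /recolor.
  case: eqVneq => [e [<-]|_]; last exact: h.
  by rewrite -fj; move/class_constantP: cf; apply.
split; last by apply/eqP/h; rewrite /recolor eqxx.
rewrite cf; apply/extends_colorP => j' i' e; apply: h; rewrite /recolor.
by case: eqVneq => // e'; rewrite -e' e in cj.
Qed.

Lemma sum_class_constant js : (forall j : 'I_k, j \in js) ->
  \sum_(f | class_constant f) \prod_(j <- js) x (f j) =
  colored_sum (fun i v => x i * v) (@no_color _ N) [seq blk j | j <- js] 1.
Proof.
move=> hjs; rewrite -sum_colorings_word => [|j _]; last by rewrite map_f.
apply: eq_bigl => f; rewrite [X in _ && X](_ : _ = true) ?andbT //.
exact/extends_colorP.
Qed.

Lemma product_sumE : product_sum P x =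
  colored_sum (fun i v => x i * v) (@no_color _ N) (factor (label P) 0 k) 1.
Proof.
rewrite /factor subn0 map_label -sum_class_constant; last by move=> j; rewrite mem_enum.
by apply: eq_bigr => f _; rewrite enumT.
Qed.

Lemma star_product_sumE : (forall i, self_adjoint (x i)) -> vn_star (product_sum P x) =
  colored_sum (fun i v => x i * v) (@no_color _ N) (factor (rev_label k (label P)) 0 k) 1.
Proof.
move=> sx; rewrite rev_factor /factor subn0 map_label -map_rev -sum_class_constant;
  last first.
  by move=> j; rewrite mem_rev mem_enum.
rewrite star_sum; apply: eq_bigr => f _.
have -> : \prod_(j < k) x (f j) = \prod_(j <- enum 'I_k) x (f j) by rewrite enumT.
elim: (enum 'I_k) => [|j js IH]; first by rewrite !big_nil star1.
by rewrite rev_cons -cats1 big_cat big_cons starM IH big_seq1 sx.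
Qed.

End ProductSum.

(** * Convergence *)

Section Represents.
Variables (R : realType) (M : von_neumann_algebra R) (I : finType) (x : I -> M) (s : I
  -> R).
Local Notation F := (seq I -> R^o).
Implicit Types (u v : M) (T : F -> F).

(** One noncommutative polynomial, given by coefficients and monomials, yields u on the x_i and T on
    the model. *)
Definition represents u T := exists l : seq (R * seq I),
  u = \sum_(e <- l) (e.1)%:C%C *: \prod_(i <- e.2) x i /\
  forall f, T f = \sum_(e <- l) e.1 *: foldr (letter_poisson s) f e.2.

Lemma represents_add u v T T' : represents u T -> represents v T' ->
  represents (u + v) (fun f => T f + T' f).
Proof.
by move=> [l [-> hT]] [l' [-> hT']]; exists (l ++ l'); split=> [|f];
  rewrite big_cat /= ?hT ?hT'.
Qed.

Lemma represents_scale (r : R) u T : represents u T ->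
  represents (r%:C%C *: u) (fun f => r *: T f).
Proof.
move=> [l [-> hT]]; exists [seq (r * e.1, e.2) | e <- l]; split=> [|f]; rewrite big_map.
  by rewrite scaler_sumr; apply: eq_bigr => e _; rewrite scalerA -rmorphM.
by rewrite hT scaler_sumr; apply: eq_bigr => e _; rewrite scalerA.
Qed.

Lemma foldr_letter_poisson_linear w : linear (fun f : F => foldr (letter_poisson s) f w).
Proof. by move=> c f g; elim: w => //= j w ->; rewrite linearP. Qed.

Lemma represents_comp u v T T' : represents u T -> represents v T' ->
  represents (u * v) (T \o T').
Proof.
move=> [l [-> hT]] [l' [-> hT']].
exists [seq (e.1 * e'.1, e.2 ++ e'.2) | e <- l, e' <- l']; split=> [|f].
  rewrite big_allpairs_dep mulr_suml; apply: eq_bigr => e _.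
  rewrite mulr_sumr; apply: eq_bigr => e' _ /=.
  by rewrite big_cat /= -scalerAl -scalerAr scalerA -rmorphM.
rewrite /= hT big_allpairs_dep; apply: eq_bigr => e _; rewrite hT'.
pose g : {linear F -> F} := HB.pack (fun f : F => foldr (letter_poisson s) f e.2)
  (GRing.isLinear.Build R F F *:%R _ (@foldr_letter_poisson_linear e.2)).
rewrite -[foldr _ _ _]/(g _) linear_sum scaler_sumr; apply: eq_bigr => e' _ /=.
by rewrite -[foldr _ _ _]/(g _) linearZ /= scalerA foldr_cat.
Qed.

Lemma represents1 : represents 1 idfun.
Proof.
exists [:: (1, [::])]; split=> [|f]; rewrite big_seq1 /=; first by rewrite big_nil scale1r.
by rewrite scale1r.
Qed.

Lemma represents_sum : represents (\sum_i x i) (total_poisson s).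
Proof.
exists [seq (1, [:: i]) | i <- enum I]; split=> [|f]; rewrite big_map big_enum;
  by apply: eq_bigr => i _ /=; rewrite ?big_seq1 scale1r.
Qed.

Lemma represents_exp u T n : represents u T -> represents (u ^+ n) (iter n T).
Proof.
move=> uT; elim: n => [|n IH]; first exact: represents1.
by rewrite exprS; exact: (represents_comp uT IH).
Qed.

Lemma represents_colored_sum (L : eqType) (c : L -> option I) w :
  represents (colored_sum (fun i v => x i * v) c w 1) (colored_sum (letter_poisson s) c w).
Proof.
exists [seq (1, w') | w' <- colorings c w]; split=> [|f]; rewrite big_map colored_sumE.
- apply: eq_bigr => w' _ /=; rewrite scale1r.
  by elim: w' => [|i w' IH]; rewrite ?big_nil // big_cons -IH.
- by move=> i l G; rewrite mulr_sumr.
- by apply: eq_bigr => u _ /=; rewrite scale1r.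
by move=> i l G; rewrite linear_sum.
Qed.

Variable phi : M -> R[i].
Hypothesis tr : faithful_normal_tracial_state phi.
Hypothesis x_free : freely_independent phi x.
Hypothesis mx : forall i k, phi (x i ^+ k) = (poisson_moment (s i ^+ 2) k)%:C%C.

Lemma represents_phi u T : represents u T -> phi u = (T (@vacuum R I) [::])%:C%C.
Proof.
move=> [l [-> ->]]; rewrite (phi_sum tr) fct_sum_apply rmorph_sum; apply: eq_bigr => e _.
by rewrite (phiZ tr) (word_transfer tr x_free mx) fctZE rmorphM.
Qed.

(** In place of an adjoint of T, the element [vn_star u] comes with its own representative T' and
    its own bound. *)
Lemma represents_op_norm u T T' d d' K : 0 < K -> represents u T ->
  represents (vn_star u) T' -> op_bounded d T K -> op_bounded d' T' K -> 0 <= op_norm u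
    <= Num.sqrt K.
Proof.
move=> K0 uT uT' bT bT'; apply: (op_norm_bound tr) => // m.
have K0' := ltW K0.
rewrite (represents_phi (represents_exp m (represents_comp uT' uT))) /=.
(* This bounds the square of the moment by (K * K)^m, hence the moment itself by K^m. *)
have := op_bounded_iter_vacuum m (mulr_ge0 K0' K0') (op_bounded_comp K0' bT' bT).
rewrite -expr2 exprAC; set v : R := iter _ _ _ _ => hv; rewrite leNgt; apply/negP => Kv.
have Km0 : 0 <= K ^+ m by rewrite exprn_ge0.
by move: hv; rewrite leNgt ltr_pXn2r ?Kv // nnegrE // (le_trans Km0) // ltW.
Qed.

End Represents.

Section Convergence.
Variables (R : realType) (M : von_neumann_algebra R) (phi : M -> R[i]).
Hypothesis tr : faithful_normal_tracial_state phi.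
Variables (x : forall N : nat, 'I_N -> M) (X : M) (a : R).
Arguments x : clear implicits.
Hypothesis a0 : 0 <= a.
Hypothesis mX : forall n, phi (X ^+ n) = (poisson_moment a n)%:C%C.
Hypothesis hx : forall N : nat, (0 < N)%N -> free_iid_decomposition phi X (x N).
Variables (k : nat) (P : {set {set 'I_k}}).
Hypothesis ncP : noncrossing P.
Hypothesis sepP : separated_inner_classes P.

Let sigma (N : nat) : R := Num.sqrt (a / N%:R).

Let sigmaE N : (0 < N)%N -> N%:R * sigma N ^+ 2 = a.
Proof.
move=> N0; rewrite sqr_sqrtr ?divr_ge0 // mulrC divfK //.
by rewrite pnatr_eq0 -lt0n.
Qed.

Let pP : finset.partition P [set: 'I_k]%SET. Proof. by case/andP: ncP. Qed.

Lemma mem_labels (t : {set 'I_k}) :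
  (t \in [seq label P j | j <- iota 0 k]) = (t \in P).
Proof.
rewrite map_label; apply/idP/idP => [tl|tP].
  by have [j _ ->] := mapP tl; exact: blk_mem.
have /finset.set0Pn[j jt] : t != finset.set0.
  by apply: contraFneq (finset.partition0 pP) => <-.
apply/mapP; exists j; first by rewrite mem_enum.
by apply/esym/eqP; rewrite -blkE.
Qed.

Lemma nouter_label (lab : nat -> {set 'I_k}) :
  [seq lab j | j <- iota 0 k] =i P -> nouter lab (outer_label P) 0 k = num_outer P.
Proof.
move=> labP; rewrite /nouter subn0 count_first_occ; apply: eq_card => t.
by rewrite !inE labP /outer_label; case: (t \in P); rewrite ?andbF ?andbT.
Qed.

Lemma ninner_label (lab : nat -> {set 'I_k}) :
  [seq lab j | j <- iota 0 k] =i P -> ninner lab (outer_label P) 0 k = num_inner P.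
Proof.
move=> labP; rewrite /ninner subn0 (count_first_occ lab (fun t => ~~ outer_label P t)).
apply: eq_card => t; rewrite !inE labP /outer_label.
by case: (t \in P); rewrite ?andbF ?andbT ?negbK.
Qed.

Lemma product_sum_op_norm : exists2 c : R, 0 < c & forall N, (0 < N)%N ->
  0 <= op_norm (product_sum P (x N) - ((1 + a)%:C%C ^+ num_inner P *: X ^+ num_outer P))
    <= Num.sqrt (c / N%:R).
Proof.
have lab1 : [seq label P j | j <- iota 0 k] =i P := mem_labels.
have lab2 : [seq rev_label k (label P) j | j <- iota 0 k] =i P.
  move=> t; have := rev_factor k (label P); rewrite /factor subn0 => ->.
  by rewrite mem_rev lab1.
have nc1 := label_nc pP ncP; have gap1 := label_gap pP ncP sepP.
have out1 := outer_labelP pP.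
have sat (lab : nat -> {set 'I_k}) : saturated k lab 0 k by [].
have [C C0 hC] := saturated_small sigmaE nc1 gap1 out1 (leq0n k) (sat _).
have [C' C'0 hC'] := saturated_small sigmaE (rev_label_nc nc1) (rev_label_gap gap1)
  (fun t => rev_label_outer (out1 t)) (leq0n k) (sat _).
rewrite (nouter_label lab1) (ninner_label lab1) in hC.
rewrite (nouter_label lab2) (ninner_label lab2) in hC'.
(* One constant for both orders of the word; the added ones keep it positive even when C, C' or a
   vanishes. *)
have c0 : 0 < (C + C' + 1) * (a + 1) by rewrite mulr_gt0 // ltr_wpDl // addr_ge0.
exists ((C + C' + 1) * (a + 1)) => //.
move=> N N0; have dx := hx N0; have [d hd] := hC N N0; have [d' hd'] := hC' N N0.
(* The families in [hd] and [hd'] are constant, so any index serves to read off the bound. *)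
pose i0 : 'I_N := Ordinal N0; set K := _ / N%:R.
have NR : 0 < N%:R :> R by rewrite ltr0n.
have K0 : 0 < K by rewrite /K divr_gt0.
have sumx : X = \sum_i x N i by rewrite (decomposition_sum dx).
have marg := @iid_poisson R M phi tr 'I_N (fun=> sigma N) (x N) (sigma N) a.
have {}marg : forall (i : 'I_N) n, phi (x N i ^+ n) = (poisson_moment (sigma N ^+ 2)
  n)%:C%C.
  apply: marg => //.
  - by rewrite card_ord.
  - exact: decomposition_free dx.
  - exact: decomposition_same_distribution dx.
  - by rewrite sumr_const card_ord -mulr_natl sigmaE.
  - by move=> n; rewrite -sumx.
have CK C1 : 0 <= C1 -> C1 <= C + C' -> C1 * sigma N ^+ 2 <= K.
  move=> C10 C1C; rewrite /K ler_pdivlMr // -mulrA (mulrC _ N%:R) sigmaE //.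
  by apply: ler_pM => //; rewrite ?(le_trans C1C) ?lerDl ?lerDr.
set kappa := ((1 + a)%:C%C ^+ num_inner P).
have kE : kappa = ((1 + a) ^+ num_inner P)%:C%C by rewrite rmorphXn.
have sX : vn_star X = X.
  rewrite sumx star_sum; apply: eq_bigr => i _.
  exact: (decomposition_self_adjoint dx).
have repX : represents (x N) (fun=> sigma N) X (total_poisson (fun=> sigma N)).
  by rewrite sumx; exact: represents_sum.
have repk : represents (x N) (fun=> sigma N) (- (kappa *: X ^+ num_outer P))
    (fun f => - ((1 + a) ^+ num_inner P *: iter (num_outer P) (total_poisson (fun=>
      sigma N)) f)).
  have h := represents_scale (- (1 + a) ^+ num_inner P) (represents_exp (num_outer P) repX).
  rewrite rmorphN scaleNr /= -kE in h; case: h => l [h1 h2]; exists l; split=> // f.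
  by rewrite -h2 scaleNr.
apply: (represents_op_norm tr (decomposition_free dx) marg K0 (d := d) (d' := d')).
- by rewrite product_sumE //; apply: represents_add repk; exact: represents_colored_sum.
- rewrite starD starN kE starZ starX sX -kE star_product_sumE //; last first.
    exact: decomposition_self_adjoint dx.
  by apply: represents_add repk; exact: represents_colored_sum.
- apply: op_bounded_le (hd i0) => //; first by rewrite mulr_ge0 // sqr_ge0.
  by apply: CK; rewrite ?lerDl ?lerDr.
apply: op_bounded_le (hd' i0) => //; first by rewrite mulr_ge0 // sqr_ge0.
by apply: CK; rewrite ?lerDl ?lerDr.
Qed.

Lemma product_sum_cvg : is_product_measure P x
  ((1 + a)%:C%C ^+ num_inner P *: X ^+ num_outer P).
Proof.
have [c c0 hc] := product_sum_op_norm; apply/cvgrPdist_lt => e e0.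
exists (Num.truncn (c / e ^+ 2)).+1 => // N /= hN.
have N0 : (0 < N)%N by exact: leq_trans hN.
have /andP[h1 h2] := hc N N0; rewrite sub0r normrN ger0_norm //.
apply: le_lt_trans h2 _; rewrite -(ger0_norm (ltW e0)) -sqrtr_sqr ltr_sqrt ?exprn_gt0 //.
rewrite ltr_pdivrMr ?ltr0n // mulrC -ltr_pdivrMr ?exprn_gt0 //.
by apply: lt_le_trans (truncnS_gt _ ) _; rewrite ?num_real // ler_nat.
Qed.

End Convergence.

(** * Lengths of finite unions of intervals *)

Section Intervals.
Local Open Scope classical_set_scope.
Variable R : realType.
Implicit Types (p q : R * R) (s : seq (R * R)).

Definition ico p : set R := `[p.1, p.2[.
Definition unions s : set R := [set x | exists2 p, p \in s & ico p x].

Lemma icoE p x : ico p x <-> p.1 <= x /\ x < p.2.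
Proof. by rewrite /ico /= in_itv /=; split=> [/andP[]//|[-> ->]]. Qed.

Definition meets p q := (p.1 < q.2) && (q.1 < p.2).

Lemma meets_ico p q x : ico p x -> ico q x -> meets p q.
Proof. by move=> /icoE[p1 p2] /icoE[q1 q2]; rewrite /meets; lra. Qed.

Lemma unions_cons p s : unions (p :: s) = ico p `|` unions s.
Proof.
apply/seteqP; split=> x; first by case=> q; rewrite inE => /orP[/eqP ->|qs] qx;
  [left|right; exists q].
by case=> [px|[q qs qx]]; [exists p; rewrite ?mem_head|exists q; rewrite // inE qs orbT].
Qed.

(** An interval that meets p is removed and merged with it, and the merged interval is inserted into
    the shorter list. *)
Lemma insert_disjoint p s : p.1 < p.2 -> all (fun q => q.1 < q.2) s ->
  pairwise (fun q r => ~~ meets q r) s ->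
  exists s', [/\ all (fun q => q.1 < q.2) s', pairwise (fun q r => ~~ meets q r) s' &
    unions s' = ico p `|` unions s].
Proof.
have [n] := ubnP (size s); elim: n p s => // n IH p s sn pp sp sd.
have [/has_cat_split[s1 [q [s2 [sE mpq]]]]|] := boolP (has (meets p) s); last first.
  move=> /hasPn h; exists (p :: s); split; rewrite /= ?pp ?sp ?sd ?andbT //.
    by apply/allP.
  exact: unions_cons.
have [qq rest] : q.1 < q.2 /\ all (fun q => q.1 < q.2) (s1 ++ s2).
  by move: sp; rewrite sE !all_cat /= => /and3P[-> -> ->].
have rd : pairwise (fun q r => ~~ meets q r) (s1 ++ s2).
  move: sd; rewrite sE !pairwise_cat /= allrel_consr => /and3P[/andP[_ ->] -> /andP[_ ->]].
  by [].
have sz : (size (s1 ++ s2) < n)%N by move: sn; rewrite sE !size_cat /=; lia.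
pose r := (Num.min p.1 q.1, Num.max p.2 q.2).
have rr : r.1 < r.2 by rewrite /r /= lt_max gt_min pp.
have [s' [h1 h2 h3]] := IH r _ sz rr rest rd; exists s'; split=> //.
have rE : ico r = ico p `|` ico q.
  move: mpq => /andP[pq qp]; apply/seteqP; split=> x.
    move=> /icoE[]; rewrite /r /= ge_min lt_max => x1 x2.
    have [xp|px] := ltP x p.1.
      right; apply/icoE; split; last exact: lt_trans xp pq.
      by move: x1; rewrite leNgt xp.
    have [xp|xp] := ltP x p.2; first by left; apply/icoE.
    right; apply/icoE; split; first by apply: le_trans (ltW qp) xp.
    by move: x2; rewrite ltNge xp.
  by case=> /icoE[x1 x2]; apply/icoE; rewrite /r /= ge_min lt_max x1 x2 ?orbT.
rewrite h3 rE sE; apply/seteqP; split=> x.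
  case=> [[px|qx]|[t ts tx]]; [by left| |].
    by right; exists q => //; rewrite mem_cat mem_head orbT.
  right; exists t => //; move: ts; rewrite !mem_cat inE.
  by case/orP => ->; rewrite ?orbT.
case=> [px|[t ts tx]]; first by left; left.
move: ts; rewrite mem_cat inE => /or3P[ts|/eqP tq|ts].
- by right; exists t; rewrite // mem_cat ts.
- by left; right; rewrite -tq.
by right; exists t; rewrite // mem_cat ts orbT.
Qed.

Lemma disjoint_intervals s : all (fun q => q.1 < q.2) s ->
  exists s', [/\ all (fun q => q.1 < q.2) s', pairwise (fun q r => ~~ meets q r) s' &
    unions s' = unions s].
Proof.
elim: s => [|p s IH]; first by exists [::].
move=> /andP[pp /IH[s' [h1 h2 h3]]]; have [s'' [k1 k2 k3]] := insert_disjoint pp h1 h2.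
by exists s''; split=> //; rewrite k3 h3 unions_cons.
Qed.

(** The intervals that define A may overlap, whereas additivity and freeness of the process concern
    disjoint ones. *)
Lemma finite_union_disjoint (A : set R) : finite_union_half_open A ->
  exists (n : nat) (b : 'I_n -> R * R), [/\ forall j, (b j).1 < (b j).2,
    trivIset setT (fun j => ico (b j)) & A = \bigcup_j ico (b j)].
Proof.
move=> [n [I [hI ->]]].
have /fin_all_exists[e he] : forall j, exists p : R * R, p.1 < p.2 /\ I j = ico p.
  by move=> j; have [a [b [ab ->]]] := hI j; exists (a, b).
pose s := [seq e j | j <- enum 'I_n].
have sp : all (fun q => q.1 < q.2) s.
  by apply/allP => q qs; have [j _ ->] := mapP qs; have [] := he j.
have [s' [h1 h2 h3]] := disjoint_intervals sp.
exists (size s'), (fun j => nth (0, 0) s' j); split.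
- by move=> j; move/allP: h1; apply; exact: mem_nth.
- apply/trivIsetP => i j _ _ ij; apply/eqP/negPn/negP => /set0P[x [xi xj]].
  have /(pairwiseP (0, 0)) h2' := h2.
  have [lij|lji|/val_inj eij] := ltngtP i j; last by rewrite eij eqxx in ij.
    by move/negP: (h2' i j (ltn_ord i) (ltn_ord j) lij); apply; exact: meets_ico xi xj.
  by move/negP: (h2' j i (ltn_ord j) (ltn_ord i) lji); apply; exact: meets_ico xj xi.
have -> : \bigcup_j I j = unions s.
  apply/seteqP; split=> x.
    move=> [j _]; have [_ ->] := he j => xj; exists (e j) => //.
    by apply: map_f; rewrite mem_enum.
  by move=> [q qs qx]; have [j _ qe] := mapP qs; exists j => //; have [_ ->] := he j;
    rewrite -qe.
rewrite -h3; apply/seteqP; split=> x.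
  move=> [q qs qx]; have iq : (index q s' < size s')%N by rewrite index_mem.
  by exists (Ordinal iq) => //=; rewrite nth_index.
by move=> [j _ xj]; exists (nth (0, 0) s' j) => //; exact: mem_nth.
Qed.

Lemma total_length_ico p : p.1 < p.2 -> total_length (ico p) = p.2 - p.1.
Proof.
by move=> pp; rewrite /total_length /ico lebesgue_measure_itv /= lte_fin pp.
Qed.

Lemma total_length_bigcup n (b : 'I_n -> R * R) : (forall j, (b j).1 < (b j).2) ->
  trivIset setT (fun j => ico (b j)) ->
  total_length (\bigcup_j ico (b j)) = \sum_j ((b j).2 - (b j).1).
Proof.
move=> bp tb; rewrite /total_length measure_fin_bigcup //=; last first.
  by move=> j _; exact: measurable_itv.
have -> : [set: 'I_n] = [set` enum 'I_n].
  by apply/seteqP; split=> j //= _; rewrite mem_enum.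
rewrite -fsbig_seq ?enum_uniq // big_enum /=.
have -> : (\sum_j lebesgue_measure (ico (b j)))%E = (\sum_j ((b j).2 - (b j).1)%:E)%E.
  by apply: eq_bigr => j _; rewrite /ico lebesgue_measure_itv /= lte_fin bp EFinN EFinB.
by rewrite sumEFin.
Qed.

End Intervals.

(** On each disjoint interval the cumulants give the moments of a model letter whose rate is its
    length; the free sum over the intervals then has their total length as rate. *)
Lemma free_poisson_moment (R : realType) (M : von_neumann_algebra R)
    (phi : M -> R[i]) (X : set R -> M) (A : set R) :
  faithful_normal_tracial_state phi -> free_poisson_process phi X ->
  finite_union_half_open A -> 0 <= total_length A /\
  forall n, phi (X A ^+ n) = (poisson_moment (total_length A) n)%:C%C.
Proof.
move=> tr pX /finite_union_disjoint[n [b [bp tb ->]]].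
have ho j : half_open (ico (b j)) by exists (b j).1, (b j).2.
rewrite total_length_bigcup // (poisson_additive pX) //.
have b0 j : 0 <= (b j).2 - (b j).1 by rewrite subr_ge0 ltW.
split=> [|m]; first exact: sumr_ge0.
have sE j : Num.sqrt ((b j).2 - (b j).1) ^+ 2 = (b j).2 - (b j).1 by rewrite sqr_sqrtr.
have -> : \sum_j ((b j).2 - (b j).1) = \sum_j Num.sqrt ((b j).2 - (b j).1) ^+ 2.
  by apply: eq_bigr => j _; rewrite sE.
apply: (poisson_sum tr (poisson_free pX ho tb)) => j k; rewrite sE.
rewrite (poisson_cumulants pX (ho j)) total_length_ico // -noncrossing_moment rmorph_sum.
by apply: eq_bigr => P _; rewrite prodr_const rmorphXn.
Qed.

Theorem proposition3 (R : realType) (M : von_neumann_algebra R)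
    (phi : M -> R[i]) (X : set R -> M) (A : set R)
    (x : forall N : nat, 'I_N -> M) (k : nat) (P : {set {set 'I_k}}) :
  faithful_normal_tracial_state phi ->
  free_poisson_process phi X ->
  finite_union_half_open A ->
  (forall N : nat, (0 < N)%N -> free_iid_decomposition phi (X A) (x N)) ->
  noncrossing P ->
  separated_inner_classes P ->
  is_product_measure P x
    (((1 + total_length A)%:C)%C ^+ num_inner P *: X A ^+ num_outer P).
Proof.
move=> tr pX hA hx ncP sepP; have [a0 mX] := free_poisson_moment tr pX hA.
exact: (product_sum_cvg tr a0 mX hx ncP sepP).
Qed.
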